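(* Let $1<p<\infty$, $0<q<\infty$, let $a$ and $b$ be normal form parameters, and let $C>0$. (i) If, for all $t>0$, $$\int_{a^{-1}(t)}^\infty a(x)^q\,dx\le C\int_{b^{-1}(t)}^\infty b(x)^q\,dx,$$ then $N_{p,q}(a)\le C^{1/q}N_{p,q}(b)$. (ii) If $1<p\le q<\infty$ and $b$ is a normal form parameter, then $$\max\big((p/p')^{1/q}A_1,\;K_{p,q}A_1^{(0)},\;K_{p,q}A_1^{(\infty)}\big)\le N_{p,q}(b)\le K_{p,q}A_1.$$ (iii) If $1<p\le q<\infty$, $b$ is a normal form parameter, and $A_1^{(0)}=A_1$ or $A_1^{(\infty)}=A_1$, then $N_{p,q}(b)=K_{p,q}A_1$. Here, for $1<p\le q<\infty$ and a normal form parameter $b$, $$c_1(t)=t^{-1/p}\bigg(\frac{p'}p\int_{b^{-1}(t)}^\infty b(x)^q\,dx\bigg)^{1/q}$$ and $$A_1=\sup_{t>0}c_1(t),\quad A_1^{(0)}=\liminf_{t\to0^+}c_1(t),\quad A_1^{(\infty)}=\liminf_{t\to\infty}c_1(t).$$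
   Context: $L^+$ is the set of Lebesgue measurable functions $(0,\infty)\to[0,\infty]$ and $\|\cdot\|_p$ is the usual $L^p$ (quasi-)norm for Lebesgue measure on $(0,\infty)$; $p'$ denotes the conjugate exponent, $\frac1p+\frac1{p'}=1$. A normal form parameter is a non-increasing function $b:(0,\infty)\to[0,\infty]$; its generalized inverse is $b^{-1}(t)=\sup\{x>0:t<b(x)\}$ for $t>0$, with $\sup\emptyset=0$. Put $H_bf(x)=\int_0^{b(x)}f(t)\,dt$ for $f\in L^+$, and let $N_{p,q}(b)$ be the smallest constant $C$, finite or infinite, such that $\|H_bf\|_q\le C\|f\|_p$ for all $f\in L^+$; it is the operator norm of $H_b$ as a map from $L^p$ to $L^q$. For $1<p\le q<\infty$ the constant $K_{p,q}$ is $$K_{p,q}=p^{1/p}(p')^{1/p'}\ \text{ if }p=q,\qquad K_{p,q}=\Big(\frac{\Gamma(s)}{\Gamma(s/p)\Gamma(s/q')}\Big)^{1/s}\ \text{ if }p<q,\ \text{ where }\tfrac1s=\tfrac1p-\tfrac1q.$$ (By classical results of Hardy ($p=q$) and Bliss ($p<q$), $N_{p,q}(x^{-p'/q})=K_{p,q}$.)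
   Formalization: The parameter a in (i), and b in the upper bound of (ii) and in (iii), is assumed finite at every x>0; otherwise the claims fail, e.g. for the parameter equal to ∞ on (0,1) and 0 on [1,∞), whose tail integrals vanish while its norm N is ∞. *)

(* Defs.v *)
From HB Require Import structures.
From mathcomp Require Import all_boot all_order all_algebra.
From mathcomp Require Import all_classical all_reals all_analysis.
From mathcomp Require Import measurable_realfun.

Set Implicit Arguments.
Unset Strict Implicit.
Unset Printing Implicit Defensive.
Import Order.TTheory GRing.Theory Num.Theory.
Import numFieldNormedType.Exports.

Local Open Scope classical_set_scope.
Local Open Scope ring_scope.

(* R equipped with the sigma-algebra of Lebesgue measurable sets, the domain of
   completed_lebesgue_measure; its carrier is convertible to R. *)
Definition lebesgueType (R : realType) : measurableType _ :=
  caratheodory_type ((wlength (idfun : R -> R))^*)%mu.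

Definition leb (R : realType) : {measure set (lebesgueType R) -> \bar R} :=
  @completed_lebesgue_measure R.

(* Functions on (0, oo) are represented by functions on R whose values outside
   (0, oo) are never used. *)

Definition halfline (R : realType) : set R := `]0, +oo[.
Arguments halfline {R}.

Definition Lplus (R : realType) (f : R -> \bar R) : Prop :=
  measurable_fun (halfline : set (lebesgueType R))
    (f : lebesgueType R -> \bar R) /\
  (forall x : R, 0 < x -> (0 <= f x)%E).

Definition lintegral (R : realType) (D : set R) (f : R -> \bar R) : \bar R :=
  (\int[leb R]_(x in (D : set (lebesgueType R))) f x)%E.

(* the L^p (quasi-)norm on (0, oo), 0 < p < oo *)
Definition pnorm (R : realType) (p : R) (f : R -> \bar R) : \bar R :=
  Lnorm (leb R) p%:E (f \_ halfline).

Definition conjexp (R : realType) (p : R) : R := (1 - p^-1)^-1.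

Definition normal_form_parameter (R : realType) (b : R -> \bar R) : Prop :=
  (forall x : R, 0 < x -> (0 <= b x)%E) /\
  (forall x y : R, 0 < x -> x <= y -> (b y <= b x)%E).

Definition finite_valued (R : realType) (b : R -> \bar R) : Prop :=
  forall x : R, 0 < x -> (b x < +oo)%E.

(* 0 is adjoined since ereal_sup set0 = -oo, whereas sup of the empty set is 0
   here. *)
Definition geninv (R : realType) (b : R -> \bar R) (t : R) : \bar R :=
  ereal_sup ([set 0%E] `|` [set x%:E | x in [set x | 0 < x /\ (t%:E < b x)%E]]).

Definition Hardy (R : realType) (b : R -> \bar R) (f : R -> \bar R) (x : R) :
    \bar R :=
  lintegral [set t | 0 < t /\ (t%:E < b x)%E] f.

(* The infimum is attained; C = +oo is always admissible because +oo * 0 = 0 in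
   \bar R and pnorm p f = 0 forces Hardy b f to vanish. *)
Definition opnorm (R : realType) (p q : R) (b : R -> \bar R) : \bar R :=
  ereal_inf [set C : \bar R | (0 <= C)%E /\
    forall f, Lplus f -> (pnorm q (Hardy b f) <= C * pnorm p f)%E].

(* the integral of b^q over (b^{-1}(t), oo) *)
Definition tail_integral (R : realType) (q : R) (b : R -> \bar R) (t : R) :
    \bar R :=
  lintegral [set x | (geninv b t < x%:E)%E] (fun x => (b x `^ q)%E).

Definition Gamma (R : realType) (s : R) : R :=
  fine (lintegral halfline (fun t => (t `^ (s - 1) * expR (- t))%:E)).

(* The constant of the inequalities of Hardy (p = q) and Bliss (p < q). *)
Definition Kconst (R : realType) (p q : R) : R :=
  if p == q then p `^ p^-1 * conjexp p `^ (conjexp p)^-1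
  else let s := (p^-1 - q^-1)^-1 in
    (Gamma s / (Gamma (s / p) * Gamma (s / conjexp q))) `^ s^-1.

Definition c1 (R : realType) (p q : R) (b : R -> \bar R) (t : R) : \bar R :=
  ((t `^ (- p^-1))%:E *
   ((conjexp p / p)%:E * tail_integral q b t) `^ q^-1)%E.

Definition A1 (R : realType) (p q : R) (b : R -> \bar R) : \bar R :=
  ereal_sup [set c1 p q b t | t in halfline].

Definition A1_zero (R : realType) (p q : R) (b : R -> \bar R) : \bar R :=
  limf_einf (c1 p q b) 0^'+.

Definition A1_infty (R : realType) (p q : R) (b : R -> \bar R) : \bar R :=
  limf_einf (c1 p q b) +oo%R.

(* Main.v *)
(* A Hardy operator H_b sees a test function f only through its primitive, and
   replacing f by its decreasing rearrangement g can only increase the primitive.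
   For such g, with G its primitive, |H_b g|^q = (G(b)/b)^q b^q and y |-> G(y)/y is
   non-increasing, so the layer-cake formula bounds |H_a g|_q by |H_b g|_q as soon
   as the integrals of a^q over {a <= t} are dominated by those of b^q over
   {b <= t}: this is (i).  Comparing b in the same way with the power weight
   (q/p') y^(q/p-1) dy on (0, oo) reduces the upper bound in (ii) to the
   inequality of Hardy and Bliss, and comparing a piece [alpha, beta] of that
   weight with b, after a dilation, transplants near-extremals of that inequality
   to b and gives the lower bounds.

   The Hardy-Bliss inequality is proved by a calibration: along the primitive F of
   a smooth f an explicit expression in F(y), y and T(y) is monotone, where T(y) is
   the point at which Bliss's extremal has accumulated the same value of
   int F^q y^-m as F has at y.  The sharp constant is evaluated through the Beta
   integral. *)

Require Import Defs.
From HB Require Import structures.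
From mathcomp Require Import all_boot all_order all_algebra.
From mathcomp Require Import all_classical all_reals all_analysis.
From mathcomp Require Import measurable_realfun.
From mathcomp Require Import ring lra.
Import Order.TTheory GRing.Theory Num.Theory.
Import numFieldNormedType.Exports.
Local Open Scope classical_set_scope.
Local Open Scope ring_scope.

Set Implicit Arguments.
Unset Strict Implicit.
Unset Printing Implicit Defensive.

(** With q = p (1 + r) and m = 1 + q/p', the Hardy-Bliss inequality bounds the integral J of F^q
    y^-m by a constant times E^(1 + r), E being the integral of f^p. J has degree q in f and E
    degree p, so for r > 0 the two integrands alone cannot be compared pointwise. Moving the
    extremal to the point T(y) repairs this: once f is rescaled so that both values of J agree at
    the end, energies can be compared, and the rescaling is the source of the power 1 + r. For r = 0
    there is no extremal; T drops out of the calibration. At 0 the calibration needs F(y)/y between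
    two positive constants. Bounded non-increasing f with nonzero primitive provide this, and
    forward averages reach all others. The tail integrals do not see where b is infinite: if b = +oo
    on (0, 1) and b = 0 beyond, all of them vanish while H_b is unbounded. Hence [finite_valued] for
    the parameter whose norm is bounded from above; the lower bounds simply drop that set. *)

Definition below (R : realType) (e : \bar R) : set R :=
  [set t | 0 < t /\ (t%:E < e)%E].

(** * Lebesgue integral and layer-cake formula *)

Section LebesgueIntegral.
Context {R : realType}.
Notation mu := (@lebesgue_measure R).
Implicit Types (D A : set R) (f : R -> \bar R).

Lemma measurable_lebesgueType D : measurable D ->
  measurable (D : set (lebesgueType R)).
Proof. by move=> mD; exact: sub_caratheodory. Qed.

Lemma measurable_fun_lebesgueType D f : measurable D -> measurable_fun D f ->
  measurable_fun (D : set (lebesgueType R)) (f : lebesgueType R -> \bar R).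
Proof.
by move=> mD mf _ Y mY; apply: measurable_lebesgueType; exact: mf.
Qed.

(** [lintegral] lives on the completed sigma-algebra. The identity is measurable from there to the
    Borel sets and pushes [leb] forward to Lebesgue measure, so the integrals of a Borel function
    agree. After rearrangement only such functions remain. *)
Lemma lintegralE D f : measurable D -> measurable_fun D f ->
  (forall x, D x -> (0 <= f x)%E) -> lintegral D f = (\int[mu]_(x in D) f x)%E.
Proof.
move=> mD mf f0.
pose phi : lebesgueType R -> measurableTypeR R := idfun.
have mphi : measurable_fun setT phi.
  by move=> _ Y mY; rewrite setTI; exact: measurable_lebesgueType.
transitivity (\int[pushforward (leb R) phi]_(x in D) f x)%E; last first.
  exact: eq_measure_integral.
rewrite (ge0_integral_pushforward mphi)//.
by move=> y /set_mem /f0.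
Qed.

Lemma measurable_below (e : \bar R) : measurable (below e).
Proof.
rewrite /below (_ : [set y : R | _] = `]0, +oo[ `&` [set y | (y%:E < e)%E]).
  exact: measurable_lte.
by apply/seteqP; split => y /=; rewrite in_itv/= andbT.
Qed.

Lemma lebesgue_measure_below (e : \bar R) : (0 <= e)%E -> mu (below e) = e.
Proof.
move=> e0; rewrite /below.
have -> : [set y : R | 0 < y /\ (y%:E < e)%E] =
    [set` Interval (BRight 0) (match e with EFin r => BLeft r | +oo%E => +oo%O | -oo%E => -oo%O end)].
  apply/seteqP; split => y /=; rewrite in_itv/=; case: {e0} e => [r| |]/=.
    by rewrite lte_fin => -[-> ->].
    by case => ->.
    by rewrite ltNge -ltNge; case.
    by rewrite lte_fin => /andP[].
    by rewrite andbT ltry.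
    by rewrite andbF.
apply: (eq_trans (lebesgue_measure_itv _)) => /=.
case: e e0 => [r| |].
- rewrite lee_fin => r0.
  change ((if (0%:E < r%:E)%E then (r%:E + (- 0)%:E)%E else 0%E) = r%:E).
  rewrite lte_fin; case: ltP => [_|r1]; first by rewrite oppr0 adde0.
  by apply/eqP; rewrite eqe eq_le r0 r1.
- by move=> _ /=; rewrite ltry.
- by rewrite leNgt ltNye.
Qed.

End LebesgueIntegral.

Section LayerCake.
Context d (T : measurableType d) (R : realType).
Variables (m : {sigma_finite_measure set T -> \bar R}) (D : set T).
Variables (u h : T -> \bar R).
Hypotheses (mD : measurable D) (mu_ : measurable_fun D u)
  (mh : measurable_fun D h).
Hypotheses (u0 : forall x, D x -> (0 <= u x)%E)
  (h0 : forall x, D x -> (0 <= h x)%E).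
Notation mu := (@lebesgue_measure R).

(** Tonelli on the strict subgraph 0 < t < u(x) with density h: integrating in t first returns u(x),
    since [below e] has measure e even for e = +oo. *)
Lemma layer_cake :
  (\int[m]_(x in D) (u x * h x) =
   \int[mu]_(t in `]0%R, +oo[) \int[m]_(x in D `&` [set x | t%:E < u x]) h x)%E.
Proof.
pose A := [set z : T * measurableTypeR R | 0 < z.2 /\ (z.2%:E < (u \_ D) z.1)%E].
have mA : measurable A.
  have -> : A = [set z : T * measurableTypeR R | (0 < z.2%:E)%E] `&`
      [set z : T * measurableTypeR R | (z.2%:E < (u \_ D) z.1)%E].
    by apply/seteqP; split => z; rewrite /A/= lte_fin.
  have m2 : measurable_fun setT (fun z : T * measurableTypeR R => (z.2%:E : \bar R)).
    by apply: measurableT_comp => //; exact: measurable_snd.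
  apply: measurableI.
    rewrite -[X in measurable X]setTI; apply: measurable_lte => //.
  rewrite -[X in measurable X]setTI; apply: measurable_lte => //.
  apply: (measurableT_comp _ measurable_fst).
  exact/(measurable_restrictT u mD).1.
pose f (z : T * measurableTypeR R) : \bar R := ((h \_ D) z.1 * (\1_A z)%:E)%E.
have f0 z : (0 <= f z)%E.
  by rewrite /f mule_ge0//; apply: erestrict_ge0.
have mf : measurable_fun setT f.
  apply: emeasurable_funM.
    by apply: (measurableT_comp _ measurable_fst); exact/(measurable_restrictT h mD).1.
  by apply: measurableT_comp => //; exact: measurable_indic.
have := @fubini_tonelli _ _ _ _ R m mu f mf f0; rewrite /fubini_F /fubini_G.
move=> E.
transitivity (\int[m]_x \int[mu]_y f (x, y))%E.
  rewrite [LHS]integral_mkcond; apply: eq_integral => x _; rewrite !patchE; case: ifPn => xD; last first.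
    rewrite integral0_eq// => y _.
    by rewrite /f /= patchE (negbTE xD) mul0e.
  have Dx : D x by exact: set_mem.
  rewrite /f/=.
  under eq_integral do rewrite patchE xD muleC.
  rewrite ge0_integralZr//; last 2 first.
    apply/measurable_EFinP.
    exact: (measurableT_comp (measurable_indic mA) (pair1_measurable x)).
    exact: h0.
  congr (_ * _)%E; symmetry.
  transitivity (\int[mu]_y (\1_([set y : R | 0 < y /\ (y%:E < u x)%E]) y)%:E)%E.
    apply: eq_integral => y _; rewrite !indicE; congr ((_ : bool)%:R%:E).
    by apply/idP/idP => /set_mem/= yA; apply/mem_set; move: yA; rewrite /A/= patchE xD.
  rewrite integral_indic//; last exact: measurable_below.
  by rewrite setIT; apply: lebesgue_measure_below; exact: u0.
rewrite E [RHS]integral_mkcond; apply: eq_integral => t _.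
rewrite !patchE; case: ifPn => [|] t0; last first.
  rewrite integral0_eq// => x _; rewrite /f indicE memNset ?mule0//= => -[t1 _].
  by move/negP : t0; apply; apply/mem_set => /=; rewrite in_itv/= t1.
move: t0 => /set_mem/=; rewrite in_itv/= andbT => t0.
rewrite [RHS]integral_mkcond; apply: eq_integral => x _.
rewrite /f/= !patchE indicE.
case: ifPn => xD; last first.
  by rewrite mul0e memNset// => -[/mem_set]; rewrite (negbTE xD).
have [ut|ut] := boolP (t%:E < u x)%E.
  rewrite mem_set ?mule1; last by rewrite /A/= patchE xD.
  by rewrite mem_set//; split => //; exact: set_mem.
rewrite memNset ?mule0; last by rewrite /A/= patchE xD => -[]; rewrite (negbTE ut).
by rewrite memNset// => -[_]/=; rewrite (negbTE ut).
Qed.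

End LayerCake.

Lemma layer_cake1 d (T : measurableType d) (R : realType)
    (m : {sigma_finite_measure set T -> \bar R}) (D : set T) (u : T -> \bar R) :
  measurable D -> measurable_fun D u -> (forall x, D x -> (0 <= u x)%E) ->
  (\int[m]_(x in D) u x =
   \int[@lebesgue_measure R]_(t in `]0%R, +oo[) m (D `&` [set x | t%:E < u x]))%E.
Proof.
move=> mD mu0 u0.
transitivity (\int[m]_(x in D) (u x * cst 1%E x))%E.
  by apply: eq_integral => x _; rewrite /= mule1.
rewrite layer_cake//; apply: eq_integral => t _.
by rewrite integral_cst ?mul1e//; exact: measurable_lte.
Qed.

Lemma nonincreasing_emeasurable (R : realType) (f : R -> \bar R) :
  (forall x y, 0 < x -> x <= y -> (f y <= f x)%E) ->
  measurable_fun (`]0, +oo[ : set R) f.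
Proof.
move=> nf mD; apply: (measurability _ (ErealGenOInfty.measurableE R)) => //.
move=> _ [_ [r ->] <-]; apply: is_interval_measurable => x y.
rewrite /= !in_itv/= !andbT => -[x0 rx] [y0 ry] z /andP[xz zy].
split; first by rewrite in_itv/= andbT (lt_le_trans x0).
by rewrite in_itv/= andbT (lt_le_trans ry)// nf// (lt_le_trans x0).
Qed.

(** The superlevel sets of a monotone function are open or closed initial segments, possibly all of
    (0, oo), while the comparison hypothesis speaks only of closed bounded ones. An increasing union
    bridges the gap. *)
Lemma initial_segment_bigcup (R : realType) (S : set R) :
  S `<=` `]0, +oo[%classic -> (forall x y, 0 < x -> x <= y -> S y -> S x) ->
  S = set0 \/ exists t : nat -> R,
    [/\ forall n, 0 < t n, nondecreasing_seq t & S = \bigcup_n `]0, t n]%classic].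
Proof.
move=> S0 Sdown.
have pos x : S x -> 0 < x by move=> /S0; rewrite /= in_itv/= andbT.
have [->|/set0P[x0 Sx0]] := eqVneq S set0; [by left|right].
have [[c [Sc cmax]]|nomax] := pselect (exists c, S c /\ forall x, S x -> x <= c).
  exists (fun=> c); split => // [n|]; first exact: pos.
  apply/seteqP; split => x /=.
    by move=> Sx; exists 0 => //=; rewrite in_itv/= pos//= cmax.
  by move=> [_ _ /=]; rewrite in_itv/= => /andP[x0' xc]; exact: Sdown Sc.
have [bS|ubS] := pselect (has_ubound S).
  have supS : has_sup S by split => //; exists x0.
  pose c := sup S.
  have lec x : S x -> x <= c by move=> Sx; exact: ub_le_sup.
  have ltc x : S x -> x < c.
    move=> Sx; rewrite lt_neqAle lec// andbT; apply/eqP => xc.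
    by apply: nomax; exists x; split => // y /lec; rewrite xc.
  have c0 : 0 < c by rewrite (lt_trans (pos _ Sx0))// ltc.
  have tlt1 n : n.+2%:R^-1 < 1 :> R by rewrite invf_lt1 ?ltr1n// ltr0n.
  (* [n.+2] instead of [n.+1] keeps the term for n = 0 positive. *)
  exists (fun n => c * (1 - n.+2%:R^-1)); split.
  - by move=> n; rewrite mulr_gt0// subr_gt0.
  - move=> m n mn; rewrite ler_pM2l// lerD2l lerN2 lef_pV2 ?posrE ?ltr0n//.
    by rewrite ler_nat.
  - apply/seteqP; split => x /=.
      move=> Sx; have xc := ltc _ Sx.
      have [k hk] : exists k : nat, (1 - x / c)^-1 < k%:R.
        by exists (Num.truncn (1 - x / c)^-1).+1; exact: truncnS_gt.
      exists k => //=; rewrite in_itv/= pos//=.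
      have d0 : 0 < 1 - x / c by rewrite subr_gt0 ltr_pdivrMr// mul1r.
      rewrite mulrC -ler_pdivrMr// lerBrDr -lerBrDl.
      rewrite invf_ple ?posrE ?ltr0n// (le_trans (ltW hk))// ler_nat.
      by rewrite (leq_trans (leqnSn _)).
    move=> [n _ /=]; rewrite in_itv/= => /andP[x_gt0 xt].
    have tc : c * (1 - n.+2%:R^-1) < c.
      by rewrite gtr_pMr// gtrBl invr_gt0 ltr0n.
    have e0 : 0 < c - c * (1 - n.+2%:R^-1) by rewrite subr_gt0.
    have [y Sy] := sup_adherent e0 supS.
    rewrite -/c opprB addrC subrK => ty.
    by apply: Sdown Sy => //; rewrite (le_trans xt)// ltW.
exists (fun n => n.+1%:R); split.
- by move=> n; rewrite ltr0n.
- by move=> m n mn; rewrite ler_nat.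
- apply/seteqP; split => x /=.
    move=> Sx; exists (Num.truncn x) => //=; rewrite in_itv/= pos//=.
    by rewrite ltW// truncnS_gt.
  move=> [n _ /=]; rewrite in_itv/= => /andP[x_gt0 xn].
  have [y [Sy ny]] : exists y, S y /\ n.+1%:R < y.
    apply: contrapT => /forallNP nS; apply: ubS; exists n.+1%:R => y Sy.
    by rewrite leNgt; apply/negP => ny; exact: nS (conj Sy ny).
  by apply: Sdown Sy => //; rewrite (le_trans xn)// ltW.
Qed.

(** * Comparison principle for non-increasing integrands *)

Section Comparison.
Context d1 d2 (T1 : measurableType d1) (T2 : measurableType d2) (R : realType).
Variables (m1 : {sigma_finite_measure set T1 -> \bar R})
  (m2 : {sigma_finite_measure set T2 -> \bar R}).
Variables (D1 : set T1) (D2 : set T2) (a1 : T1 -> R) (a2 : T2 -> R).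
Variables (h1 : T1 -> \bar R) (h2 : T2 -> \bar R) (C : R).
Hypotheses (mD1 : measurable D1) (mD2 : measurable D2).
Hypotheses (ma1 : measurable_fun D1 a1) (ma2 : measurable_fun D2 a2).
Hypotheses (mh1 : measurable_fun D1 h1) (mh2 : measurable_fun D2 h2).
Hypotheses (a10 : forall x, D1 x -> 0 < a1 x) (a20 : forall x, D2 x -> 0 < a2 x).
Hypotheses (h10 : forall x, D1 x -> (0 <= h1 x)%E)
  (h20 : forall x, D2 x -> (0 <= h2 x)%E).
Hypothesis C0 : 0 <= C.
Hypothesis cmp : forall t, 0 < t ->
  (\int[m1]_(x in D1 `&` [set x | (a1 x <= t)%R]) h1 x <=
   C%:E * \int[m2]_(x in D2 `&` [set x | (a2 x <= t)%R]) h2 x)%E.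

Let cmpS (S : set R) : S `<=` `]0, +oo[%classic ->
  (forall x y, 0 < x -> x <= y -> S y -> S x) ->
  (\int[m1]_(x in D1 `&` [set x | S (a1 x)]) h1 x <=
   C%:E * \int[m2]_(x in D2 `&` [set x | S (a2 x)]) h2 x)%E.
Proof.
move=> S0 /(initial_segment_bigcup S0)[->|[t [t0 tnd ->]]].
  have -> : D1 `&` [set x | set0 (a1 x)] = set0 by apply/seteqP; split => x [].
  rewrite integral_set0 mule_ge0 ?lee_fin//.
  by apply: integral_ge0 => x [].
have E1 : D1 `&` [set x | (\bigcup_n `]0, t n]%classic) (a1 x)] =
    \bigcup_n (D1 `&` [set x | a1 x <= t n]).
  rewrite -setI_bigcupr; apply/seteqP; split => x [Dx [n _ /= xn]]; split => //; exists n => //=.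
    by move: xn; rewrite in_itv/= => /andP[].
  by rewrite in_itv/= a10.
have mle d' (T : measurableType d') (D : set T) (a : T -> R) n :
    measurable D -> measurable_fun D a -> measurable (D `&` [set x | a x <= t n]).
  move=> mD ma; rewrite (_ : [set _ | _] = a @^-1` `]-oo, t n]); first exact: ma.
  by apply/seteqP; split => x /=; rewrite in_itv.
rewrite E1.
have /cvg_lim <- // : (\int[m1]_(x in D1 `&` [set x | (a1 x <= t n)%R]) h1 x)%E @[n --> \oo]
    --> (\int[m1]_(x in \bigcup_n (D1 `&` [set x | (a1 x <= t n)%R])) h1 x)%E.
  apply: ge0_nondecreasing_set_cvg_integral.
  - move=> i j ij; apply/subsetPset => x [Dx /= xi]; split => //=.
    by rewrite (le_trans xi)// tnd.
  - by move=> i; exact: mle.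
  - by move=> i; apply: measurable_funS mh1 => // x [].
  - by move=> i x [+ _]; exact: h10.
apply: lime_le.
  apply: ereal_nondecreasing_is_cvgn.
  apply: ge0_nondecreasing_set_nondecreasing_integral.
  - move=> i j ij; apply/subsetPset => x [Dx /= xi]; split => //=.
    by rewrite (le_trans xi)// tnd.
  - by move=> i; exact: mle.
  - by move=> i; apply: measurable_funS mh1 => // x [].
  - by move=> i x [+ _]; exact: h10.
apply: nearW => n; rewrite (le_trans (cmp (t0 n)))//.
rewrite lee_wpmul2l ?lee_fin//; apply: ge0_subset_integral.
- exact: mle.
- have -> : D2 `&` [set x | (\bigcup_n `]0, t n]%classic) (a2 x)] =
      \bigcup_n (D2 `&` [set x | a2 x <= t n]).
    rewrite -setI_bigcupr; apply/seteqP; split => x [Dx [k _ /= xn]]; split => //; exists k => //=.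
      by move: xn; rewrite in_itv/= => /andP[].
    by rewrite in_itv/= a20.
  by apply: bigcupT_measurable => k; exact: mle.
- by apply: measurable_funS mh2 => // x [].
- by move=> x [+ _]; exact: h20.
- by move=> x [Dx /= xn]; split => //=; exists n => //=; rewrite in_itv/= a20.
Qed.

(** Layer cake in the values of phi: each set where phi exceeds t is an initial segment, and [cmpS]
    extends the hypothesis to such segments by monotone convergence. The two spaces and the maps
    [a1], [a2] are unrelated, so the same statement compares two parameters, compares a parameter
    with a power weight, and serves as a change of variables. *)
Lemma comparison (phi : R -> \bar R) : (forall x, 0 < x -> (0 <= phi x)%E) ->
  (forall x y, 0 < x -> x <= y -> (phi y <= phi x)%E) ->
  (\int[m1]_(x in D1) (phi (a1 x) * h1 x) <=
   C%:E * \int[m2]_(x in D2) (phi (a2 x) * h2 x))%E.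
Proof.
move=> phi0 nphi.
have mphi d' (T : measurableType d') (D : set T) (a : T -> R) :
    measurable D -> measurable_fun D a -> (forall x, D x -> 0 < a x) ->
    measurable_fun D (phi \o a).
  move=> mD ma a0; apply: (@measurable_comp _ _ _ _ _ _ (`]0%R, +oo[%classic : set R) phi D a) => //.
    by move=> _ [x Dx <-] /=; rewrite in_itv/= andbT a0.
  exact: nonincreasing_emeasurable.
rewrite (layer_cake _ mD1 (mphi _ _ _ _ mD1 ma1 a10) mh1)//; last first.
  by move=> x Dx /=; apply: phi0; exact: a10.
rewrite (layer_cake _ mD2 (mphi _ _ _ _ mD2 ma2 a20) mh2)//; last first.
  by move=> x Dx /=; apply: phi0; exact: a20.
have mlt d' (T : measurableType d') (D : set T) (a : T -> R) (t : R) :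
    measurable D -> measurable_fun D a -> (forall x, D x -> 0 < a x) ->
    measurable (D `&` [set x | (t%:E < phi (a x))%E]).
  by move=> mD ma a0; apply: measurable_lte => //; exact: mphi.
have nG d' (T : measurableType d') (m : {measure set T -> \bar R}) (D : set T)
    (a : T -> R) (h : T -> \bar R) : measurable D -> measurable_fun D a ->
    measurable_fun D h -> (forall x, D x -> 0 < a x) ->
    (forall x, D x -> (0 <= h x)%E) ->
    measurable_fun (`]0%R, +oo[ : set R)
      (fun t : R => \int[m]_(x in D `&` [set x | (t%:E < phi (a x))%E]) h x)%E.
  move=> mD ma mh a0 h0; apply: nonincreasing_emeasurable => s t s0 st.
  apply: ge0_subset_integral.
  - exact: mlt.
  - exact: mlt.
  - by apply: measurable_funS mh => // x [].
  - by move=> x [+ _]; exact: h0.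
  - by move=> x [Dx /= tx]; split => //=; rewrite (le_lt_trans _ tx)// lee_fin.
rewrite -ge0_integralZl//; last 2 first.
- exact: (nG _ _ m2 D2 a2 h2).
- by move=> t _; apply: integral_ge0 => x [+ _]; exact: h20.
apply: ge0_le_integral => //.
- by move=> t _; apply: integral_ge0 => x [+ _]; exact: h10.
- exact: (nG _ _ m1 D1 a1 h1).
- by apply: emeasurable_funM => //; exact: (nG _ _ m2 D2 a2 h2).
move=> t _.
pose S := [set y : R | 0 < y /\ (t%:E < phi y)%E].
have ES d' (T : measurableType d') (D : set T) (a : T -> R) :
    (forall x, D x -> 0 < a x) ->
    D `&` [set x | (t%:E < (phi \o a) x)%E] = D `&` [set x | S (a x)].
  move=> a0; apply/seteqP; split => x [Dx /= tx]; split => //=.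
    by split => //; exact: a0.
  by case: tx.
rewrite !ES//; apply: cmpS; first by move=> x [x0 _] /=; rewrite in_itv/= andbT.
by move=> x y x0 xy [y0 ty]; split => //; rewrite (lt_le_trans ty)// nphi.
Qed.

End Comparison.

Lemma lt_poweR (R : realType) (p t : R) (x : \bar R) : 0 < p -> 0 < t -> (0 <= x)%E ->
  (t%:E < x `^ p)%E = ((t `^ p^-1)%:E < x)%E.
Proof.
move=> p0 t0; case: x => [r| |]//=.
- rewrite lee_fin => r0; rewrite !lte_fin; apply/idP/idP => h.
    have := gt0_ltr_powR (r := p^-1); rewrite invr_gt0 => /(_ p0 t (r `^ p)).
    rewrite !nnegrE ltW// powR_ge0 => /(_ isT isT h).
    by rewrite -powRrM divff ?gt_eqF// powRr1.
  have := gt0_ltr_powR p0; move=> /(_ (t `^ p^-1) r).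
  rewrite !nnegrE powR_ge0 r0 => /(_ isT isT h).
  by rewrite -powRrM mulVf ?gt_eqF// powRr1// ltW.
- by move=> _; rewrite gt_eqF// !ltry.
Qed.

(** * Decreasing rearrangement *)

Section Rearrangement.
Context {R : realType}.
Notation mu := (@lebesgue_measure R).
Variable f : R -> \bar R.
Hypothesis Lf : Lplus f.

Let T := lebesgueType R.
Let D : set T := halfline.
Let m := leb R.

Let mD : measurable D.
Proof. by apply: measurable_lebesgueType; exact: measurable_itv. Qed.

Let mf : measurable_fun D (f : T -> \bar R). Proof. by case: Lf. Qed.

Let f0 x : 0 < x -> (0 <= f x)%E. Proof. by case: Lf => _; exact. Qed.

Let Dpos (x : R) : D x -> 0 < x.
Proof. by rewrite /D /halfline/= in_itv/= andbT. Qed.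

Definition distribution_function (t : R) : \bar R :=
  leb R ((halfline : set (lebesgueType R)) `&` [set x | (t%:E < f x)%E]).
Notation dist := distribution_function.

Let mlt (t : \bar R) : measurable (D `&` [set x | (t < f x)%E]).
Proof. exact: measurable_lte. Qed.

Let dist_nincr s t : s <= t -> (dist t <= dist s)%E.
Proof.
move=> st; apply: le_measure; rewrite ?inE; [exact: mlt|exact: mlt|].
by move=> x [Dx /= tx]; split => //=; rewrite (le_lt_trans _ tx)// lee_fin.
Qed.

(** Right continuity of the distribution function, by continuity of the measure from below. It makes
    [g_gt] an equivalence between strict inequalities. *)
Let dist_rcont (s t : R) : (s%:E < dist t)%E -> exists2 t', t < t' & (s%:E < dist t')%E.
Proof.
pose F n := D `&` [set x | ((t + n.+1%:R^-1)%:E < f x)%E].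
have ndF : nondecreasing_seq F.
  move=> i j ij; apply/subsetPset => x [Dx /= tx]; split => //=.
  by rewrite (le_lt_trans _ tx)// lee_fin lerD2l lef_pV2 ?posrE ?ltr0n// ler_nat.
have FE : \bigcup_n F n = D `&` [set x | (t%:E < f x)%E].
  apply/seteqP; split => x.
    move=> [n _ [Dx /= tx]]; split => //=; rewrite (le_lt_trans _ tx)//.
    by rewrite lee_fin lerDl invr_ge0 ler0n.
  move=> [Dx /= tx]; case fx: (f x) tx => [r| |]// tx.
    move: tx; rewrite lte_fin -subr_gt0 => rt.
    exists (Num.truncn (r - t)^-1) => //; split => //=.
    rewrite fx lte_fin -ltrBrDl invf_plt ?posrE ?ltr0n//.
    exact: truncnS_gt.
  by exists 0%N => //; split => //=; rewrite fx ltry.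
have := @nondecreasing_cvg_mu _ _ _ m F (fun n => mlt _).
rewrite FE => /(_ (mlt _) ndF) /cvg_lim Fl.
rewrite /dist -Fl// => slt.
have [n _ sn] : exists2 n, True & (s%:E < m (F n))%E.
  apply: contrapT => nF; move: slt; apply/negP; rewrite -leNgt.
  apply: lime_le.
    apply: ereal_nondecreasing_is_cvgn => i j ij.
    by apply: le_measure; rewrite ?inE; [exact: mlt|exact: mlt|exact/subsetPset/ndF].
  apply: nearW => n /=; rewrite leNgt; apply/negP => sn.
  by apply: nF; exists n.
by exists (t + n.+1%:R^-1) => //; rewrite ltrDl invr_gt0 ltr0n.
Qed.

(** The decreasing rearrangement of f. *)
Let g := geninv dist.

Let g_gt s t : 0 < t -> (t%:E < g s)%E = (s%:E < dist t)%E.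
Proof.
move=> t0; apply/idP/idP.
  move=> /ereal_sup_gt[_ [->|[t' [t'0 /= st'] <-]]] /=.
    by rewrite lte_fin ltNge ltW.
  by rewrite lte_fin => tt'; rewrite (lt_le_trans st')// dist_nincr// ltW.
move=> /dist_rcont[t' tt' st']; rewrite (@lt_le_trans _ _ t'%:E)//.
by apply: ereal_sup_ubound; right; exists t' => //=; rewrite (lt_trans t0).
Qed.

Let g_ge0 s : (0 <= g s)%E.
Proof. by apply: ereal_sup_ubound; left. Qed.

Let g_nincr s t : s <= t -> (g t <= g s)%E.
Proof.
move=> st; apply: ereal_sup_le => y [->|[x [x0 /= tx] <-]]; first by left.
by right; exists x => //; split => //=; rewrite (le_lt_trans _ tx)// lee_fin.
Qed.

Let mg : measurable_fun (`]0%R, +oo[ : set R) g.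
Proof. by apply: nonincreasing_emeasurable => x y _; exact: g_nincr. Qed.

Let dist_ge0 t : (0 <= dist t)%E. Proof. exact: measure_ge0. Qed.

Let measure_g (t : R) : 0 < t ->
  mu ((`]0%R, +oo[ : set R) `&` [set s | (t%:E < g s)%E]) = dist t.
Proof.
move=> t0; rewrite -[RHS]lebesgue_measure_below//; congr (mu _).
apply/seteqP; split => s /=; rewrite in_itv/= andbT g_gt//.
Qed.

(** By [g_gt], g exceeds t exactly on (0, dist t), so f and g are equimeasurable and have the same
    p-integral. Inside (0, e) the set where f exceeds t has measure at most e and at most [dist t];
    for g it is the minimum of the two. *)
Lemma rearrangement (p : R) : 0 < p -> exists g : R -> \bar R,
  [/\ forall s, (0 <= g s)%E, forall s t, s <= t -> (g t <= g s)%E,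
      forall e : \bar R, (0 <= e)%E ->
        (lintegral (below e) f <=
        \int[mu]_(t in below e) g t)%E &
      (lintegral halfline (fun x => f x `^ p) =
        \int[mu]_(x in `]0%R, +oo[) g x `^ p)%E].
Proof.
move=> p0; exists g; split => //.
- move=> e e0.
  pose De : set R := below e.
  have mDe : measurable De by exact: measurable_below.
  have mDe' : measurable (De : set T) by exact: measurable_lebesgueType.
  have mfe : measurable_fun (De : set T) (f : T -> \bar R).
    by apply: measurable_funS mf => // x [x0 _]; rewrite /D /halfline/= in_itv/= x0.
  have mge : measurable_fun De g.
    by apply: measurable_funS mg => // x [x0 _] /=; rewrite in_itv/= x0.
  rewrite /lintegral -/De.
  rewrite (layer_cake1 m mDe' mfe)//; last by move=> x [x0 _]; exact: f0.
  rewrite (layer_cake1 mu mDe mge)//.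
  have mfet (t : R) : measurable ((De : set T) `&` [set x | (t%:E < f x)%E]).
    exact: measurable_lte.
  have mget (t : R) : measurable (De `&` [set x | (t%:E < g x)%E]).
    exact: measurable_lte.
  apply: ge0_le_integral => //.
  + apply: nonincreasing_emeasurable => s t s0 st.
    apply: le_measure; rewrite ?inE//.
    by move=> x [Dx /= tx]; split => //=; rewrite (le_lt_trans _ tx)// lee_fin.
  + apply: nonincreasing_emeasurable => s t s0 st.
    apply: le_measure; rewrite ?inE; [exact: mget|exact: mget|].
    by move=> x [Dx /= tx]; split => //=; rewrite (le_lt_trans _ tx)// lee_fin.
  + move=> t /=; rewrite in_itv/= andbT => t0.
    have -> : De `&` [set x | (t%:E < g x)%E] =
        below (Order.min e (dist t)).
      apply/seteqP; split => s; rewrite /De /below /= lt_min g_gt//.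
        by move=> [[-> ->] ->].
      by move=> [-> /andP[-> ->]].
    rewrite [leRHS]lebesgue_measure_below; last by rewrite le_min e0 dist_ge0.
    rewrite le_min; apply/andP; split.
      rewrite -[leRHS]lebesgue_measure_below//.
      apply: (@le_measure _ _ _ m); rewrite ?inE; [exact: mfet|exact: mDe'|].
      by move=> x [].
    apply: (@le_measure _ _ _ m); rewrite ?inE; [exact: mfet|exact: mlt|].
    by move=> x [[x0 _] tx]; split => //; rewrite /D /halfline/= in_itv/= x0.
- rewrite /lintegral.
  rewrite (layer_cake1 m mD (measurableT_comp (measurable_poweR p) mf))//; last first.
    by move=> x _; exact: poweR_ge0.
  rewrite (layer_cake1 mu _ (measurableT_comp (measurable_poweR p) mg))//; last first.
    by move=> x _; exact: poweR_ge0.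
  apply: eq_integral => t; rewrite inE/= in_itv/= andbT => t0.
  have tp : 0 < t `^ p^-1 by rewrite powR_gt0.
  transitivity (dist (t `^ p^-1)).
    congr (m _); apply/seteqP; split => x [Dx /=].
      by rewrite lt_poweR//; exact/f0/Dpos.
    by rewrite -lt_poweR//; exact/f0/Dpos.
  rewrite -measure_g//; congr (mu _); apply/seteqP; split => x [Dx /=].
    by rewrite -lt_poweR.
  by rewrite lt_poweR.
Qed.

End Rearrangement.

Lemma poweR_le (R : realType) (p : R) (x y : \bar R) : 0 <= p -> (0 <= x)%E ->
  (x <= y)%E -> (x `^ p <= y `^ p)%E.
Proof.
move=> p0 x0 xy; apply: gt0_ler_poweR => //; rewrite in_itv/= ?x0 leey ?andbT//.
exact: le_trans xy.
Qed.

Lemma poweRVK (R : realType) (p : R) (x : \bar R) : 0 < p -> (0 <= x)%E ->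
  ((x `^ p^-1) `^ p = x)%E.
Proof. by move=> p0 x0; rewrite -poweRrM mulVf ?gt_eqF// poweRe1. Qed.

Lemma poweRKV (R : realType) (p : R) (x : \bar R) : 0 < p -> (0 <= x)%E ->
  ((x `^ p) `^ p^-1 = x)%E.
Proof. by move=> p0 x0; rewrite -poweRrM divff ?gt_eqF// poweRe1. Qed.

(** * Comparison of Hardy operators *)

Section Operator.
Context {R : realType}.
Notation mu := (@lebesgue_measure R).
Implicit Types (b f g : R -> \bar R).

Lemma measurable_halfline : measurable (@halfline R).
Proof. exact: measurable_itv. Qed.

Lemma halflineP (x : R) : halfline x <-> 0 < x.
Proof. by rewrite /halfline/= in_itv/= andbT. Qed.

Lemma pnormE (p : R) f : 0 < p -> (forall x, 0 < x -> (0 <= f x)%E) ->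
  pnorm p f = ((lintegral halfline (fun x => f x `^ p)) `^ p^-1)%E.
Proof.
move=> p0 f0; rewrite /pnorm unlock /lintegral [in RHS]integral_mkcond.
congr (_ `^ _)%E; apply: eq_integral => x _; rewrite !patchE.
case: ifPn => [/set_mem/halflineP x0|_]; first by rewrite gee0_abs ?f0.
by rewrite abse0 poweR0r// gt_eqF.
Qed.

Lemma measurable_normal_form b : normal_form_parameter b ->
  measurable_fun (`]0%R, +oo[ : set R) b.
Proof. by move=> [_ nb]; exact: nonincreasing_emeasurable. Qed.

(** The points where [fine (b x)] is a faithful positive real, as [comparison] demands. Zeros of b
    add nothing to integrals of b^q, and points with b = +oo lie in no tail. *)
Definition finite_positive_set b : set R := [set x | 0 < x /\ (0 < b x < +oo)%E].

Lemma measurable_finite_positive_set b : normal_form_parameter b ->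
  measurable (finite_positive_set b).
Proof.
move=> nb; rewrite (_ : finite_positive_set b =
   (`]0, +oo[ `&` [set x | (0 < b x)%E]) `&` (`]0, +oo[ `&` [set x | (b x < +oo)%E])).
  by apply: measurableI; apply: measurable_lte => //; exact: measurable_normal_form.
apply/seteqP; split => x; rewrite /finite_positive_set /= !in_itv/= !andbT.
  by move=> [x0 /andP[]].
by move=> [[x0 ->] [_ ->]].
Qed.

Lemma geninv_ge0 b t : (0 <= geninv b t)%E.
Proof. by apply: ereal_sup_ubound; left. Qed.

Lemma lt_geninv b (t x : R) : 0 < x -> (geninv b t < x%:E)%E -> (b x <= t%:E)%E.
Proof.
move=> x0 gx; rewrite leNgt; apply/negP => tb; move: gx; apply/negP; rewrite -leNgt.
by apply: ereal_sup_ubound; right; exists x.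
Qed.

Lemma geninv_le b (t x : R) : normal_form_parameter b -> 0 < x ->
  (b x <= t%:E)%E -> (geninv b t <= x%:E)%E.
Proof.
move=> [_ nb] x0 bx; apply: ge_ereal_sup => _ [->|[y [y0 /= ty] <-]].
  by rewrite lee_fin ltW.
rewrite lee_fin leNgt; apply/negP => xy.
by move: ty; rewrite ltNge (le_trans _ bx)// nb// ltW.
Qed.

(** The ray beyond [geninv b t] and the set where b <= t differ at most by the end point, which
    belongs to the latter or not according to the one-sided continuity of b. Discarding zeros of b
    does not change the integral. *)
Lemma tail_integralE (q : R) b (t : R) : 0 < q -> normal_form_parameter b -> 0 < t ->
  tail_integral q b t =
  (\int[mu]_(x in finite_positive_set b `&` [set x | (fine (b x) <= t)%R]) b x `^ q)%E.
Proof.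
move=> q0 nfb t0; have [b0 nb] := nfb.
have mbq : measurable_fun (`]0%R, +oo[ : set R) (fun x => b x `^ q)%E.
  exact: (measurableT_comp (measurable_poweR q) (measurable_normal_form nfb)).
pose S : set R := [set x | 0 < x /\ (b x <= t%:E)%E].
transitivity (\int[mu]_(x in S) b x `^ q)%E; last first.
  rewrite [LHS]integral_mkcond [RHS]integral_mkcond; apply: eq_integral => x _.
  rewrite !patchE; case: ifPn => [/set_mem[x0 bx]|xS].
    case: ifPn => // /negP xF; have [->|bx0] := eqVneq (b x) 0%E.
      by rewrite poweR0r// gt_eqF.
    exfalso; apply: xF; apply/mem_set; rewrite /finite_positive_set/=.
    have bxy : (b x < +oo)%E by rewrite (le_lt_trans bx)// ltry.
    split; first by split => //; rewrite lt_neqAle eq_sym bx0 b0.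
    by rewrite /= -lee_fin fineK// ge0_fin_numE// b0.
  case: ifPn => // /set_mem[[x0 /andP[bx0 bxy]] /= bt]; exfalso.
  move/negP : xS; apply; apply/mem_set; split => //.
  by rewrite -(@fineK _ (b x)) ?lee_fin// ge0_fin_numE// b0.
have S_itv : [set x | (geninv b t < x%:E)%E] `<=` S.
  move=> x /= gx; have x0 : 0 < x by rewrite -lte_fin (le_lt_trans (geninv_ge0 b t)).
  by split => //; exact: lt_geninv.
have Sg x : S x -> (geninv b t <= x%:E)%E by move=> [x0 bx]; exact: geninv_le.
rewrite /tail_integral.
have := geninv_ge0 b t; case: (geninv b t) S_itv Sg => [g| |]// S_itv Sg; last first.
  move=> _.
  have -> : [set x : R | (+oo < x%:E)%E] = set0 by apply/seteqP; split.
  have -> : S = set0 by apply/seteqP; split => // x /Sg.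
  by rewrite integral_set0 /lintegral integral_set0.
rewrite lee_fin => g0.
have gE : [set x | (g%:E < x%:E)%E] = `]g, +oo[%classic.
  by apply/seteqP; split => x /=; rewrite in_itv/= andbT lte_fin.
have mg : measurable_fun `]g, +oo[ (fun x => b x `^ q)%E.
  apply: measurable_funS mbq => // x /=; rewrite !in_itv/= !andbT.
  exact: le_lt_trans.
rewrite gE lintegralE//; last by move=> x _; exact: poweR_ge0.
have [Sgg|nSg] := pselect (S g).
  rewrite (_ : S = `[g, +oo[%classic); first exact: integral_itv_obnd_cbnd.
  apply/seteqP; split => x /=; rewrite in_itv/= andbT; first by move=> /Sg.
  rewrite le_eqVlt => /predU1P[<-//|gx]; apply: S_itv.
  by rewrite /= lte_fin.
rewrite (_ : S = `]g, +oo[%classic)//.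
apply/seteqP; split => x /=; rewrite in_itv/= andbT; last first.
  by move=> gx; apply: S_itv; rewrite /= lte_fin.
move=> Sx; move: (Sg _ Sx); rewrite lee_fin le_eqVlt => /predU1P[gx|//].
by move: nSg; rewrite gx.
Qed.

(** The upper limit is extended because b may take the value +oo. *)
Definition primitive g (y : \bar R) : \bar R := (\int[mu]_(t in below y) g t)%E.

Section Primitive.
Variable g : R -> \bar R.
Hypothesis g0 : forall s, 0 < s -> (0 <= g s)%E.
Hypothesis gn : forall s t, 0 < s -> s <= t -> (g t <= g s)%E.

Let mg : measurable_fun (`]0%R, +oo[ : set R) g.
Proof. exact: nonincreasing_emeasurable. Qed.

Lemma measurable_fun_below y : measurable_fun (below y) g.
Proof.
by apply: measurable_funS mg => // x [x0 _] /=; rewrite in_itv/= x0.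
Qed.

Lemma primitive_ge0 y : (0 <= primitive g y)%E.
Proof. by apply: integral_ge0 => x [x0 _]; exact: g0. Qed.

Lemma primitive_le x y : (x <= y)%E -> (primitive g x <= primitive g y)%E.
Proof.
move=> xy; apply: ge0_subset_integral.
- exact: measurable_below.
- exact: measurable_below.
- exact: measurable_fun_below.
- by move=> t [t0 _]; exact: g0.
- by move=> t [t0 tx]; split => //; exact: lt_le_trans xy.
Qed.

Lemma primitive0 : primitive g 0 = 0%E.
Proof.
rewrite /primitive (_ : below 0 = set0) ?integral_set0//.
by apply/seteqP; split => // x [x0]; rewrite lte_fin ltNge ltW.
Qed.

Lemma primitive_split (x y : R) : 0 < x -> x <= y ->
  primitive g y%:E = (primitive g x%:E + \int[mu]_(t in `[x, y[) g t)%E.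
Proof.
move=> x0 xy.
have D : below y%:E = below x%:E `|` `[x, y[.
  apply/seteqP; split => t /=; rewrite in_itv/= /below/= !lte_fin.
    by move=> [t0 ty]; case: (ltP t x) => tx; [left|right].
  move=> [[t0 tx]|/andP[xt ty]]; first by split => //; exact: lt_le_trans xy.
  by split => //; exact: lt_le_trans xt.
rewrite {1}/primitive D ge0_integral_setU//.
- exact: measurable_below.
- by rewrite -D; exact: measurable_fun_below.
- by rewrite -D => t [t0 _]; exact: g0.
- rewrite disj_set2E; apply/eqP/seteqP; split => // t [[_]].
  by rewrite lte_fin /= in_itv/= => tx /andP[]; rewrite leNgt tx.
Qed.

Let integral_itvco (x y : R) (c : \bar R) : x <= y ->
  (\int[mu]_(t in `[x, y[) cst c t = (y - x)%:E * c)%E.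
Proof.
move=> xy; rewrite integral_cst// muleC; congr (_ * _)%E.
apply: (eq_trans (lebesgue_measure_itv _)) => /=; rewrite lte_fin.
move: xy; rewrite le_eqVlt => /predU1P[->|xy]; first by rewrite ltxx subrr.
by rewrite xy.
Qed.

Let mgco (x y : R) : 0 < x -> measurable_fun `[x, y[ g.
Proof.
move=> x0; apply: measurable_funS mg => // t /=.
by rewrite !in_itv/= andbT => /andP[xt _]; exact: lt_le_trans xt.
Qed.

Lemma primitive_le_add (x y : R) : 0 < x -> x <= y ->
  (primitive g y%:E <= primitive g x%:E + (y - x)%:E * g x)%E.
Proof.
move=> x0 xy; rewrite (primitive_split x0 xy) leeD2l// -integral_itvco//.
apply: ge0_le_integral => //; last 2 first.
- exact: mgco.
- by move=> t /=; rewrite in_itv/= => /andP[xt _]; exact: gn.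
- by move=> t /=; rewrite in_itv/= => /andP[xt _]; apply: g0; exact: lt_le_trans xt.
Qed.

Lemma primitive_ge_add (x y : R) : 0 < x -> x <= y ->
  (primitive g x%:E + (y - x)%:E * g y <= primitive g y%:E)%E.
Proof.
move=> x0 xy; rewrite (primitive_split x0 xy) leeD2l// -integral_itvco//.
apply: ge0_le_integral => //.
- by move=> t _; exact: g0 (lt_le_trans x0 xy).
- exact: mgco.
- move=> t /=; rewrite in_itv/= => /andP[xt ty]; apply: gn; last exact: ltW.
  exact: lt_le_trans xt.
Qed.

Lemma mul_le_primitive (x : R) : 0 < x -> (x%:E * g x <= primitive g x%:E)%E.
Proof.
move=> x0.
have := @lebesgue_measure_below R x%:E; rewrite lee_fin ltW// => /(_ isT) mx.
rewrite -[X in (X * _)%E]mx muleC -integral_cst//; last exact: measurable_below.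
apply: ge0_le_integral => //; first exact: measurable_below.
- by move=> t [t0 _]; exact: g0.
- exact: measurable_fun_below.
- by move=> t [t0]; rewrite lte_fin => tx; apply: gn => //; exact: ltW.
Qed.

(** From G(y) <= G(x) + (y - x) g(x) and x g(x) <= G(x). The argument adds and never subtracts
    values of G, since they may be infinite. *)
Lemma average_nincr (x y : R) : 0 < x -> x <= y ->
  (primitive g y%:E * (y^-1)%:E <= primitive g x%:E * (x^-1)%:E)%E.
Proof.
move=> x0 xy; have y0 : 0 < y by exact: lt_le_trans xy.
have gx := mul_le_primitive x0.
have E := primitive_le_add x0 xy.
rewrite muleC -lee_pdivlMl ?invr_gt0// invrK.
rewrite (le_trans E)//.
have -> : (y%:E * (primitive g x%:E * (x^-1)%:E) =
   primitive g x%:E + (y - x)%:E * ((x^-1)%:E * primitive g x%:E))%E.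
  rewrite [in RHS]muleA -EFinM mulrBl divff ?gt_eqF//.
  rewrite muleC -muleA -EFinM [(x^-1 * y)%R]mulrC.
  rewrite -{2}(mul1e (primitive g x%:E)) -ge0_muleDl ?lee_fin ?subr_ge0//.
    by rewrite -EFinD addrC subrK muleC.
  by rewrite ler_pdivlMr// mul1r.
rewrite leeD2l// lee_wpmul2l ?lee_fin ?subr_ge0//.
by rewrite muleC -lee_pdivrMr ?invr_gt0// ?invrK muleC.
Qed.

Definition average_power (q : R) (y : R) : \bar R :=
  ((primitive g y%:E * (y^-1)%:E) `^ q)%E.

Lemma average_powerM (q y : R) : 0 < y ->
  (average_power q y * (y%:E `^ q) = primitive g y%:E `^ q)%E.
Proof.
move=> y0; rewrite /average_power -poweRM; last 2 first.
  by rewrite mule_ge0 ?primitive_ge0// lee_fin invr_ge0 ltW.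
  by rewrite lee_fin ltW.
by rewrite -muleA -EFinM mulVf ?gt_eqF// mule1.
Qed.

Lemma average_power_nincr (q x y : R) : 0 < q -> 0 < x -> x <= y ->
  (average_power q y <= average_power q x)%E.
Proof.
move=> q0 x0 xy; apply: poweR_le; [exact: ltW| |exact: average_nincr].
by rewrite mule_ge0 ?primitive_ge0// lee_fin invr_ge0 ltW// (lt_le_trans x0).
Qed.

Section Composite.
Variables (b : R -> \bar R) (q : R).
Hypotheses (nfb : normal_form_parameter b) (q0 : 0 < q).

Lemma measurable_primitive_comp :
  measurable_fun (`]0%R, +oo[ : set R) (fun x => primitive g (b x) `^ q)%E.
Proof.
apply: nonincreasing_emeasurable => x y x0 xy.
apply: poweR_le; [exact: ltW|exact: primitive_ge0|apply: primitive_le].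
by case: nfb => _; exact.
Qed.

Lemma integral_finite_positive_set :
  (\int[mu]_(x in finite_positive_set b) (average_power q (fine (b x)) * b x `^ q) =
   \int[mu]_(x in finite_positive_set b) primitive g (b x) `^ q)%E.
Proof.
apply: eq_integral => x /set_mem[x0 /andP[bx0 bxy]].
have bE : b x = (fine (b x))%:E by rewrite fineK// ge0_fin_numE// ltW.
by rewrite {2 3}bE average_powerM// -lte_fin -bE.
Qed.

Lemma integral_finite_positive_set_le :
  (\int[mu]_(x in finite_positive_set b) (average_power q (fine (b x)) * b x `^ q) <=
   \int[mu]_(x in `]0%R, +oo[) primitive g (b x) `^ q)%E.
Proof.
rewrite integral_finite_positive_set; apply: ge0_subset_integral => //.
- exact: measurable_finite_positive_set.
- exact: measurable_primitive_comp.
- by move=> x _; exact: poweR_ge0.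
- by move=> x [x0 _] /=; rewrite in_itv/= x0.
Qed.

(** Finite values make this an equality: where b = +oo the right-hand integrand need not vanish, and
    the left-hand domain omits such points. For infinite values only the preceding inequality
    survives. *)
Lemma integral_finite_positive_setE : finite_valued b ->
  (\int[mu]_(x in finite_positive_set b) (average_power q (fine (b x)) * b x `^ q) =
   \int[mu]_(x in `]0%R, +oo[) primitive g (b x) `^ q)%E.
Proof.
move=> fb; rewrite integral_finite_positive_set [LHS]integral_mkcond [RHS]integral_mkcond.
apply: eq_integral => x _; rewrite !patchE; case: ifPn => [/set_mem[x0 _]|xF].
  by rewrite ifT//; apply/mem_set; rewrite /= in_itv/= x0.
case: ifPn => // /set_mem/=; rewrite in_itv/= andbT => x0.
have [->|bx0] := eqVneq (b x) 0%E; first by rewrite primitive0 poweR0r// gt_eqF.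
exfalso; move/negP : xF; apply; apply/mem_set; split => //.
by case: nfb => b0 _; rewrite lt_neqAle eq_sym bx0 b0//= fb.
Qed.

Lemma HardyE x : Hardy b g x = primitive g (b x).
Proof.
rewrite /Hardy lintegralE//.
- exact: measurable_below.
- exact: measurable_fun_below.
- by move=> t [t0 _]; exact: g0.
Qed.

Lemma pnorm_Hardy :
  pnorm q (Hardy b g) = ((\int[mu]_(x in `]0%R, +oo[) primitive g (b x) `^ q) `^ q^-1)%E.
Proof.
rewrite pnormE//; last by move=> x x0; rewrite HardyE; exact: primitive_ge0.
congr (_ `^ _)%E.
have -> : Hardy b g = primitive g \o b by apply/funext => x; exact: HardyE.
rewrite lintegralE//; [exact: measurable_halfline|exact: measurable_primitive_comp|].
by move=> x _; exact: poweR_ge0.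
Qed.

Lemma pnorm_nincr :
  pnorm q g = ((\int[mu]_(x in `]0%R, +oo[) g x `^ q) `^ q^-1)%E.
Proof.
rewrite pnormE//; congr (_ `^ _)%E; rewrite lintegralE//.
- exact: measurable_halfline.
- exact: (measurableT_comp (measurable_poweR q) mg).
- by move=> x _; exact: poweR_ge0.
Qed.

End Composite.

Lemma Lplus_nincr : Lplus g.
Proof.
split; last exact: g0.
by apply: measurable_fun_lebesgueType; [exact: measurable_halfline|exact: mg].
Qed.

End Primitive.

Lemma pnorm_Hardy_rearrangement b f (p q : R) : normal_form_parameter b ->
    0 < p -> 0 < q -> Lplus f -> exists g : R -> \bar R,
  [/\ forall s, (0 <= g s)%E, forall s t, s <= t -> (g t <= g s)%E,
      (pnorm q (Hardy b f) <= pnorm q (Hardy b g))%E &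
      pnorm p f = pnorm p g].
Proof.
move=> nfb p0 q0 Lf; have [g [g0 gn gF gp]] := rearrangement Lf p0.
exists g; split => //.
  have g0' s : 0 < s -> (0 <= g s)%E by [].
  have gn' s t : 0 < s -> s <= t -> (g t <= g s)%E by move=> _; exact: gn.
  have H0 x : (0 <= Hardy b f x)%E.
    by apply: integral_ge0 => t [t0 _]; exact: Lf.2.
  rewrite [leRHS]pnorm_Hardy// pnormE//.
  apply: poweR_le; first by rewrite invr_ge0 ltW.
    by apply: integral_ge0 => x _; exact: poweR_ge0.
  (* [Hardy b f] inherits monotonicity from b, hence Borel measurability, although f is only
     Lebesgue measurable. *)
  have mH : measurable_fun (`]0%R, +oo[ : set R) (fun x => Hardy b f x `^ q)%E.
    apply: nonincreasing_emeasurable => x y x0 xy.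
    apply: poweR_le; [exact: ltW|exact: H0|].
    have bD (z : \bar R) : measurable (below z : set (lebesgueType R)).
      by apply: measurable_lebesgueType; exact: measurable_below.
    apply: ge0_subset_integral; [exact: bD|exact: bD| | |].
    - apply: (measurable_funS (measurable_lebesgueType measurable_halfline) _ Lf.1).
      by move=> t [t0 _]; exact/halflineP.
    - by move=> t [t0 _]; exact: Lf.2.
    - move=> t [t0 tb]; split => //; apply: lt_le_trans tb _.
      by case: nfb => _; exact.
  rewrite lintegralE; [|exact: measurable_halfline|exact: mH|by move=> x _; exact: poweR_ge0].
  apply: ge0_le_integral.
  - exact: measurable_halfline.
  - by move=> x _; exact: poweR_ge0.
  - exact: mH.
  - exact: measurable_primitive_comp.
  - move=> x /halflineP x0; apply: poweR_le => //; first exact: ltW.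
    by apply: gF; case: nfb => + _; exact.
rewrite pnormE//; last exact: Lf.2.
by rewrite pnorm_nincr ?gp// => s t _; exact: gn.
Qed.

(** The norm for a is expressed exactly through its finite positive values, then [comparison] is
    applied with phi the non-increasing [average_power]. On the side of b an inequality suffices, so
    b may be infinite. *)
Lemma opnorm_le_of_tails (a b : R -> \bar R) (p q C : R) :
  0 < p -> 0 < q -> normal_form_parameter a -> normal_form_parameter b -> 0 < C ->
  finite_valued a ->
  (forall t : R, 0 < t -> (tail_integral q a t <= C%:E * tail_integral q b t)%E) ->
  (opnorm p q a <= (C `^ q^-1)%:E * opnorm p q b)%E.
Proof.
move=> p0 q0 nfa nfb C0 fa tab; have c0 : 0 < C `^ q^-1 by rewrite powR_gt0.
(* Each constant C' valid for b makes C^(1/q) C' valid for a. *)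
rewrite -lee_pdivrMl//; apply: le_ereal_inf_tmp => C' [C'0 HC'].
rewrite lee_pdivrMl//; apply: ereal_inf_lbound; split.
  by rewrite mule_ge0// lee_fin ltW.
move=> f Lf; have [g [g0 gn gH gp]] := pnorm_Hardy_rearrangement nfa p0 q0 Lf.
have g0' s : 0 < s -> (0 <= g s)%E by [].
have gn' s t : 0 < s -> s <= t -> (g t <= g s)%E by move=> _; exact: gn.
rewrite (le_trans gH)// gp -muleA.
apply: (@le_trans _ _ ((C `^ q^-1)%:E * pnorm q (Hardy b g))%E); last first.
  by rewrite lee_wpmul2l ?lee_fin ?(ltW c0)// HC'//; exact: Lplus_nincr.
rewrite !pnorm_Hardy// -poweR_EFin -poweRM ?lee_fin ?(ltW C0)//; last first.
  by apply: integral_ge0 => x _; exact: poweR_ge0.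
apply: poweR_le; first by rewrite invr_ge0 ltW.
  by apply: integral_ge0 => x _; exact: poweR_ge0.
rewrite -integral_finite_positive_setE//.
apply: (@le_trans _ _ (C%:E * \int[mu]_(x in finite_positive_set b)
    (average_power g q (fine (b x)) * b x `^ q))%E); last first.
  by rewrite lee_wpmul2l ?lee_fin ?(ltW C0)// integral_finite_positive_set_le.
have msup (c : R -> \bar R) : normal_form_parameter c -> measurable_fun (finite_positive_set c) c.
  move=> nfc; apply: measurable_funS (measurable_normal_form nfc) => //.
  by move=> x [x0 _] /=; rewrite in_itv/= x0.
apply: comparison.
- exact: measurable_finite_positive_set.
- exact: measurable_finite_positive_set.
- by apply: measurableT_comp => //; exact: msup.
- by apply: measurableT_comp => //; exact: msup.
- by apply: (measurableT_comp (measurable_poweR q)); exact: msup.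
- by apply: (measurableT_comp (measurable_poweR q)); exact: msup.
- by move=> x [_ ax]; exact: fine_gt0.
- by move=> x [_ ax]; exact: fine_gt0.
- by move=> x _; exact: poweR_ge0.
- by move=> x _; exact: poweR_ge0.
- exact: ltW.
- by move=> t t0; rewrite -!tail_integralE//; exact: tab.
- by move=> x x0; exact: poweR_ge0.
- by move=> x y x0 xy; exact: average_power_nincr.
Qed.

End Operator.

(** * Primitives of functions on the half-line *)

Section RealAnalysis.
Context {R : realType}.
Notation mu := (@lebesgue_measure R).
Implicit Types (f F h : R -> R) (x y : R).

Lemma powR_expR (x s : R) : 0 < x -> x `^ s = expR (s * ln x).
Proof. by move=> x0; rewrite /powR gt_eqF. Qed.

Lemma powR_le (s x y : R) : 0 <= s -> 0 <= x -> x <= y -> x `^ s <= y `^ s.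
Proof.
by move=> s0 x0 xy; apply: ge0_ler_powR => //; rewrite nnegrE// (le_trans x0).
Qed.

Lemma is_derive_powR (s x : R) : 0 < x ->
  is_derive x 1 (fun y => y `^ s) (s * x `^ (s - 1)).
Proof.
move=> x0; have xI : x \in `]0, +oo[ by rewrite in_itv/= x0.
apply: DeriveDef; first exact: derivable_powR.
by rewrite -derive1E powR_derive1.
Qed.

Lemma is_derive_powR_comp f (s x df : R) : 0 < f x -> is_derive x 1 f df ->
  is_derive x 1 (fun y => f y `^ s) (s * f x `^ (s - 1) * df).
Proof.
move=> fx0 fd.
exact: (@is_derive1_comp _ (fun y => y `^ s) f x _ _ (is_derive_powR s fx0) fd).
Qed.

Lemma is_derive_continuous f (x df : R) : is_derive x 1 f df -> {for x, continuous f}.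
Proof.
by move=> [fd _]; apply/differentiable_continuous/derivable1_diffP.
Qed.

Lemma is_derive_le h (dh : R -> R) (x y : R) : x <= y ->
  (forall z, x <= z <= y -> is_derive z 1 h (dh z)) ->
  (forall z, x <= z <= y -> 0 <= dh z) -> h x <= h y.
Proof.
move=> xy hd dh0.
have ch : {within `[x, y], continuous h}.
  apply: derivable_within_continuous => z; rewrite in_itv/= => zxy.
  by have [] := hd z zxy.
have hd' z : z \in `]x, y[ -> is_derive z 1 h (dh z).
  by rewrite in_itv/= => /andP[xz zy]; apply: hd; rewrite !ltW.
have [c] := MVT_segment xy hd' ch.
rewrite in_itv/= => cxy E; rewrite -subr_ge0 E mulr_ge0 ?dh0// subr_ge0//.
Qed.

(** The last hypothesis replaces a limit at 0: for each e a single point where h >= -e is enough,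
    because h is non-decreasing from there on. Singular boundary terms then need an estimate only at
    a well-chosen point. *)
Lemma ge0_of_is_derive h (dh : R -> R) (x : R) :
  (forall y, 0 < y <= x -> is_derive y 1 h (dh y)) ->
  (forall y, 0 < y <= x -> 0 <= dh y) ->
  (forall e, 0 < e -> exists2 y, 0 < y <= x & - e <= h y) -> 0 <= h x.
Proof.
move=> hd dh0 hs; rewrite leNgt; apply/negP => hx.
have h2 : 0 < - h x / 2 by lra.
have [y /andP[y0 yx] hy] := hs _ h2.
have : h y <= h x.
  by apply: (is_derive_le yx) => z /andP[yz zx]; [apply: hd|apply: dh0];
    rewrite zx (lt_le_trans y0).
lra.
Qed.

(** The inequality expR t >= 1 + t at the logarithms u, v of X and Z relative to their weighted
    geometric mean M: the linear terms cancel because a u + b v = 0. *)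
Lemma weighted_AMGM (a b X Z : R) : 0 < a -> 0 < b -> 0 < X -> 0 < Z ->
  (a + b) * (X `^ (a / (a + b)) * Z `^ (b / (a + b))) <= a * X + b * Z.
Proof.
move=> a0 b0 X0 Z0; set M := X `^ _ * Z `^ _.
have ab0 : a + b != 0 by rewrite gt_eqF// addr_gt0.
have M0 : 0 < M by rewrite mulr_gt0 ?powR_gt0.
pose u := ln X - ln M; pose v := ln Z - ln M.
have lnM' : ln M = a / (a + b) * ln X + b / (a + b) * ln Z.
  by rewrite /M lnM ?posrE ?powR_gt0// !ln_powR.
have uv : a * u + b * v = 0.
  by rewrite /u /v lnM'; field.
have XE : X = M * expR u by rewrite /u expRB !lnK ?posrE// mulrCA divff ?mulr1// gt_eqF.
have ZE : Z = M * expR v by rewrite /v expRB !lnK ?posrE// mulrCA divff ?mulr1// gt_eqF.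
have h : 0 <= a * (expR u - 1 - u) + b * (expR v - 1 - v).
  have e t : 0 <= expR t - 1 - t by have := expR_ge1Dx t; lra.
  by apply: addr_ge0; apply: mulr_ge0; [exact: ltW|exact: e|exact: ltW|exact: e].
have : a + b <= a * expR u + b * expR v by lra.
rewrite -(ler_pM2l M0) => h2.
by rewrite XE ZE; move: h2; lra.
Qed.

(** Real-valued, so that it can be differentiated. [fine] sends an infinite integral to 0, whence
    the finiteness hypotheses that accompany it. *)
Definition real_primitive f y : R := fine (primitive (EFin \o f) y%:E).

Section RealPrimitive.
Variable f : R -> R.
Hypothesis f0 : forall x, 0 < x -> 0 <= f x.
Hypothesis mf : measurable_fun (`]0%R, +oo[ : set R) f.
Hypothesis ff : forall x, 0 < x -> (primitive (EFin \o f) x%:E < +oo)%E.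

Let mEf : measurable_fun (`]0%R, +oo[ : set R) (EFin \o f).
Proof. exact/measurable_EFinP. Qed.

Lemma primitive_EFin_ge0 (z : \bar R) : (0 <= primitive (EFin \o f) z)%E.
Proof. by apply: integral_ge0 => x [x0 _]; rewrite lee_fin f0. Qed.

Lemma real_primitiveE x : 0 < x -> primitive (EFin \o f) x%:E = (real_primitive f x)%:E.
Proof.
by move=> x0; rewrite fineK// ge0_fin_numE ?ff// primitive_EFin_ge0.
Qed.

Lemma real_primitive_ge0 x : 0 <= real_primitive f x.
Proof. by rewrite fine_ge0// primitive_EFin_ge0. Qed.

Lemma below_itv x : below x%:E = `]0, x[%classic.
Proof.
by apply/seteqP; split => t; rewrite /below /= in_itv/= lte_fin => /andP.
Qed.

Let integrable_f x : 0 < x -> mu.-integrable `]0, x] (EFin \o f).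
Proof.
move=> x0; apply/integrableP; split.
  apply: measurable_funS mEf => // t /=; rewrite !in_itv/= => /andP[->//].
rewrite -integral_itv_bndo_bndc; last first.
  apply: measurableT_comp => //; apply: measurable_funS mEf => // t /=.
  by rewrite !in_itv/= => /andP[->//].
have := ff x0; rewrite /primitive below_itv; congr (_ < _)%E.
apply: eq_integral => t.
by rewrite inE/= in_itv/= => /andP[t0 _]; rewrite /= ger0_norm// f0.
Qed.

Let real_primitive_Rintegral x : real_primitive f x = (\int[mu]_(t in `]0%R, x]) f t)%R.
Proof.
rewrite /Rintegral -integral_itv_bndo_bndc/=.
  by rewrite /real_primitive /primitive below_itv.
by apply: measurable_funS mEf => // t /=; rewrite !in_itv/= => /andP[->].
Qed.

Lemma is_derive_real_primitive_for x : 0 < x -> {for x, continuous f} ->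
  is_derive x 1 (real_primitive f) (f x).
Proof.
move=> x0 cf.
have xx : x < x + 1 by rewrite ltrDl.
have [] := continuous_FTC1 xx (integrable_f (addr_gt0 x0 ltr01)) _ cf.
  by rewrite lte_fin.
rewrite (_ : (fun y => _) = real_primitive f); last first.
  by apply/funext => y; rewrite real_primitive_Rintegral.
by move=> df E; apply: DeriveDef => //; rewrite -derive1E.
Qed.

Lemma measurable_real_primitive_small e : 0 < e ->
  exists2 d, 0 < d & forall y, 0 < y < d -> real_primitive f y < e.
Proof.
move=> e0.
have I1 : mu.-integrable `[0, 1] (EFin \o f).
  have := integrable_f ltr01 => /integrableP[m1 i1].
  apply/integrableP; split.
    by apply/emeasurable_fun_itv_obnd_cbndP.
  rewrite -integral_itv_obnd_cbnd//.
  exact: measurableT_comp.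
have /cvgrPdist_lt/(_ e e0)/=[d d0 Hd] := parameterized_integral_cvg_left ltr01 I1.
exists d => // y /andP[y0 yd].
have := Hd y; rewrite /ball_/= !sub0r !normrN ger0_norm ?(ltW y0)// => /(_ yd).
rewrite /parameterized_integral (_ : (\int[mu]_(t in `[0%R, y]) f t)%R = real_primitive f y).
  by rewrite ger0_norm ?real_primitive_ge0.
rewrite real_primitive_Rintegral /Rintegral -integral_itv_obnd_cbnd//.
by apply: measurable_funS mEf => // t /=; rewrite !in_itv/= => /andP[->].
Qed.

End RealPrimitive.

Lemma measurable_continuous_pos f :
  (forall x, 0 < x -> {for x, continuous f}) -> measurable_fun (`]0%R, +oo[ : set R) f.
Proof.
move=> cf; apply: open_continuous_measurable_fun; first exact: interval_open.
by move=> x /set_mem/=; rewrite in_itv/= andbT; exact: cf.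
Qed.

Section ContinuousPrimitive.
Variable f : R -> R.
Hypothesis f0 : forall x, 0 < x -> 0 <= f x.
Hypothesis cf : forall x, 0 < x -> {for x, continuous f}.
Hypothesis ff : forall x, 0 < x -> (primitive (EFin \o f) x%:E < +oo)%E.

Lemma is_derive_real_primitive x : 0 < x -> is_derive x 1 (real_primitive f) (f x).
Proof.
move=> x0; apply: is_derive_real_primitive_for => //; last exact: cf.
exact: measurable_continuous_pos.
Qed.

Lemma real_primitive_small e : 0 < e ->
  exists2 d, 0 < d & forall y, 0 < y < d -> real_primitive f y < e.
Proof.
by apply: measurable_real_primitive_small => //; exact: measurable_continuous_pos.
Qed.

Lemma real_primitive_le x y : x <= y -> 0 < y -> real_primitive f x <= real_primitive f y.
Proof.
move=> xy y0; have [x0|x0] := ltP 0 x; last first.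
  rewrite {1}/real_primitive /primitive (_ : below _ = set0).
    by rewrite integral_set0/= real_primitive_ge0.
  by rewrite below_itv; apply/seteqP; split => // t /=; rewrite in_itv/= => /andP[t0 tx]; lra.
by apply: (is_derive_le xy) => z /andP[xz zy];
  [apply: is_derive_real_primitive|apply: f0]; exact: lt_le_trans xz.
Qed.

Lemma real_primitive_lt x y : (forall z, 0 < z -> 0 < f z) -> 0 < x -> x < y ->
  real_primitive f x < real_primitive f y.
Proof.
move=> fp x0 xy.
have hd z : x <= z <= y -> is_derive z 1 (real_primitive f) (f z).
  by move=> /andP[xz _]; apply: is_derive_real_primitive; exact: lt_le_trans xz.
have ch : {within `[x, y], continuous (real_primitive f)}.
  apply: derivable_within_continuous => z; rewrite in_itv/= => zxy.
  by have [] := hd z zxy.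
have hd' z : z \in `]x, y[ -> is_derive z 1 (real_primitive f) (f z).
  by rewrite in_itv/= => /andP[xz zy]; apply: hd; rewrite !ltW.
have [c] := MVT xy hd' ch.
rewrite in_itv/= => /andP[xc cy] E; rewrite -subr_gt0 E mulr_gt0 ?subr_gt0//.
by apply: fp; exact: lt_trans xc.
Qed.

Lemma real_primitive_gt0 x : (forall z, 0 < z -> 0 < f z) -> 0 < x ->
  0 < real_primitive f x.
Proof.
move=> fp x0; apply: (@le_lt_trans _ _ (real_primitive f (x / 2))).
  exact: real_primitive_ge0.
by apply: real_primitive_lt => //; lra.
Qed.

Lemma real_primitive_surj t v : 0 < t -> 0 < v -> v <= real_primitive f t ->
  exists2 x, 0 < x <= t & real_primitive f x = v.
Proof.
move=> t0 v0 vt; have [d d0 Hd] := real_primitive_small v0.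
pose x0 := Num.min (d / 2) t.
have x00 : 0 < x0 by rewrite lt_min t0 divr_gt0.
have x0t : x0 <= t by rewrite ge_min lexx orbT.
have Hx0 : real_primitive f x0 < v.
  by apply: Hd; rewrite x00/= gt_min; apply/orP; left; lra.
have ch : {within `[x0, t], continuous (real_primitive f)}.
  apply: derivable_within_continuous => z; rewrite in_itv/= => /andP[xz _].
  by have [] := is_derive_real_primitive (lt_le_trans x00 xz).
have [|c] := IVT (v := v) x0t ch.
  rewrite ge_min le_max vt (ltW Hx0) orbT//.
rewrite in_itv/= => /andP[xc ct] E; exists c => //.
by rewrite ct (lt_le_trans x00).
Qed.

End ContinuousPrimitive.

(** [xget] selects a preimage, unique on (0, oo) by strict monotonicity. Off the range of J the
    inverse carries no information, so it is evaluated only at points J x. *)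
Lemma is_derive_inverse_pos (J : R -> R) (dJ : R -> R) :
  (forall x, 0 < x -> is_derive x 1 J (dJ x)) -> (forall x, 0 < x -> 0 < dJ x) ->
  exists g : R -> R, (forall x, 0 < x -> g (J x) = x) /\
    forall x, 0 < x -> is_derive (J x) 1 g (dJ x)^-1.
Proof.
move=> Jd dJ0.
have Jlt x y : 0 < x -> x < y -> J x < J y.
  move=> x0 xy.
  have ch : {within `[x, y], continuous J}.
    apply: derivable_within_continuous => z; rewrite in_itv/= => /andP[xz _].
    by have [] := Jd z (lt_le_trans x0 xz).
  have hd' z : z \in `]x, y[ -> is_derive z 1 J (dJ z).
    by rewrite in_itv/= => /andP[xz zy]; apply: Jd; exact: lt_trans xz.
  have [c] := MVT xy hd' ch.
  rewrite in_itv/= => /andP[xc cy] E; rewrite -subr_gt0 E mulr_gt0 ?subr_gt0//.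
  by apply: dJ0; exact: lt_trans xc.
pose g v := xget 0 [set x | 0 < x /\ J x = v].
have gK x : 0 < x -> g (J x) = x.
  move=> x0; rewrite /g; case: xgetP => [z _ [z0 zx]|/(_ x)]; last by case.
  have [zx'|xz|//] := ltgtP z x.
    by have := Jlt _ _ z0 zx'; rewrite zx ltxx.
  by have := Jlt _ _ x0 xz; rewrite zx ltxx.
exists g; split => // x x0.
apply: (@is_derive_inverse _ J g).
- near=> z; apply: gK; near: z; exact: lt_nbhsr.
- near=> z; apply: (@is_derive_continuous _ _ (dJ z)); apply: Jd.
  by near: z; exact: lt_nbhsr.
- exact: Jd.
- by rewrite gt_eqF// dJ0.
Unshelve. all: by end_near. Qed.

End RealAnalysis.

(** * The inequality of Hardy and Bliss *)

Section BlissPointwise.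
Context {R : realType}.
Variables (p r : R).
Hypotheses (p1 : 1 < p) (r0 : 0 < r).

Let q := p * (1 + r).
Let m := p + r * (p - 1).
Let rho := r * (p - 1) / p.
Let n := (p - 1) * (1 + rho).
Let al := (p - 1) * q / m.

Let p0 : 0 < p. Proof. exact: lt_trans ltr01 p1. Qed.
Let pn0 : p != 0. Proof. by rewrite gt_eqF. Qed.
Let p1n0 : p - 1 != 0. Proof. by rewrite gt_eqF// subr_gt0. Qed.
Let r1n0 : 1 + r != 0. Proof. by rewrite gt_eqF// addr_gt0. Qed.
Let m0 : 0 < m. Proof. by rewrite /m addr_gt0// mulr_gt0// subr_gt0. Qed.
Let rho0 : 0 < rho. Proof. by rewrite /rho divr_gt0// mulr_gt0// subr_gt0. Qed.
Let n0 : 0 < n. Proof. by rewrite /n mulr_gt0 ?subr_gt0// addr_gt0. Qed.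

(** Young's inequality with exponents p and p'. The powers of T and y in G are those for which G^p'
    = a^q y^-m T^-r, the integrand of J times T^-r. Bliss's extremal with T = y gives f^p = G^p',
    the case of equality. *)
Lemma bliss_young (a y T f : R) : 0 < a -> 0 < y -> 0 < T -> 0 <= f ->
  p * (f * (a `^ (m - 1) * T `^ (- rho) * y `^ (- n))) <=
  f `^ p + (p - 1) * (a `^ q * y `^ (- m) * T `^ (- r)).
Proof.
move=> a0 y0 T0 f0; set G := a `^ (m - 1) * _ * _.
have G0 : 0 < G by rewrite !mulr_gt0// powR_gt0.
have p'0 : 0 < p / (p - 1) by rewrite divr_gt0// subr_gt0.
have conj : p^-1 + (p / (p - 1))^-1 = 1 by field; rewrite pn0 p1n0.
have := conjugate_powR f0 (ltW G0) p0 p'0 conj.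
have -> : G `^ (p / (p - 1)) = a `^ q * y `^ (- m) * T `^ (- r).
  rewrite /G !powR_expR ?mulr_gt0 ?expR_gt0// -!expRD expRK; congr expR.
  by rewrite /q /m /n /rho; field; rewrite pn0 p1n0.
set B := a `^ q * _ * _ => Y.
have -> : f `^ p + (p - 1) * B = p * (f `^ p / p + B / (p / (p - 1))).
  by field; rewrite pn0 p1n0.
by rewrite ler_pM2l.
Qed.

(** The two means are those of T'/T and 1/y, where T' is prescribed by the equality of the two
    values of J. With the weights rho and n, whose sum is (p - 1)(1 + r) = m - 1, all powers of T
    cancel from the geometric mean times a^m T^-rho y^-n. Equality holds for T'/T = 1/y, as for T =
    y. *)
Lemma bliss_AMGM (a y T F0 : R) : 0 < a -> 0 < y -> 0 < T -> 0 < F0 ->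
  (p - 1) * (1 + r) * (a `^ q * y `^ (- m) * F0 `^ (- r)) <=
  a `^ m * T `^ (- rho) * y `^ (- n) *
    (rho * (a `^ q * y `^ (- m) / (F0 `^ q * T `^ (- m)) / T) + n * y^-1).
Proof.
move=> a0 y0 T0 F00; set P := a `^ m * _ * _; set X := _ / T.
have P0 : 0 < P by rewrite !mulr_gt0 ?powR_gt0.
have X0 : 0 < X by rewrite !(mulr_gt0, invr_gt0, powR_gt0).
have Z0 : 0 < y^-1 by rewrite invr_gt0.
have WE : rho + n = (p - 1) * (1 + r) by rewrite /n /rho; field.
have := weighted_AMGM rho0 n0 X0 Z0.
rewrite -(ler_pM2l P0); apply: le_trans; rewrite le_eqVlt; apply/orP; left; apply/eqP.
rewrite {1}WE [RHS]mulrCA; congr (_ * _).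
have lnX : ln X = q * ln a - m * ln y - q * ln F0 + m * ln T - ln T.
  rewrite /X ln_div ?posrE ?(mulr_gt0, invr_gt0, powR_gt0)//.
  rewrite ln_div ?posrE ?(mulr_gt0, invr_gt0, powR_gt0)//.
  rewrite !lnM ?posrE ?(mulr_gt0, invr_gt0, powR_gt0)// !ln_powR; ring.
rewrite /P (powR_expR _ X0) (powR_expR _ Z0) lnX lnV ?posrE//.
rewrite !powR_expR// -!expRD; congr expR.
rewrite WE /n /m /rho /q; field.
by rewrite pn0 p1n0 r1n0.
Qed.

(** The right side is the derivative of the calibration; a, f, T, T' and F0 stand for F(y), f(y),
    T(y), its derivative and the extremal at T(y). It splits into [bliss_young] plus p/m times
    [bliss_AMGM]. *)
Lemma bliss_pointwise (a y T F0 f T' : R) : 0 < a -> 0 < y -> 0 < T -> 0 < F0 ->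
  F0 `^ (- r) = 1 + T `^ (- r) -> 0 <= f ->
  T' = a `^ q * y `^ (- m) / (F0 `^ q * T `^ (- m)) ->
  0 <= f `^ p -
    p / m * (m * a `^ (m - 1) * f * (T `^ (- rho) * y `^ (- n)) +
             a `^ m * (- rho * T `^ (- rho - 1) * T' * y `^ (- n) +
                       T `^ (- rho) * (- n * y `^ (- n - 1)))) -
    F0 `^ q * T `^ (- m) * (al * F0 `^ (- r) - (p - 1) * T `^ (- r)) * T'.
Proof.
move=> a0 y0 T0 F00 FE f0 T'E.
have Y := bliss_young a0 y0 T0 f0.
have A := bliss_AMGM a0 y0 T0 F00.
rewrite -T'E in A.
set B := a `^ q * y `^ (- m) in Y A T'E *.
have FT0 : F0 `^ q * T `^ (- m) != 0 by rewrite gt_eqF// mulr_gt0// powR_gt0.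
have -> : F0 `^ q * T `^ (- m) * (al * F0 `^ (- r) - (p - 1) * T `^ (- r)) * T' =
   B * (al * F0 `^ (- r) - (p - 1) * T `^ (- r)).
  by rewrite mulrAC [F0 `^ q * _ * T']mulrC T'E divfK.
have TE : T `^ (- rho - 1) = T `^ (- rho) / T.
  by rewrite powRB ?powRr1 ?ltW//; apply/implyP => _; rewrite gt_eqF.
have yE : y `^ (- n - 1) = y `^ (- n) / y.
  by rewrite powRB ?powRr1 ?ltW//; apply/implyP => _; rewrite gt_eqF.
rewrite TE yE.
move: Y A; set G := a `^ (m - 1) * _ * _; set P := a `^ m * _ * _.
set S := F0 `^ (- r); set Tr := T `^ (- r) => Y A.
have alE : al = p / m * ((p - 1) * (1 + r)).
  by rewrite /al /q; field; rewrite gt_eqF.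
have A' : al * (B * S) <= p / m * (P * (rho * (T' / T) + n / y)).
  by rewrite alE -mulrA ler_pM2l ?divr_gt0// mulrA.
have -> : p / m * (m * a `^ (m - 1) * f * (T `^ (- rho) * y `^ (- n)) +
             a `^ m * (- rho * (T `^ (- rho) / T) * T' * y `^ (- n) +
                       T `^ (- rho) * (- n * (y `^ (- n) / y)))) =
   p * (f * G) - p / m * (P * (rho * (T' / T) + n / y)).
  by rewrite /G /P; field; rewrite !gt_eqF.
move: A' Y; rewrite -/Tr; lra.
Qed.

End BlissPointwise.

(** * Calibration along Bliss's extremal *)

Section BlissCore.
Context {R : realType}.
Variables (p r : R).
Hypotheses (p1 : 1 < p) (r0 : 0 < r).
Implicit Types (s t v e d z y : R).

(* With q = p (1 + r): the primitive of Bliss's extremal function, and that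
   function itself. *)
Definition extremal (t : R) : R := (1 + t `^ (- r)) `^ (- r^-1).
Definition extremal_deriv (t : R) : R := (extremal t / t) `^ (1 + r).

Let q := p * (1 + r).
Let m := p + r * (p - 1).
Let rho := r * (p - 1) / p.
Let n := (p - 1) * (1 + rho).
Let al := (p - 1) * q / m.

Let p0 : 0 < p. Proof. exact: lt_trans ltr01 p1. Qed.
Let q0 : 0 < q. Proof. by rewrite /q mulr_gt0// addr_gt0. Qed.
Let pn0 : p != 0. Proof. by rewrite gt_eqF. Qed.
Let rn0 : r != 0. Proof. by rewrite gt_eqF. Qed.
Let p1n0 : p - 1 != 0. Proof. by rewrite gt_eqF// subr_gt0. Qed.
Let r1n0 : 1 + r != 0. Proof. by rewrite gt_eqF// addr_gt0. Qed.
Let m0 : 0 < m. Proof. by rewrite /m addr_gt0// mulr_gt0// subr_gt0. Qed.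
Let rho0 : 0 < rho. Proof. by rewrite /rho divr_gt0// mulr_gt0// subr_gt0. Qed.

Let u0 (t : R) : 0 < t -> 0 < 1 + t `^ (- r).
Proof. by move=> t0; rewrite addr_gt0// powR_gt0. Qed.

Lemma extremal_gt0 (t : R) : 0 < t -> 0 < extremal t.
Proof. by move=> t0; rewrite powR_gt0// u0. Qed.

Lemma extremal_powRNr (t : R) : 0 < t -> extremal t `^ (- r) = 1 + t `^ (- r).
Proof.
move=> t0; rewrite /extremal -powRrM mulNr mulrN opprK mulVf// powRr1//.
exact/ltW/u0.
Qed.

Lemma extremal_le (t : R) : 0 < t -> extremal t <= t.
Proof.
move=> t0; rewrite leNgt; apply/negP => tF.
have : t `^ r < extremal t `^ r.
  by apply: gt0_ltr_powR; rewrite ?nnegrE ?ltW// extremal_gt0.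
move=> h; have : (extremal t `^ r)^-1 < (t `^ r)^-1.
  rewrite ltf_pV2 //; rewrite posrE; apply: powR_gt0 => //; exact: extremal_gt0.
rewrite -!powRN extremal_powRNr//; lra.
Qed.

Lemma extremal_le1 (t : R) : 0 < t -> extremal t <= 1.
Proof.
move=> t0; rewrite /extremal [leLHS]powRN invf_le1 ?powR_gt0 ?u0//.
have h : 0 <= r^-1 by rewrite invr_ge0 ltW.
have : 1 `^ r^-1 <= (1 + t `^ (- r)) `^ r^-1.
  apply: ge0_ler_powR => //; rewrite ?nnegrE//; last by rewrite lerDl powR_ge0.
  exact/ltW/u0.
by rewrite powR1.
Qed.

Lemma is_derive_extremal (t : R) : 0 < t -> is_derive t 1 extremal (extremal_deriv t).
Proof.
move=> t0; have du : is_derive t 1 (fun y : R => 1 + y `^ (- r)) (- r * t `^ (- r - 1)).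
  have := is_deriveD (is_derive_cst (1 : R) t (1 : R)) (is_derive_powR (- r) t0).
  by rewrite add0r.
apply: is_derive_eq; first exact: (@is_derive_powR_comp R (fun y : R => 1 + y `^ (- r)) (- r^-1) t _ (u0 t0) du).
have -> : - r^-1 * (1 + t `^ (- r)) `^ (- r^-1 - 1) * (- r * t `^ (- r - 1)) =
   (1 + t `^ (- r)) `^ (- r^-1 - 1) * t `^ (- r - 1) by field.
rewrite /extremal_deriv powRM ?invr_ge0 ?ltW// ?extremal_gt0//.
rewrite /extremal -powRrM; congr (_ * _); first by congr (_ `^ _); field.
by rewrite !powR_expR ?invr_gt0// lnV ?posrE//; congr expR; ring.
Qed.

Lemma extremal_deriv_gt0 (t : R) : 0 < t -> 0 < extremal_deriv t.
Proof. by move=> t0; rewrite powR_gt0// divr_gt0// extremal_gt0. Qed.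

Variables (J0 E0 : R -> R).
Hypotheses (J0d : forall t, 0 < t ->
    is_derive t 1 J0 (extremal t `^ q * t `^ (- m)))
  (E0d : forall t, 0 < t -> is_derive t 1 E0 (extremal_deriv t `^ p)).
Hypotheses (J0small : forall e, 0 < e -> exists2 d, 0 < d & forall t, 0 < t < d -> J0 t < e)
  (E0small : forall e, 0 < e -> exists2 d, 0 < d & forall t, 0 < t < d -> E0 t < e).
Hypothesis J0surj : forall t v, 0 < t -> 0 < v -> v <= J0 t ->
  exists2 x, 0 < x <= t & J0 x = v.
Hypothesis J0gt0 : forall t, 0 < t -> 0 < J0 t.

(** The value for which the calibration D of [bliss_path] vanishes identically along the extremal
    itself: there T y = y, and rho + n = m - 1 turns T^-rho y^-n into y^(1 - m). *)
Let psi (t : R) := E0 t - p / m * (extremal t `^ m * t `^ (1 - m)).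
Let dpsi (t : R) := extremal t `^ q * t `^ (- m) * (al * extremal t `^ (- r) - (p - 1) * t `^ (- r)).

Let psid (t : R) : 0 < t -> is_derive t 1 psi (dpsi t).
Proof.
move=> t0; have F0 := extremal_gt0 t0.
have dF := is_derive_powR_comp m F0 (is_derive_extremal t0).
have dt := is_derive_powR (1 - m) t0.
have dP := is_deriveZ (p / m) (is_deriveM dF dt).
have dS := is_deriveB (E0d t0) dP.
apply: (is_derive_eq dS).
rewrite /dpsi /GRing.scale/=.
set e1 := extremal t `^ q * t `^ (- m) * t `^ (- r).
set e2 := extremal t `^ q * t `^ (- m) * extremal t `^ (- r).
have -> : extremal_deriv t `^ p = e1.
  rewrite /e1 /extremal_deriv -powRrM !powR_expR ?divr_gt0// -!expRD ln_div ?posrE//.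
  by congr expR; rewrite /q /m; ring.
have -> : 1 - m - 1 = - m by ring.
have -> : extremal t `^ m * ((1 - m) * t `^ (- m)) = (1 - m) * e2.
  rewrite mulrCA; congr (_ * _); rewrite /e2 !powR_expR// -!expRD.
  by congr expR; rewrite /q /m; ring.
have -> : t `^ (1 - m) * (m * extremal t `^ (m - 1) * extremal_deriv t) = m * e1.
  rewrite -mulrA mulrCA; congr (_ * _).
  rewrite /e1 /extremal_deriv !powR_expR ?divr_gt0// -!expRD ln_div ?posrE//.
  by congr expR; rewrite /q /m; ring.
have -> : extremal t `^ q * t `^ (- m) * (al * extremal t `^ (- r) - (p - 1) * t `^ (- r)) =
    al * e2 - (p - 1) * e1 by rewrite /e1 /e2; ring.
rewrite /al /q; have : m != 0 by rewrite gt_eqF.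
by rewrite /m => mn0; field.
Qed.

Let phi_gt0 (t : R) : 0 < t -> 0 < extremal t `^ q * t `^ (- m).
Proof. by move=> t0; rewrite mulr_gt0// powR_gt0// extremal_gt0. Qed.

Section Path.
Variables (F f J E : R -> R) (x tau c C : R).
Hypotheses (x0 : 0 < x) (tau0 : 0 < tau) (c0 : 0 < c) (C0 : 0 < C).
Hypothesis f_ge0 : forall y, 0 < y <= x -> 0 <= f y.
Hypothesis Fd : forall y, 0 < y <= x -> is_derive y 1 F (f y).
Hypothesis Jd : forall y, 0 < y <= x -> is_derive y 1 J (F y `^ q * y `^ (- m)).
Hypothesis Ed : forall y, 0 < y <= x -> is_derive y 1 E (f y `^ p).
Hypothesis FcC : forall y, 0 < y <= x -> c * y <= F y <= C * y.
Hypothesis J_gt0 : forall y, 0 < y <= x -> 0 < J y.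
Hypothesis E_ge0 : forall y, 0 < y <= x -> 0 <= E y.
Hypothesis Jsmall : forall e, 0 < e -> exists2 d, 0 < d & forall t, 0 < t < d -> J t < e.
Hypothesis Jtau : J x = J0 tau.

(* T y is the point where the extremal has the same J as F has at y; D is the
   calibration, nonnegative because it vanishes at 0 and D' >= 0 by
   bliss_pointwise. *)
Lemma bliss_path : psi tau <= E x.
Proof.
have Fp y : 0 < y <= x -> 0 < F y.
  move=> yx; have /andP[y0 _] := yx; have /andP[h _] := FcC yx.
  by rewrite (lt_le_trans _ h)// mulr_gt0.
have J0le s t : 0 < s -> s <= t -> J0 s <= J0 t.
  move=> s0 st; apply: (is_derive_le st) => z /andP[sz _].
    by apply: J0d; exact: lt_le_trans sz.
  exact/ltW/phi_gt0/(lt_le_trans s0 sz).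
have [g [gK gd]] := is_derive_inverse_pos J0d phi_gt0.
have Jle y : 0 < y <= x -> J y <= J x.
  move=> /andP[y0 yx]; apply: (is_derive_le yx) => z /andP[yz zx].
    by apply: Jd; rewrite zx (lt_le_trans y0).
  by rewrite mulr_ge0 ?powR_ge0.
pose T y := g (J y).
have TP y : 0 < y <= x -> 0 < T y /\ J0 (T y) = J y.
  move=> yx; have [z /andP[z0 _] zE] := J0surj tau0 (J_gt0 yx) (eq_rect _ (fun v => J y <= v) (Jle _ yx) _ Jtau).
  by rewrite /T -zE gK.
pose T' y := F y `^ q * y `^ (- m) / (extremal (T y) `^ q * T y `^ (- m)).
have Td y : 0 < y <= x -> is_derive y 1 T (T' y).
  move=> yx; have [Ty0 TyE] := TP y yx.
  have := gd _ Ty0; rewrite TyE => gd'.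
  have := is_derive1_comp gd' (Jd yx).
  by rewrite mulrC.
pose D y := E y - p / m * (F y `^ m * (T y `^ (- rho) * y `^ (- n))) - psi (T y).
suff : 0 <= D x.
  have h : 0 <= p / m * (F x `^ m * (tau `^ (- rho) * x `^ (- n))).
    apply: mulr_ge0; first by apply: divr_ge0; exact: ltW.
    by rewrite !mulr_ge0// powR_ge0.
  have TE : T x = tau by rewrite /T Jtau gK.
  rewrite /D TE; lra.
pose dD y := f y `^ p -
    p / m * (m * F y `^ (m - 1) * f y * (T y `^ (- rho) * y `^ (- n)) +
             F y `^ m * (- rho * T y `^ (- rho - 1) * T' y * y `^ (- n) +
                       T y `^ (- rho) * (- n * y `^ (- n - 1)))) -
    extremal (T y) `^ q * T y `^ (- m) * (al * extremal (T y) `^ (- r) - (p - 1) * T y `^ (- r)) * T' y.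
apply: (@ge0_of_is_derive _ D dD).
- move=> y yx; have [Ty0 TyE] := TP y yx; have /andP[y0 _] := yx.
  have dF := is_derive_powR_comp m (Fp y yx) (Fd yx).
  have dT := is_derive_powR_comp (- rho) Ty0 (Td y yx).
  have dy := is_derive_powR (- n) y0.
  have dP := is_deriveZ (p / m) (is_deriveM dF (is_deriveM dT dy)).
  have dpsi' := is_derive1_comp (psid Ty0) (Td y yx).
  have dS := is_deriveB (is_deriveB (Ed yx) dP) dpsi'.
  apply: (is_derive_eq dS).
  rewrite /dD /dpsi /GRing.scale/= !fctE; ring.
- move=> y yx; have [Ty0 TyE] := TP y yx; have /andP[y0 _] := yx.
  apply: bliss_pointwise => //.
  + exact: Fp.
  + exact: extremal_gt0.
  + exact: extremal_powRNr.
  + exact: f_ge0.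
move=> e e0.
(* A linear lower bound T y >= k y is needed because D contains a negative power of T. As F >= c y
   and the extremal is at most t, J' >= c^q y^r, while J0(k y) has derivative at most k^(1 + r) y^r;
   these agree for k = c^p. *)
pose k := c `^ p.
have k0 : 0 < k by rewrite powR_gt0.
have kT y : 0 < y <= x -> k * y <= T y.
  move=> yx; have [Ty0 TyE] := TP y yx; have /andP[y0 yx'] := yx.
  suff : 0 <= J y - J0 (k * y).
    rewrite subr_ge0 -TyE leNgt => h; rewrite leNgt; apply/negP => Tk; move: h; apply/negP; rewrite negbK.
    have Tkd z : T y <= z <= k * y -> is_derive z 1 J0 (extremal z `^ q * z `^ (- m)).
      by move=> /andP[Tz _]; apply: J0d; exact: lt_le_trans Tz.
    have ch : {within `[T y, k * y], continuous J0}.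
      by apply: derivable_within_continuous => z; rewrite in_itv/= => /Tkd[].
    have hd' z : z \in `]T y, k * y[ -> is_derive z 1 J0 (extremal z `^ q * z `^ (- m)).
      by rewrite in_itv/= => /andP[Tz zk]; apply: Tkd; rewrite !ltW.
    have [z] := MVT Tk hd' ch.
    rewrite in_itv/= => /andP[Tz zk] zE; rewrite -subr_gt0 zE mulr_gt0 ?subr_gt0//.
    by apply: phi_gt0; exact: lt_trans Tz.
  apply: (@ge0_of_is_derive _ (fun y => J y - J0 (k * y))
    (fun y => F y `^ q * y `^ (- m) - extremal (k * y) `^ q * (k * y) `^ (- m) * k)).
  - move=> z /andP[z0 zy].
    have zx : 0 < z <= x by rewrite z0 (le_trans zy).
    have kd : is_derive z 1 (fun y : R => k * y) k.
      have := is_deriveZ k (is_derive_id z (1 : R)).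
      by rewrite /GRing.scale/= mulr1.
    exact: (is_deriveB (Jd zx) (is_derive1_comp (J0d (mulr_gt0 k0 z0)) kd)).
  - move=> z /andP[z0 zy].
    have zx : 0 < z <= x by rewrite z0 (le_trans zy).
    have kz0 : 0 < k * z by rewrite mulr_gt0.
    rewrite subr_ge0.
    apply: (@le_trans _ _ ((k * z) `^ q * (k * z) `^ (- m) * k)).
      rewrite !ler_pM2r ?powR_gt0//; apply: powR_le; first exact: ltW.
        exact/ltW/extremal_gt0.
      exact: extremal_le.
    apply: (@le_trans _ _ ((c * z) `^ q * z `^ (- m))); last first.
      rewrite ler_pM2r ?powR_gt0//; apply: powR_le; first exact: ltW.
        by rewrite mulr_ge0// ltW.
      by have /andP[] := FcC zx.
    rewrite le_eqVlt; apply/orP; left; apply/eqP.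
    have cz0 : 0 < c * z by rewrite mulr_gt0.
    rewrite (powR_expR q cz0) !(powR_expR _ z0) !(powR_expR _ kz0).
    have kE : k = expR (p * ln c) by rewrite /k powR_expR.
    have lnk : ln k = p * ln c by rewrite kE expRK.
    rewrite !lnM ?posrE// lnk [X in _ * X = _]kE -!expRD.
    by congr expR; rewrite /q /m; ring.
  - move=> e' e'0; have [d d0 Hd] := J0small e'0.
    pose z := Num.min y (d / (2 * k)).
    have z0 : 0 < z by rewrite lt_min y0 divr_gt0// mulr_gt0.
    have zy : z <= y by rewrite ge_min lexx.
    exists z; first by rewrite z0.
    have zx : 0 < z <= x by rewrite z0 (le_trans zy).
    have kz : k * z < d.
      apply: (@le_lt_trans _ _ (d / 2)); last by lra.
      have h : z <= d / (2 * k) by rewrite ge_min lexx orbT.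
      have -> : d / 2 = k * (d / (2 * k)) by field; rewrite gt_eqF.
      by rewrite ler_pM2l.
    have := Hd (k * z); rewrite mulr_gt0//= => /(_ kz).
    have := J_gt0 zx; lra.
have e20 : 0 < e / 2 by rewrite divr_gt0.
have [d1 d10 Hd1] := E0small e20.
have d120 : 0 < d1 / 2 by rewrite divr_gt0.
have [d2 d20 Hd2] := Jsmall (J0gt0 d120).
(* Since m - rho - n = 1, the bounds F <= C y and T >= k y make the boundary term at most M y. *)
pose M := p / m * (C `^ m * k `^ (- rho)).
have M0 : 0 < M by rewrite mulr_gt0 ?divr_gt0// mulr_gt0 ?powR_gt0.
pose y := Num.min x (Num.min (d2 / 2) (e / 2 / M)).
have y0 : 0 < y by rewrite !lt_min x0 !divr_gt0.
have yx : y <= x by rewrite ge_min lexx.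
have yd2 : y < d2.
  apply: (@le_lt_trans _ _ (d2 / 2)); last by lra.
  by rewrite !ge_min lexx /= orbT.
have yM : M * y <= e / 2.
  by rewrite mulrC -ler_pdivlMr// !ge_min lexx !orbT.
have yx' : 0 < y <= x by rewrite y0.
exists y => //.
have [Ty0 TyE] := TP y yx'.
have Td1 : T y < d1.
  apply: (@lt_trans _ _ (d1 / 2)); last by lra.
  rewrite ltNge; apply/negP => /(J0le _ _ d120); rewrite TyE.
  by rewrite leNgt Hd2// y0.
have E0T : E0 (T y) < e / 2 by apply: Hd1; rewrite Ty0.
have psiT : psi (T y) <= E0 (T y).
  rewrite /psi lerBlDr lerDl; apply: mulr_ge0; first by apply: divr_ge0; exact: ltW.
  by rewrite mulr_ge0 ?powR_ge0.
have P1 : p / m * (F y `^ m * (T y `^ (- rho) * y `^ (- n))) <= M * y.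
  have -> : M * y = p / m * ((C * y) `^ m * ((k * y) `^ (- rho) * y `^ (- n))).
    rewrite /M -mulrA; congr (_ * _).
    rewrite !powRM ?ltW//.
    have -> : C `^ m * y `^ m * (k `^ (- rho) * y `^ (- rho) * y `^ (- n)) =
      C `^ m * k `^ (- rho) * (y `^ m * (y `^ (- rho) * y `^ (- n))) by ring.
    congr (_ * _); rewrite !powR_expR// -!expRD -[LHS](lnK y0); congr expR.
    by rewrite /n /m /rho; field.
  rewrite ler_pM2l ?divr_gt0//; apply: ler_pM; rewrite ?mulr_ge0 ?powR_ge0//.
    apply: powR_le; first exact: ltW.
      exact/ltW/Fp.
    by have /andP[] := FcC yx'.
  rewrite ler_pM2r ?powR_gt0// !powRN lef_pV2 ?posrE ?powR_gt0// ?mulr_gt0//.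
  by apply: powR_le; [exact: ltW|rewrite mulr_ge0// ltW|exact: kT].
have := E_ge0 yx'; rewrite /D; lra.
Qed.

End Path.

(** Replacing f by k f multiplies J by k^q and E by k^p. The choice k^q = J0 tau / J x gives the
    matching required by [bliss_path], and k^p becomes the power 1/(1 + r) of that quotient. *)
Lemma bliss_path_scaled (F f J E : R -> R) (x tau c C : R) :
  0 < x -> 0 < tau -> 0 < c -> 0 < C ->
  (forall y, 0 < y <= x -> 0 <= f y) ->
  (forall y, 0 < y <= x -> is_derive y 1 F (f y)) ->
  (forall y, 0 < y <= x -> is_derive y 1 J (F y `^ q * y `^ (- m))) ->
  (forall y, 0 < y <= x -> is_derive y 1 E (f y `^ p)) ->
  (forall y, 0 < y <= x -> c * y <= F y <= C * y) ->
  (forall y, 0 < y <= x -> 0 < J y) ->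
  (forall y, 0 < y <= x -> 0 <= E y) ->
  (forall e, 0 < e -> exists2 d, 0 < d & forall t, 0 < t < d -> J t < e) ->
  E0 tau - p / m * (extremal tau `^ m * tau `^ (1 - m)) <=
    (J0 tau / J x) `^ (1 + r)^-1 * E x.
Proof.
move=> x0 tau0 c0 C0 f0 Fd Jd Ed FcC Jg Eg Js.
have xx : 0 < x <= x by rewrite x0 lexx.
have Jx0 := Jg x xx.
have JJ0 : 0 < J0 tau / J x := divr_gt0 (J0gt0 tau0) Jx0.
pose k := (J0 tau / J x) `^ q^-1.
have k0 : 0 < k := powR_gt0 _ JJ0.
have qn0 : q != 0 by rewrite gt_eqF.
have kq : k `^ q = J0 tau / J x.
  by rewrite /k -powRrM mulVf// powRr1//; exact: ltW JJ0.
have kp : k `^ p = (J0 tau / J x) `^ (1 + r)^-1.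
  by rewrite /k -powRrM; congr (_ `^ _); rewrite /q; field; rewrite r1n0 pn0.
have kq0 : 0 < k `^ q := powR_gt0 _ k0.
have dZ (u : R -> R) (du a y : R) : is_derive y 1 u du ->
    is_derive y 1 (fun y => a * u y) (a * du).
  by move=> /(is_deriveZ a).
rewrite -kp.
apply: (@bliss_path (fun y => k * F y) (fun y => k * f y)
  (fun y => k `^ q * J y) (fun y => k `^ p * E y) x tau (k * c) (k * C)) => //.
- exact: mulr_gt0.
- exact: mulr_gt0.
- by move=> y yx; rewrite mulr_ge0 ?f0// ltW.
- by move=> y yx; apply: dZ; exact: Fd.
- move=> y yx; have /andP[y0 _] := yx; have /andP[h _] := FcC y yx.
  rewrite powRM ?(ltW k0)//; last by rewrite (le_trans _ h)// mulr_ge0// ltW.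
  by rewrite -mulrA; apply: dZ; exact: Jd.
- move=> y yx; rewrite powRM ?(ltW k0) ?f0//.
  by apply: dZ; exact: Ed.
- by move=> y yx; rewrite -!mulrA !ler_pM2l// FcC.
- by move=> y yx; rewrite mulr_gt0 ?Jg.
- by move=> y yx; rewrite mulr_ge0 ?powR_ge0 ?Eg.
- move=> e e0; have [d d0 Hd] := Js _ (divr_gt0 e0 kq0).
  exists d => // t td; have := Hd t td.
  by rewrite (ltr_pdivlMr _ _ kq0) => h; rewrite mulrC.
- by rewrite kq divfK// gt_eqF.
Qed.

End BlissCore.

Section PrimitiveLimit.
Context {R : realType}.
Notation mu := (@lebesgue_measure R).
Implicit Types (x y e t : R).

Lemma belowy : below +oo%E = (`]0, +oo[ : set R)%classic.
Proof.
by apply/seteqP; split => t /=; rewrite in_itv/= andbT /below/= ltry => // -[].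
Qed.

Lemma bigcup_below : \bigcup_n (below (n%:R%:E)) = `]0, +oo[%classic :> set R.
Proof.
apply/seteqP; split => t /=; rewrite in_itv/= andbT; first by move=> [n _ []].
move=> t0; exists (Num.truncn t).+1 => //; split => //.
by rewrite lte_fin truncnS_gt.
Qed.

Lemma primitivey_gt (f : R -> \bar R) (v : \bar R) :
  measurable_fun (`]0%R, +oo[ : set R) f -> (forall x, 0 < x -> (0 <= f x)%E) ->
  (v < primitive f +oo)%E -> exists2 t : R, 0 < t & (v < primitive f t%:E)%E.
Proof.
move=> mf f0 vf.
have := @ge0_nondecreasing_set_cvg_integral _ (measurableTypeR R) R (fun n => below n%:R%:E) f mu.
move=> /(_ _ (fun n => measurable_below _) _ _)/cvg_lim H.
move: vf; rewrite /primitive belowy -bigcup_below -H//; last 3 first.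
- apply/nondecreasing_seqP => n; apply/subsetPset => t [t0 tn]; split => //.
  by rewrite (lt_trans tn)// lte_fin ltr_nat.
- by move=> n; apply: measurable_funS mf => // t [t0 _] /=; rewrite in_itv/= t0.
- by move=> n t [t0 _]; exact: f0.
move=> vl; apply: contrapT => nt; move: vl; apply/negP; rewrite -leNgt.
apply: lime_le.
  apply: ereal_nondecreasing_is_cvgn => i j ij; apply: ge0_subset_integral.
  - exact: measurable_below.
  - exact: measurable_below.
  - by apply: measurable_funS mf => // t [t0 _] /=; rewrite in_itv/= t0.
  - by move=> t [t0 _]; exact: f0.
  - by move=> t [t0 ti]; split => //; rewrite (lt_le_trans ti)// lee_fin ler_nat.
apply: nearW => -[|n].
  rewrite (_ : below _ = set0).
    rewrite integral_set0 leNgt; apply/negP => v0; apply: nt; exists 1 => //.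
    by rewrite (lt_le_trans v0)//; apply: integral_ge0 => t [t0 _]; exact: f0.
  by rewrite below_itv; apply/seteqP; split => // t /=; rewrite in_itv/= => /andP[t0]; rewrite ltNge ltW.
rewrite leNgt; apply/negP => vn; apply: nt; exists n.+1%:R => //.
Qed.

Lemma primitive_bounded (f : R -> R) (x M : R) : 0 < x ->
  measurable_fun (`]0%R, +oo[ : set R) f ->
  (forall y, 0 < y < x -> 0 <= f y <= M) ->
  (primitive (EFin \o f) x%:E <= (M * x)%:E)%E.
Proof.
move=> x0 mf fM; rewrite /primitive.
apply: (@le_trans _ _ (\int[mu]_(t in below x%:E) cst M%:E t)%E); last first.
  rewrite integral_cst; last exact: measurable_below.
  have h : mu (below x%:E) = x%:E by apply: lebesgue_measure_below; rewrite lee_fin ltW.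
  by rewrite EFinM -{2}h.
apply: ge0_le_integral.
- exact: measurable_below.
- move=> t [t0]; rewrite lte_fin => tx; rewrite lee_fin.
  by have := fM t; rewrite t0 tx => /(_ isT)/andP[].
- apply/measurable_EFinP; apply: measurable_funS mf => // t [t0 _] /=.
  by rewrite in_itv/= t0.
- exact: measurable_cst.
- move=> t [t0]; rewrite lte_fin => tx; rewrite lee_fin.
  by have := fM t; rewrite t0 tx => /(_ isT)/andP[].
Qed.

(** At a zero of f the power need not be differentiable when s < 1, so continuity there is checked
    directly; elsewhere it follows from the derivative. *)
Lemma continuous_powR_comp (f : R -> R) (s x : R) : 0 < s -> 0 < x ->
  (forall y, 0 < y -> 0 <= f y) ->
  {for x, continuous f} -> {for x, continuous (fun y => f y `^ s)}.
Proof.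
move=> s0 x0 f0 cf; have := f0 _ x0; rewrite le_eqVlt => /predU1P[fx0|fx0].
  apply/cvgrPdist_lt => e e0; rewrite -fx0 powR0 ?gt_eqF//.
  have es0 : 0 < e `^ s^-1 by rewrite powR_gt0.
  have /cvgrPdist_lt/(_ _ es0) H := cf.
  near=> y; rewrite sub0r normrN ger0_norm ?powR_ge0//.
  have y0 : 0 < y by near: y; exact: lt_nbhsr.
  have : `|f x - f y| < e `^ s^-1 by near: y.
  rewrite -fx0 sub0r normrN ger0_norm ?f0// => h.
  have -> : e = (e `^ s^-1) `^ s by rewrite -powRrM mulVf ?gt_eqF// powRr1// ltW.
  by apply: gt0_ltr_powR => //; rewrite nnegrE ?powR_ge0// f0.
apply: (@continuous_comp _ _ _ f (fun t => t `^ s)) => //.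
exact: is_derive_continuous (is_derive_powR s fx0).
Unshelve. all: by end_near. Qed.

End PrimitiveLimit.

(** * The inequality for bounded continuous non-increasing functions *)

Section SmoothBliss.
Context {R : realType}.
Notation mu := (@lebesgue_measure R).
Implicit Types (x y e t : R).
Variables (p r : R).
Hypotheses (p1 : 1 < p).

Let q := p * (1 + r).
Let m := p + r * (p - 1).

Let p0 : 0 < p. Proof. exact: lt_trans ltr01 p1. Qed.

Section Smooth.
Hypothesis r0 : 0 <= r.
Let q0 : 0 < q. Proof. by rewrite /q mulr_gt0// ltr_wpDr. Qed.

Variable (f : R -> R) (C : R).
Hypotheses (f0 : forall x, 0 < x -> 0 <= f x)
  (fn : forall x y, 0 < x -> x <= y -> f y <= f x)
  (fC : forall x, 0 < x -> f x <= C)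
  (cf : forall x, 0 < x -> {for x, continuous f}).

Let F := real_primitive f.
Let phiJ y := F y `^ q * y `^ (- m).
Let phiE y := f y `^ p.

Let C0 : 0 <= C. Proof. by apply: le_trans (fC ltr01); exact: f0. Qed.

Let mf : measurable_fun (`]0%R, +oo[ : set R) f.
Proof. exact: measurable_continuous_pos. Qed.

Let ff x : 0 < x -> (primitive (EFin \o f) x%:E < +oo)%E.
Proof.
move=> x0; apply: (@le_lt_trans _ _ (C * x)%:E); last exact: ltry.
by apply: primitive_bounded => // y /andP[y0 _]; rewrite f0// fC.
Qed.

Let Fd x : 0 < x -> is_derive x 1 F (f x).
Proof. by move=> x0; exact: is_derive_real_primitive. Qed.

Let FC x : 0 < x -> F x <= C * x.
Proof.
move=> x0; rewrite -lee_fin -real_primitiveE//.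
by apply: primitive_bounded => // y /andP[y0 _]; rewrite f0// fC.
Qed.

Let F0 x : 0 <= F x. Proof. exact: real_primitive_ge0. Qed.

Let Favg x y : 0 < x -> x <= y -> F y / y <= F x / x.
Proof.
move=> x0 xy; have y0 := lt_le_trans x0 xy.
have := @average_nincr R (EFin \o f) _ _ x y x0 xy.
rewrite !real_primitiveE// -!EFinM lee_fin; apply.
  by move=> s s0; rewrite lee_fin f0.
by move=> s t s0 st; rewrite lee_fin fn.
Qed.

Lemma continuous_smoothJ x : 0 < x -> {for x, continuous phiJ}.
Proof.
move=> x0; apply: continuousM.
  by apply: continuous_powR_comp => //; exact: is_derive_continuous (Fd x0).
exact: is_derive_continuous (is_derive_powR (- m) x0).
Qed.

Lemma continuous_smoothE x : 0 < x -> {for x, continuous phiE}.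
Proof. by move=> x0; apply: continuous_powR_comp => //; exact: cf. Qed.

Lemma smoothJ_ge0 x : 0 <= phiJ x.
Proof. by rewrite mulr_ge0 ?powR_ge0. Qed.

Lemma smoothE_ge0 x : 0 <= phiE x.
Proof. by rewrite powR_ge0. Qed.

(** The singularity of y^-m is cancelled by F <= C y: since q - m = r, the integrand is at most C^q
    y^r. *)
Lemma smoothJ_lty x : 0 < x -> (primitive (EFin \o phiJ) x%:E < +oo)%E.
Proof.
move=> x0; apply: (@le_lt_trans _ _ (C `^ q * x `^ r * x)%:E); last exact: ltry.
apply: primitive_bounded => //.
  by apply: measurable_continuous_pos; exact: continuous_smoothJ.
move=> y /andP[y0 yx]; rewrite smoothJ_ge0/=.
apply: (@le_trans _ _ ((C * y) `^ q * y `^ (- m))).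
  by rewrite ler_wpM2r ?powR_ge0// powR_le ?(ltW q0)// FC.
rewrite powRM ?(ltW y0)// -mulrA ler_wpM2l ?powR_ge0//.
rewrite -powRD; last by apply/implyP => _; rewrite gt_eqF.
rewrite (_ : q - m = r); last by rewrite /q /m; ring.
by rewrite powR_le// ltW.
Qed.

Lemma smoothE_lty x : 0 < x -> (primitive (EFin \o phiE) x%:E < +oo)%E.
Proof.
move=> x0; apply: (@le_lt_trans _ _ (C `^ p * x)%:E); last exact: ltry.
apply: primitive_bounded => //.
  by apply: measurable_continuous_pos; exact: continuous_smoothE.
move=> y /andP[y0 yx]; rewrite smoothE_ge0/=.
by rewrite powR_le ?(ltW p0)// ?f0// fC.
Qed.

Let J := real_primitive phiJ.
Let E := real_primitive phiE.

Lemma smooth_degenerate x : 0 < x -> F x = 0 -> J x = 0.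
Proof.
move=> x0 Fx; rewrite /J /real_primitive /primitive integral0_eq// => y [y0].
rewrite lte_fin => yx; congr EFin.
have -> : phiJ y = 0; last by [].
rewrite /phiJ (_ : F y = 0) ?powR0 ?mul0r// ?gt_eqF//.
by apply/eqP; rewrite eq_le F0 andbT -Fx; apply: real_primitive_le => //; exact: ltW.
Qed.

(** Young's inequality with G = (F/(p' y))^(p - 1) gives D' >= 0. Equality means f = F/(p' y), so f
    is a multiple of y^(-1/p), a power just outside L^p; this is why there is no extremal. *)
Lemma hardy_smooth : r = 0 -> forall x, 0 < x ->
  (conjexp p) `^ (- p) * J x <= E x.
Proof.
move=> rE x x0.
have qE : q = p by rewrite /q rE addr0 mulr1.
have mE : m = p by rewrite /m rE mul0r addr0.
have [Fx0|Fxn0] := eqVneq (F x) 0.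
  by rewrite smooth_degenerate// mulr0; exact: (real_primitive_ge0 (fun y _ => smoothE_ge0 y)).
have Fx : 0 < F x by rewrite lt_neqAle eq_sym Fxn0 F0.
have Fp y : 0 < y <= x -> 0 < F y.
  move=> /andP[y0 yx]; have := Favg y0 yx; rewrite ler_pdivlMr// => h.
  by rewrite (lt_le_trans _ h)// mulr_gt0 ?divr_gt0.
set p' := conjexp p.
have p'E : p' = p / (p - 1).
  by rewrite /p' /conjexp; field; rewrite !gt_eqF ?subr_gt0//; lra.
have p'0 : 0 < p' by rewrite p'E divr_gt0// subr_gt0.
pose D y := E y - p' `^ (1 - p) * (F y `^ p * y `^ (1 - p)) - p' `^ (- p) * J y.
have Jd y : 0 < y -> is_derive y 1 J (F y `^ p * y `^ (- p)).
  move=> y0; rewrite -{1}qE -mE.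
  exact: (is_derive_real_primitive (fun x _ => smoothJ_ge0 x) continuous_smoothJ smoothJ_lty y0).
have Ed y : 0 < y -> is_derive y 1 E (f y `^ p).
  move=> y0.
  exact: (is_derive_real_primitive (fun x _ => smoothE_ge0 x) continuous_smoothE smoothE_lty y0).
suff : 0 <= D x.
  have h : 0 <= p' `^ (1 - p) * (F x `^ p * x `^ (1 - p)) by rewrite !mulr_ge0// powR_ge0.
  rewrite /D; lra.
apply: (@ge0_of_is_derive _ D (fun y => f y `^ p -
    p' `^ (1 - p) * (F y `^ p * ((1 - p) * y `^ (- p)) +
      y `^ (1 - p) * (p * F y `^ (p - 1) * f y)) - p' `^ (- p) * (F y `^ p * y `^ (- p)))).
- move=> y /[dup] yx /andP[y0 _].
  have dF := is_derive_powR_comp p (Fp y yx) (Fd y0).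
  have dy := is_derive_powR (1 - p) y0.
  have dP := is_deriveZ (p' `^ (1 - p)) (is_deriveM dF dy).
  have dS := is_deriveB (is_deriveB (Ed y y0) dP) (is_deriveZ (p' `^ (- p)) (Jd y y0)).
  apply: (is_derive_eq dS).
  by rewrite /GRing.scale/= (_ : 1 - p - 1 = - p)//; ring.
- move=> y /[dup] yx /andP[y0 _]; have Fy := Fp y yx.
  set G := p' `^ (1 - p) * F y `^ (p - 1) * y `^ (1 - p).
  set H := p' `^ (- p) * F y `^ p * y `^ (- p).
  have G0 : 0 <= G by rewrite !mulr_ge0// powR_ge0.
  have conj : p^-1 + p'^-1 = 1 by rewrite /p' /conjexp invrK; ring.
  have := conjugate_powR (f0 y0) G0 p0 p'0 conj.
  have pn0 : p != 0 by rewrite gt_eqF.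
  have p1n0 : p - 1 != 0 by rewrite gt_eqF// subr_gt0.
  have -> : G `^ p' = H.
    rewrite /G /H (powR_expR (1 - p) p'0) (powR_expR (- p) p'0) !(powR_expR _ Fy) !(powR_expR _ y0).
    rewrite -!expRD powR_expR ?expR_gt0// expRK; congr expR.
    by rewrite p'E; field.
  have -> : p' `^ (1 - p) * (F y `^ p * ((1 - p) * y `^ (- p)) +
      y `^ (1 - p) * (p * F y `^ (p - 1) * f y)) = (1 - p) * p' * H + p * (f y * G).
    have -> : p' `^ (1 - p) = p' * p' `^ (- p).
      by rewrite powRD ?powRr1 ?ltW//; apply/implyP => _; rewrite gt_eqF.
    by rewrite /G /H; have -> : p' `^ (1 - p) = p' * p' `^ (- p);
      [rewrite powRD ?powRr1 ?ltW//; apply/implyP => _; rewrite gt_eqF|ring].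
  have -> : p' `^ (- p) * (F y `^ p * y `^ (- p)) = H by rewrite /H mulrA.
  rewrite -(ler_pM2l p0) => Y.
  have : p * (f y `^ p / p + H / p') = f y `^ p + (p - 1) * H.
    by rewrite p'E; field; rewrite pn0 p1n0.
  have : (1 - p) * p' = - p by rewrite p'E; field.
  by move=> -> e; move: Y; rewrite e; lra.
- move=> e e0; have e20 : 0 < e / 2 by rewrite divr_gt0.
  pose c := p' `^ (- p).
  have c0 : 0 < c by rewrite powR_gt0.
  have [d d0 Hd] := real_primitive_small (fun x _ => smoothJ_ge0 x) continuous_smoothJ smoothJ_lty (divr_gt0 e20 c0).
  (* The boundary term is at most (M - 1) y; the summand 1 makes division by M legitimate even when
     C = 0. *)
  pose M := p' `^ (1 - p) * C `^ p + 1.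
  have M0 : 0 < M by rewrite ltr_wpDl// mulr_ge0 ?powR_ge0.
  pose y := Num.min x (Num.min (d / 2) (e / 2 / M)).
  have y0 : 0 < y by rewrite !lt_min x0 !divr_gt0.
  have yx : y <= x by rewrite ge_min lexx.
  have yd : y < d.
    apply: (@le_lt_trans _ _ (d / 2)); last by lra.
    by rewrite !ge_min lexx /= orbT.
  have yM : M * y <= e / 2.
    by rewrite mulrC -ler_pdivlMr// !ge_min lexx !orbT.
  exists y; first by rewrite y0.
  have Jy : c * J y < e / 2.
    by rewrite mulrC -ltr_pdivlMr//; apply: Hd; rewrite y0.
  have B : p' `^ (1 - p) * (F y `^ p * y `^ (1 - p)) <= M * y.
    apply: (@le_trans _ _ (p' `^ (1 - p) * C `^ p * y)); last first.
      by rewrite ler_pM2r// lerDl.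
    rewrite -mulrA ler_pM2l ?powR_gt0//.
    apply: (@le_trans _ _ ((C * y) `^ p * y `^ (1 - p))).
      by rewrite ler_pM2r ?powR_gt0// powR_le ?(ltW p0)// FC.
    rewrite powRM ?(ltW y0)// -mulrA -powRD; last by apply/implyP => _; rewrite gt_eqF.
    by rewrite addrC subrK powRr1// ltW.
  have Ey : 0 <= E y by exact: (real_primitive_ge0 (fun x _ => smoothE_ge0 x)).
  rewrite /D -/c; lra.
Qed.

(** Let tau tend to infinity in [bliss_path_scaled]: J0 tau stays below jinf, E0 tau tends to einf,
    and the boundary term is at most p/m tau^(1 - m), which vanishes because the extremal is at most
    1 and m > 1. *)
Lemma bliss_smooth (jinf einf : R) : 0 < r -> 0 < jinf -> 0 < einf ->
  (primitive (fun t => (extremal r t `^ q * t `^ (- m))%:E) +oo = jinf%:E)%E ->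
  (primitive (fun t => (extremal_deriv r t `^ p)%:E) +oo = einf%:E)%E ->
  forall x, 0 < x -> J x / jinf <= (E x / einf) `^ (1 + r).
Proof.
move=> rp jinf0 einf0 HJ HE x x0.
have [Fx0|Fxn0] := eqVneq (F x) 0.
  by rewrite smooth_degenerate// mul0r powR_ge0.
have Fx : 0 < F x by rewrite lt_neqAle eq_sym Fxn0 F0.
have Fp y : 0 < y -> 0 < F y.
  move=> y0; have [yx|xy] := leP y x.
    have := Favg y0 yx; rewrite ler_pdivlMr// => h.
    by rewrite (lt_le_trans _ h)// mulr_gt0 ?divr_gt0.
  by rewrite (lt_le_trans Fx)//; apply: real_primitive_le => //; exact: ltW.
pose phi t := extremal r t `^ q * t `^ (- m).
pose eps t := extremal_deriv r t `^ p.
have phi_gt0 t : 0 < t -> 0 < phi t.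
  by move=> t0; apply: mulr_gt0; apply: powR_gt0 => //; exact: extremal_gt0.
have eps_gt0 t : 0 < t -> 0 < eps t.
  by move=> t0; apply: powR_gt0; exact: extremal_deriv_gt0.
have phi_ge0 t : 0 < t -> 0 <= phi t by move=> /phi_gt0/ltW.
have eps_ge0 t : 0 < t -> 0 <= eps t by move=> /eps_gt0/ltW.
have dext t := @is_derive_extremal R r rp t.
have cphi t : 0 < t -> {for t, continuous phi}.
  move=> t0; apply: continuousM.
    exact: (is_derive_continuous (@is_derive_powR_comp R (extremal r) q t _ (extremal_gt0 r t0) (dext _ t0))).
  exact: is_derive_continuous (is_derive_powR (- m) t0).
have ceps t : 0 < t -> {for t, continuous eps}.
  move=> t0; apply: continuous_powR_comp => //.
    by move=> y y0; rewrite powR_ge0.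
  apply: continuous_powR_comp => //; first by rewrite addr_gt0.
    by move=> y y0; apply: divr_ge0; apply: ltW => //; exact: extremal_gt0.
  apply: continuousM; first exact: is_derive_continuous (dext _ t0).
  by apply: continuousV => //; rewrite gt_eqF.
have mphi := measurable_continuous_pos cphi.
have meps := measurable_continuous_pos ceps.
have prim_le (u : R -> R) t : measurable_fun (`]0%R, +oo[ : set R) u ->
    (forall y, 0 < y -> 0 <= u y) ->
    (primitive (EFin \o u) t%:E <= primitive (EFin \o u) +oo)%E.
  move=> mu0 u0; apply: ge0_subset_integral.
  - exact: measurable_below.
  - exact: measurable_below.
  - by rewrite belowy; exact/measurable_EFinP.
  - by move=> y [y0 _]; rewrite lee_fin u0.
  - by move=> y [y0 _]; split => //; exact: ltry.
have fphi t : 0 < t -> (primitive (EFin \o phi) t%:E < +oo)%E.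
  by move=> t0; rewrite (le_lt_trans (prim_le _ _ mphi phi_ge0))// HJ ltry.
have feps t : 0 < t -> (primitive (EFin \o eps) t%:E < +oo)%E.
  by move=> t0; rewrite (le_lt_trans (prim_le _ _ meps eps_ge0))// HE ltry.
pose J0 := real_primitive phi; pose E0 := real_primitive eps.
have Jgt0 y : 0 < y -> 0 < J y.
  move=> y0; apply: (real_primitive_gt0 (fun x _ => smoothJ_ge0 x) continuous_smoothJ smoothJ_lty _ y0).
  by move=> z z0; apply: mulr_gt0; apply: powR_gt0; [exact: Fp|exact: z0].
have Jx0 := Jgt0 x x0.
have Ege0 y : 0 <= E y by exact: (real_primitive_ge0 (fun x _ => smoothE_ge0 x)).
have Jd y : 0 < y -> is_derive y 1 J (phiJ y).
  move=> y0.
  exact: (is_derive_real_primitive (fun x _ => smoothJ_ge0 x) continuous_smoothJ smoothJ_lty y0).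
have Ed y : 0 < y -> is_derive y 1 E (phiE y).
  move=> y0.
  exact: (is_derive_real_primitive (fun x _ => smoothE_ge0 x) continuous_smoothE smoothE_lty y0).
have J0gt0 t : 0 < t -> 0 < J0 t by exact: real_primitive_gt0.
have J0le t : 0 < t -> J0 t <= jinf.
  by move=> t0; rewrite -lee_fin -real_primitiveE// -HJ; exact: prim_le.
have key tau : 0 < tau ->
    E0 tau - p / m * (extremal r tau `^ m * tau `^ (1 - m)) <=
    (J0 tau / J x) `^ (1 + r)^-1 * E x.
  move=> tau0.
  (* F x / x is a lower slope of F on (0, x] because averages decrease; [C + 1] is an upper slope
     that is visibly positive. *)
  have H := @bliss_path_scaled R p r p1 rp J0 E0
    (@is_derive_real_primitive R phi phi_ge0 cphi fphi)
    (@is_derive_real_primitive R eps eps_ge0 ceps feps)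
    (@real_primitive_small R phi phi_ge0 cphi fphi)
    (@real_primitive_small R eps eps_ge0 ceps feps)
    (@real_primitive_surj R phi phi_ge0 cphi fphi)
    J0gt0 F f J E x tau (F x / x) (C + 1) x0 tau0 (divr_gt0 Fx x0) (ltr_wpDl C0 ltr01).
  refine (H _ _ _ _ _ _ _ _) => {H}.
  - by move=> y /andP[y0 _]; exact: f0.
  - by move=> y /andP[y0 _]; exact: Fd.
  - by move=> y /andP[y0 _]; exact: Jd.
  - by move=> y /andP[y0 _]; exact: Ed.
  - move=> y /andP[y0 yx].
    have h1 : F y <= (C + 1) * y by rewrite (le_trans (FC y0))// ler_pM2r// lerDl.
    have h2 : F x / x * y <= F y by rewrite -ler_pdivlMr// Favg.
    by rewrite h1 h2.
  - by move=> y /andP[y0 _]; exact: Jgt0.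
  - by move=> y _; exact: Ege0.
  - move=> e e0.
    exact: (real_primitive_small (fun x _ => smoothJ_ge0 x) continuous_smoothJ smoothJ_lty e0).
pose V := (jinf / J x) `^ (1 + r)^-1 * E x.
have keyV tau : 0 < tau -> E0 tau - p / m * tau `^ (1 - m) <= V.
  move=> tau0; apply: (@le_trans _ _ (E0 tau - p / m * (extremal r tau `^ m * tau `^ (1 - m)))).
    have m0 : 0 < m by rewrite /m addr_gt0// mulr_gt0// subr_gt0.
    rewrite lerD2l lerN2 ler_pM2l ?divr_gt0// ler_piMl ?powR_ge0//.
    have : extremal r tau `^ m <= 1 `^ m.
      by apply: powR_le; [exact: ltW|exact/ltW/extremal_gt0|exact: extremal_le1].
    by rewrite powR1.
  apply: (le_trans (key _ tau0)); rewrite /V ler_wpM2r//.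
  apply: powR_le; first by rewrite invr_ge0 ltW// addr_gt0.
    exact/ltW/(divr_gt0 (J0gt0 _ tau0) Jx0).
  by rewrite ler_pM2r ?invr_gt0// J0le.
have eV : einf <= V.
  rewrite leNgt; apply/negP => Ve.
  pose d := (einf - V) / 2.
  have d0 : 0 < d by rewrite divr_gt0// subr_gt0.
  have m1 : 0 < m - 1.
    have : 0 < r * (p - 1) by rewrite mulr_gt0// subr_gt0.
    by have := p1; rewrite /m; lra.
  have [t t0 Ht] : exists2 t : R, 0 < t & ((V + d)%:E < primitive (EFin \o eps) t%:E)%E.
    apply: primitivey_gt.
    - exact/measurable_EFinP.
    - by move=> y y0; rewrite lee_fin eps_ge0.
    - by rewrite HE lte_fin /d; lra.
  (* t1 solves p/m t^(1 - m) = d. Beyond t and t1 the boundary term is at most d, while E0 already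
     exceeds V + d. *)
  pose t1 := (d / (p / m)) `^ (- (m - 1)^-1).
  have pm0 : 0 < p / m by rewrite divr_gt0//; move: m1; lra.
  have t10 : 0 < t1 by rewrite powR_gt0// divr_gt0.
  pose tau := Num.max t t1.
  have tau0 : 0 < tau by rewrite lt_max t0.
  have k1 := keyV _ tau0.
  have k2 : V + d < E0 tau.
    rewrite -lte_fin -real_primitiveE//; apply: (lt_le_trans Ht).
    apply: ge0_subset_integral.
    - exact: measurable_below.
    - exact: measurable_below.
    - apply/measurable_EFinP; apply: measurable_funS meps => // y [y0 _] /=.
      by rewrite in_itv/= y0.
    - by move=> y [y0 _]; rewrite lee_fin eps_ge0.
    - move=> y [y0 yt]; split => //; rewrite (lt_le_trans yt)// lee_fin.
      by rewrite /tau le_max lexx.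
  have k3 : p / m * tau `^ (1 - m) <= d.
    rewrite mulrC -ler_pdivlMr//.
    have -> : d / (p / m) = t1 `^ (1 - m).
      rewrite /t1 -powRrM (_ : - (m - 1)^-1 * (1 - m) = 1); last first.
        by rewrite -(opprB m) mulrNN mulVf// gt_eqF.
      by rewrite powRr1// ltW// divr_gt0.
    rewrite (_ : 1 - m = - (m - 1)); last by rewrite opprB.
    rewrite !powRN lef_pV2; [|exact: (powR_gt0 _ tau0)|exact: (powR_gt0 _ t10)].
    by apply: powR_le; [exact: ltW|exact: ltW|rewrite /tau le_max lexx orbT].
  move: k1; rewrite lerBlDr => k1; have := lt_le_trans k2 k1.
  by rewrite ltrD2l ltNge k3.
have r1 : 0 < 1 + r by rewrite addr_gt0.
have h1 : (J x / jinf) `^ (1 + r)^-1 <= E x / einf.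
  rewrite ler_pdivlMr// mulrC -ler_pdivlMr ?powR_gt0 ?divr_gt0//.
  apply: (le_trans eV); rewrite /V mulrC ler_wpM2l//.
  rewrite -(invf_div (J x)); have u0 : 0 < J x / jinf := divr_gt0 Jx0 jinf0.
  by rewrite !powR_expR ?invr_gt0// lnV ?posrE// mulrN expRN.
have -> : J x / jinf = ((J x / jinf) `^ (1 + r)^-1) `^ (1 + r).
  by rewrite -powRrM mulVf ?gt_eqF// powRr1// divr_ge0// ltW.
by apply: powR_le; [exact: ltW|exact: powR_ge0|].
Qed.

End Smooth.
End SmoothBliss.

(** * Extension to all non-increasing functions by forward averages *)

Section NonincreasingBliss.
Context {R : realType}.
Notation mu := (@lebesgue_measure R).
Implicit Types (x y e t h : R).
Variables (p r : R).
Hypotheses (p1 : 1 < p) (r0 : 0 <= r).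

Let q := p * (1 + r).
Let m := p + r * (p - 1).
Let p0 : 0 < p. Proof. exact: lt_trans ltr01 p1. Qed.
Let q0 : 0 < q. Proof. by rewrite /q mulr_gt0// ltr_wpDr. Qed.

(** Common form of the cases r = 0 and r > 0, so that the passage to general non-increasing
    functions is made once. For bounded f the integrals up to x are finite, so [real_primitive] is
    the true integral. *)
Definition bliss_for_smooth (B : R) : Prop := forall (f : R -> R) (C : R),
  (forall x, 0 < x -> 0 <= f x) -> (forall x y, 0 < x -> x <= y -> f y <= f x) ->
  (forall x, 0 < x -> f x <= C) -> (forall x, 0 < x -> {for x, continuous f}) ->
  forall x, 0 < x ->
  real_primitive (fun y => real_primitive f y `^ q * y `^ (- m)) x <=
  B * real_primitive (fun y => f y `^ p) x `^ (1 + r).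

Variable B : R.
Hypotheses (B0 : 0 < B) (smoothB : bliss_for_smooth B).

Section Fixed.
Variable g : R -> \bar R.
Hypothesis g0 : forall s, 0 < s -> (0 <= g s)%E.
Hypothesis gn : forall s t, 0 < s -> s <= t -> (g t <= g s)%E.
Variable N : R.
Hypothesis gN : (\int[mu]_(x in `]0%R, +oo[) g x `^ p = N%:E)%E.

Let mg : measurable_fun (`]0%R, +oo[ : set R) g.
Proof. exact: nonincreasing_emeasurable. Qed.

Let N0 : 0 <= N.
Proof. by rewrite -lee_fin -gN; apply: integral_ge0 => x _; exact: poweR_ge0. Qed.

Let mgp : measurable_fun (`]0%R, +oo[ : set R) (fun x => g x `^ p)%E.
Proof. exact: (measurableT_comp (measurable_poweR p) mg). Qed.

Let g_lty x : 0 < x -> (primitive g x%:E < +oo)%E.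
Proof.
move=> x0; apply: (@le_lt_trans _ _ (x + N)%:E); last exact: ltry.
(* Pointwise g <= 1 + g^p, so the primitive at x is at most x + N. *)
apply: (@le_trans _ _ (\int[mu]_(y in below x%:E) (cst 1%E y + g y `^ p))%E).
  have mgb : measurable_fun (below x%:E) g by exact: measurable_fun_below.
  have mgpb : measurable_fun (below x%:E) (fun y => g y `^ p)%E.
    exact: (measurableT_comp (measurable_poweR p) mgb).
  apply: ge0_le_integral.
  - exact: measurable_below.
  - by move=> y [y0 _]; exact: g0.
  - exact: mgb.
  - exact: emeasurable_funD.
  - move=> y [y0 _]; have := g0 y0; rewrite /cst; case: (g y) => [v| |]//.
    + rewrite lee_fin => v0; rewrite poweR_EFin -EFinD lee_fin.
      have [v1|v1] := leP v 1; first by rewrite (le_trans v1)// lerDl powR_ge0.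
      by rewrite ler_wpDl// le1r_powR// ltW.
    + by move=> _; rewrite poweRyr ?gt_eqF// addey.
rewrite ge0_integralD//; last 3 first.
- exact: measurable_below.
- by move=> y _; exact: poweR_ge0.
- apply: (measurableT_comp (measurable_poweR p)).
  exact: measurable_fun_below.
rewrite integral_cst; last exact: measurable_below.
have h : mu (below x%:E) = x%:E by apply: lebesgue_measure_below; rewrite lee_fin ltW.
rewrite mul1e EFinD -gN; apply: leeD; first by rewrite -[leRHS]h.
apply: ge0_subset_integral => //; first exact: measurable_below.
- by move=> y _; exact: poweR_ge0.
- by move=> y [y0 _] /=; rewrite in_itv/= y0.
Qed.

Let g_fin x : 0 < x -> g x = (fine (g x))%:E.
Proof.
move=> x0; rewrite fineK// ge0_fin_numE ?g0// ltNge leye_eq; apply/negP => /eqP gx.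
have := g_lty x0; rewrite ltNge => /negP; apply.
by apply: le_trans (mul_le_primitive g0 gn x0); rewrite gx gt0_muley// lte_fin.
Qed.

Let gr y := fine (g y).
Let G := real_primitive gr.

Let gr0 x : 0 < x -> 0 <= gr x.
Proof. by move=> x0; rewrite -lee_fin -g_fin ?g0. Qed.

Let grn x y : 0 < x -> x <= y -> gr y <= gr x.
Proof. by move=> x0 xy; rewrite -lee_fin -!g_fin ?gn// (lt_le_trans x0). Qed.

Let primitive_gr (z : \bar R) : primitive (EFin \o gr) z = primitive g z.
Proof. by apply: eq_integral => y /set_mem[y0 _]; rewrite /= -g_fin. Qed.

Let GE x : 0 < x -> primitive g x%:E = (G x)%:E.
Proof.
move=> x0; rewrite -primitive_gr; apply: real_primitiveE => //.
by move=> y y0; rewrite primitive_gr g_lty.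
Qed.

Let mgr : measurable_fun (`]0%R, +oo[ : set R) gr.
Proof. by apply: measurableT_comp => //. Qed.

Let fgr x : 0 < x -> (primitive (EFin \o gr) x%:E < +oo)%E.
Proof. by move=> x0; rewrite primitive_gr g_lty. Qed.

Let G0 x : 0 <= G x. Proof. exact: real_primitive_ge0. Qed.

Let G_le_add x y : 0 < x -> x <= y -> G y <= G x + (y - x) * gr x.
Proof.
move=> x0 xy; have y0 := lt_le_trans x0 xy; rewrite -lee_fin EFinD EFinM -!GE// -g_fin//.
exact: primitive_le_add.
Qed.

Let G_ge_add x y : 0 < x -> x <= y -> G x + (y - x) * gr y <= G y.
Proof.
move=> x0 xy; have y0 := lt_le_trans x0 xy; rewrite -lee_fin EFinD EFinM -!GE// -g_fin//.
exact: primitive_ge_add.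
Qed.

Let G_le x y : 0 < x -> x <= y -> G x <= G y.
Proof.
move=> x0 xy; apply: le_trans (G_ge_add x0 xy).
by rewrite lerDl mulr_ge0 ?subr_ge0// gr0// (lt_le_trans x0).
Qed.

Let G_avg x y : 0 < x -> x <= y -> G y / y <= G x / x.
Proof.
move=> x0 xy; have y0 := lt_le_trans x0 xy.
by have := average_nincr g0 gn x0 xy; rewrite !GE// -!EFinM lee_fin.
Qed.

Let cG x : 0 < x -> {for x, continuous G}.
Proof.
move=> x0; have x20 : 0 < x / 2 by rewrite divr_gt0.
apply/cvgrPdist_lt => e e0.
(* G is Lipschitz on [x/2, oo) with constant g(x/2); the added 1 keeps e / M meaningful when that
   value is 0. *)
pose M := gr (x / 2) + 1.
have M0 : 0 < M by rewrite ltr_wpDl// gr0.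
near=> y.
have xy2 : x / 2 < y by near: y; apply: lt_nbhsr; lra.
have d : `|x - y| < e / M by near: y; apply: cvgr_dist_lt => //; rewrite divr_gt0.
have y0 : 0 < y := lt_trans x20 xy2.
have key (u v : R) : x / 2 <= u -> u <= v -> `|G u - G v| <= M * (v - u).
  move=> xu uv; have u0 := lt_le_trans x20 xu.
  rewrite ler0_norm ?subr_le0 ?G_le// opprB lerBlDl (le_trans (G_le_add u0 uv))//.
  rewrite lerD2l mulrC ler_wpM2r ?subr_ge0// (le_trans (grn x20 xu))//.
  by rewrite lerDl.
have [xy|yx] := leP x y.
  rewrite (le_lt_trans (key _ _ _ xy))//; first by lra.
  by rewrite mulrC -ltr_pdivlMr// -(ger0_norm (_ : 0 <= y - x)) ?subr_ge0// distrC.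
rewrite distrC (le_lt_trans (key _ _ (ltW xy2) (ltW yx)))//.
by rewrite mulrC -ltr_pdivlMr// -(ger0_norm (_ : 0 <= x - y)) ?subr_ge0// ltW.
Unshelve. all: by end_near. Qed.

Section Steklov.
Variable h : R.
Hypothesis h0 : 0 < h.

(** The mean of g over (y, y + h). A forward window keeps it below g, so averaging does not raise
    the energy. *)
Definition steklov (y : R) : R := (G (y + h) - G y) / h.
Notation f := steklov.

Lemma steklov_ge0 x : 0 < x -> 0 <= f x.
Proof. by move=> x0; rewrite divr_ge0 ?(ltW h0)// subr_ge0 G_le// lerDl ltW. Qed.

Let f_le x : 0 < x -> f x <= gr x.
Proof.
move=> x0; rewrite ler_pdivrMr// lerBlDl.
have xh : x <= x + h by rewrite lerDl ltW.
by rewrite (le_trans (G_le_add x0 xh))// lerD2l (addrC x) addrK mulrC.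
Qed.

Let f_nincr x y : 0 < x -> x <= y -> f y <= f x.
Proof.
move=> x0 xy; have y0 := lt_le_trans x0 xy.
have xh0 : 0 < x + h by rewrite addr_gt0.
rewrite ler_pM2r ?invr_gt0//.
(* When the windows overlap, their common part cancels and the increments of G over (x, y) and (x +
   h, y + h) are compared. When they are disjoint, values of g separate them. *)
have [yxh|xhy] := leP y (x + h).
  have a1 : G (y + h) <= G (x + h) + (y - x) * gr (x + h).
    by have := @G_le_add (x + h) (y + h) xh0; rewrite lerD2r opprD addrACA subrr addr0; exact.
  have a2 := G_ge_add x0 xy.
  have a3 : (y - x) * gr (x + h) <= (y - x) * gr y.
    by rewrite ler_wpM2l ?subr_ge0// grn.
  lra.
have yh : y <= y + h by rewrite lerDl ltW.
have xh : x <= x + h by rewrite lerDl ltW.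
have a1 := G_le_add y0 yh.
have a2 := G_ge_add x0 xh.
have a3 : h * gr y <= h * gr (x + h) by rewrite ler_wpM2l ?(ltW h0)// grn// ltW.
have e u : u + h - u = h by ring.
move: a1 a2; rewrite !e; lra.
Qed.

(** Subadditivity G(x + h) <= G(x) + G(h), obtained by splitting G(x + h) in the proportion x : h
    and using that averages decrease. *)
Lemma steklov_bound x : 0 < x -> f x <= G h / h.
Proof.
move=> x0; have xh0 : 0 < x + h by rewrite addr_gt0.
rewrite ler_pM2r ?invr_gt0// lerBlDr.
have a1 : G (x + h) / (x + h) * x <= G x.
  by rewrite -ler_pdivlMr// G_avg// lerDl ltW.
have a2 : G (x + h) / (x + h) * h <= G h.
  by rewrite -ler_pdivlMr// G_avg// lerDr ltW.
have -> : G (x + h) = G (x + h) / (x + h) * x + G (x + h) / (x + h) * h.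
  by rewrite -mulrDr divfK// gt_eqF.
lra.
Qed.

Lemma continuous_steklov x : 0 < x -> {for x, continuous f}.
Proof.
move=> x0; apply: continuousM; last exact: cst_continuous.
apply: continuousB; last exact: cG.
apply: (@continuous_comp _ _ _ (fun y => y + h) G).
  by apply: continuousD; [exact: cvg_id|exact: cst_continuous].
by apply: cG; rewrite addr_gt0.
Qed.

Let P := real_primitive G.

Let fG x : 0 < x -> (primitive (EFin \o G) x%:E < +oo)%E.
Proof.
move=> x0; apply: (@le_lt_trans _ _ (G x * x)%:E); last exact: ltry.
apply: primitive_bounded => //; first exact: measurable_continuous_pos.
by move=> y /andP[y0 yx]; rewrite G0 G_le// ltW.
Qed.

Let Pd x : 0 < x -> is_derive x 1 P (G x).
Proof. by apply: is_derive_real_primitive => // y _; exact: G0. Qed.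

Let ff x : 0 < x -> (primitive (EFin \o f) x%:E < +oo)%E.
Proof.
move=> x0; apply: (@le_lt_trans _ _ (G h / h * x)%:E); last exact: ltry.
apply: primitive_bounded => //; first by apply: measurable_continuous_pos; exact: continuous_steklov.
by move=> y /andP[y0 yx]; rewrite steklov_ge0// steklov_bound.
Qed.

Let Q y := (P (y + h) - P y) / h.

Let G_le_Q y : 0 < y -> G y <= Q y.
Proof.
move=> y0; rewrite ler_pdivlMr// -subr_ge0.
have yh : y <= y + h by rewrite lerDl ltW.
have dd z : y <= z <= y + h -> is_derive z 1 (fun z => P z - G y * z) (G z - G y).
  move=> /andP[yz _]; have z0 := lt_le_trans y0 yz.
  have d1 := is_deriveZ (G y) (is_derive_id z (1 : R)).
  have := is_deriveB (Pd z0) d1.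
  by rewrite /GRing.scale/= mulr1.
have := is_derive_le yh dd => /(_ _)/=.
have hh z : y <= z <= y + h -> 0 <= G z - G y.
  by move=> /andP[yz _]; rewrite subr_ge0 G_le.
by move=> /(_ hh); lra.
Qed.

Let Q_le y : 0 < y -> Q y <= G (y + h).
Proof.
move=> y0; rewrite ler_pdivrMr// -subr_ge0.
have yh : y <= y + h by rewrite lerDl ltW.
have dd z : y <= z <= y + h -> is_derive z 1 (fun z => G (y + h) * z - P z) (G (y + h) - G z).
  move=> /andP[yz _]; have z0 := lt_le_trans y0 yz.
  have d1 := is_deriveZ (G (y + h)) (is_derive_id z (1 : R)).
  have := is_deriveB d1 (Pd z0).
  by rewrite /GRing.scale/= mulr1.
have hh z : y <= z <= y + h -> 0 <= G (y + h) - G z.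
  by move=> /andP[yz zh]; rewrite subr_ge0 G_le// (lt_le_trans y0).
have := is_derive_le yh dd hh => /=; lra.
Qed.

(** The primitive of the average and Q, the forward mean of G, have the same derivative, so their
    difference is constant. Near 0 it is at least -G(h) up to an arbitrarily small error, since Q(z)
    <= G(z + h); at y one has Q >= G. *)
Lemma steklov_primitive_ge y : 0 < y -> G y - G h <= real_primitive f y.
Proof.
move=> y0.
suff : 0 <= real_primitive f y - Q y + G h.
  have := G_le_Q y0; lra.
apply: (@ge0_of_is_derive _ (fun z => real_primitive f z - Q z + G h) (fun=> 0)) => //.
- move=> z /andP[z0 _].
  have zh0 : 0 < z + h by rewrite addr_gt0.
  have d1 := is_derive_real_primitive steklov_ge0 continuous_steklov ff z0.
  have ds : is_derive z 1 (fun y : R => y + h) 1.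
    have := is_deriveD (is_derive_id z (1 : R)) (is_derive_cst h z (1 : R)).
    by rewrite addr0.
  have d2 := @is_derive1_comp R P (fun y => y + h) z _ _ (Pd zh0) ds.
  have d3 := is_deriveZ h^-1 (is_deriveB d2 (Pd z0)).
  have d4 := is_deriveD (is_deriveB d1 d3) (is_derive_cst (G h) z (1 : R)).
  rewrite (_ : (fun _ => _) = real_primitive f - h^-1 \*: ((P \o +%R^~ h) - P) + cst (G h)).
    by apply: (is_derive_eq d4); rewrite /GRing.scale/= mulr1 addr0 /f; lra.
  by apply/funext => t; rewrite /Q !fctE; congr (_ - _ + _); exact: mulrC.
- move=> e e0; have /cvgrPdist_lt/(_ _ e0) H := cG h0.
  have [d d0 Hd] : exists2 d, 0 < d & forall z, `|h - z| < d -> `|G h - G z| < e.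
    by have [d /= d0 Hd] := H; exists d => // z hz; exact: Hd.
  pose z := Num.min y (d / 2).
  have z0 : 0 < z by rewrite lt_min y0 divr_gt0.
  exists z; first by rewrite z0 ge_min lexx.
  have zd : z < d by rewrite gt_min; apply/orP; right; lra.
  have : `|G h - G (z + h)| < e.
    apply: Hd; have -> : h - (z + h) = - z by ring.
    by rewrite normrN gtr0_norm.
  rewrite distrC ltr_norml => /andP[_ a1].
  have a2 := Q_le z0.
  have a3 : 0 <= real_primitive f z by exact: (real_primitive_ge0 steklov_ge0).
  lra.
Qed.

Lemma steklov_bliss x : 0 < x ->
  real_primitive (fun y => real_primitive f y `^ q * y `^ (- m)) x <= B * N `^ (1 + r).
Proof.
move=> x0; apply: (le_trans (smoothB steklov_ge0 f_nincr steklov_bound continuous_steklov x0)).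
rewrite ler_pM2l//; apply: powR_le; first by rewrite addr_ge0.
  by apply: real_primitive_ge0 => y _; exact: powR_ge0.
have cfp y : 0 < y -> {for y, continuous (fun z => f z `^ p)}.
  by move=> y0; apply: continuous_powR_comp => //; [exact: steklov_ge0|exact: continuous_steklov].
rewrite -lee_fin -gN -real_primitiveE//; last 2 first.
- by move=> y _; exact: powR_ge0.
- move=> y y0; apply: (@le_lt_trans _ _ ((G h / h) `^ p * y)%:E); last exact: ltry.
  apply: primitive_bounded => //; first exact: measurable_continuous_pos.
  move=> z /andP[z0 _]; rewrite powR_ge0/= powR_le ?(ltW p0) ?steklov_ge0 ?steklov_bound//.
rewrite /primitive.
apply: (@le_trans _ _ (\int[mu]_(y in below x%:E) g y `^ p)%E); last first.
  apply: ge0_subset_integral => //; first exact: measurable_below.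
  - by move=> y _; exact: poweR_ge0.
  - by move=> y [y0 _] /=; rewrite in_itv/= y0.
have sub : below x%:E `<=` (`]0%R, +oo[ : set R).
  by move=> y [y0 _] /=; rewrite in_itv/= y0.
apply: ge0_le_integral.
- exact: measurable_below.
- by move=> y _; rewrite lee_fin powR_ge0.
- apply/measurable_EFinP; apply: measurable_funS (measurable_continuous_pos cfp) => //.
- exact: measurable_funS mgp.
- move=> y [y0 _]; rewrite /= g_fin// poweR_EFin lee_fin.
  by apply: powR_le; [exact: ltW|exact: steklov_ge0|exact: f_le].
Qed.

End Steklov.

Let phi x := (primitive g x%:E `^ q * (x `^ (- m))%:E)%E.
Let psi x := G x `^ q * x `^ (- m).

Let psi0 x : 0 <= psi x. Proof. by rewrite mulr_ge0 ?powR_ge0. Qed.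

Let cpsi x : 0 < x -> {for x, continuous psi}.
Proof.
move=> x0; apply: continuousM; last exact: is_derive_continuous (is_derive_powR (- m) x0).
by apply: continuous_powR_comp => //; exact: cG.
Qed.

Let mpsi : measurable_fun (`]0%R, +oo[ : set R) (EFin \o psi).
Proof. by apply/measurable_EFinP; exact: measurable_continuous_pos. Qed.

Let mpsico (d Y : R) : 0 < d -> measurable_fun `[d, Y[ (EFin \o psi).
Proof.
move=> d0; apply: measurable_funS mpsi => // t /=.
by rewrite !in_itv/= andbT => /andP[dt _]; exact: lt_le_trans dt.
Qed.

(** On [d, oo) the additive loss G(h) becomes multiplicative: with eta = c^(1/q) and h so small that
    G(h) < (1 - eta) G(d), the averaged primitive is at least eta G there. This costs the factor
    eta^q = c, which may be taken arbitrarily close to 1. *)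
Let psi_itv (d Y c : R) : 0 < d -> 0 < c < 1 ->
  (c%:E * \int[mu]_(x in `[d, Y[) (psi x)%:E <= (B * N `^ (1 + r))%:E)%E.
Proof.
move=> d0 /andP[c0 c1].
have RHS0 : 0 <= B * N `^ (1 + r) by rewrite mulr_ge0 ?powR_ge0// ltW.
have [Yd|dY] := leP Y d.
  rewrite set_itv_ge ?integral_set0 ?mule0 ?lee_fin//.
  by rewrite -leNgt bnd_simp.
have Y0 := lt_trans d0 dY.
have [Gd0|Gdn0] := eqVneq (G d) 0.
  rewrite integral0_eq ?mule0 ?lee_fin// => x /=; rewrite in_itv/= => /andP[dx _].
  rewrite /psi (_ : G x = 0) ?powR0 ?mul0r ?gt_eqF//.
  have x0 := lt_le_trans d0 dx.
  have := G_avg d0 dx; rewrite Gd0 mul0r ler_pdivrMr// mul0r => h.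
  by apply/eqP; rewrite eq_le h G0.
have Gd : 0 < G d by rewrite lt_neqAle eq_sym Gdn0 G0.
pose eta := c `^ q^-1.
have eta1 : eta < 1.
  have := @gt0_ltr_powR R q^-1; rewrite invr_gt0 => /(_ q0 c 1).
  by rewrite !nnegrE ltW// ler01 => /(_ isT isT c1); rewrite powR1.
have etaq : eta `^ q = c by rewrite /eta -powRrM mulVf ?gt_eqF// powRr1// ltW.
have e0 : 0 < (1 - eta) * G d by rewrite mulr_gt0// subr_gt0.
have [d1 d10 Hd1] := measurable_real_primitive_small gr0 mgr fgr e0.
pose h := d1 / 2.
have h0 : 0 < h by rewrite divr_gt0.
have Gh : G h < (1 - eta) * G d by apply: Hd1; rewrite h0/= /h; lra.
have F_ge x : d <= x -> eta * G x <= real_primitive (steklov h) x.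
  move=> dx; have x0 := lt_le_trans d0 dx.
  apply: le_trans (steklov_primitive_ge h0 x0).
  have : (1 - eta) * G d <= (1 - eta) * G x by rewrite ler_pM2l ?subr_gt0// G_le.
  lra.
pose chi y := real_primitive (steklov h) y `^ q * y `^ (- m).
have chi0 y : 0 <= chi y by rewrite mulr_ge0 ?powR_ge0.
have mchi : measurable_fun (`]0%R, +oo[ : set R) (EFin \o chi).
  apply/measurable_EFinP; apply: measurable_continuous_pos => y y0.
  exact: (continuous_smoothJ p1 r0 (steklov_ge0 h0) (steklov_bound h0) (continuous_steklov h0) y0).
have chiY : (primitive (EFin \o chi) Y%:E < +oo)%E.
  exact: (smoothJ_lty p1 r0 (steklov_ge0 h0) (steklov_bound h0) (continuous_steklov h0) Y0).
apply: (@le_trans _ _ (primitive (EFin \o chi) Y%:E)); last first.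
  rewrite -(@fineK _ (primitive _ _)); first by rewrite lee_fin; exact: steklov_bliss.
  rewrite ge0_fin_numE//; apply: integral_ge0 => y _; rewrite lee_fin; exact: chi0.
rewrite -ge0_integralZl//; last 3 first.
- exact: mpsico.
- by move=> x _; rewrite lee_fin.
- by rewrite lee_fin ltW.
apply: (@le_trans _ _ (\int[mu]_(x in `[d, Y[) (chi x)%:E)%E).
  apply: ge0_le_integral => //.
  - by move=> x _; rewrite -EFinM lee_fin mulr_ge0// ltW.
  - by apply: emeasurable_funM => //; exact: mpsico.
  - apply: measurable_funS mchi => // t /=.
    by rewrite !in_itv/= andbT => /andP[dt _]; exact: lt_le_trans dt.
  - move=> x /=; rewrite in_itv/= => /andP[dx _]; rewrite -EFinM lee_fin.
    have x0 := lt_le_trans d0 dx.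
    rewrite /psi /chi mulrA ler_pM2r ?powR_gt0// -etaq -powRM ?powR_ge0//.
    by apply: powR_le; [exact: ltW|rewrite mulr_ge0 ?powR_ge0|exact: F_ge].
apply: ge0_subset_integral => //.
- exact: measurable_below.
- by apply: measurable_funS mchi => // t [t0 _] /=; rewrite in_itv/= t0.
- by move=> x _; rewrite lee_fin.
- move=> x /=; rewrite in_itv/= => /andP[dx xY]; split; first exact: lt_le_trans dx.
  by rewrite lte_fin.
Qed.

Lemma bliss_nincr_fin :
  (\int[mu]_(x in `]0%R, +oo[) phi x <= (B * N `^ (1 + r))%:E)%E.
Proof.
have -> : (\int[mu]_(x in `]0%R, +oo[) phi x = \int[mu]_(x in `]0%R, +oo[) (psi x)%:E)%E.
  apply: eq_integral => x; rewrite inE/= in_itv/= andbT => x0.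
  by rewrite /phi GE// poweR_EFin.
have U : `]0%R, +oo[%classic = \bigcup_n `[n.+1%:R^-1, n.+1%:R[%classic :> set R.
  apply/seteqP; split => x /=; rewrite in_itv/= andbT.
    move=> x0; exists (maxn (Num.truncn x) (Num.truncn x^-1)) => //=.
    rewrite in_itv/=; apply/andP; split.
      rewrite invf_ple ?posrE ?ltr0n// (le_trans (ltW (truncnS_gt _)))// ler_nat ltnS.
      exact: leq_maxr.
    by rewrite (lt_le_trans (truncnS_gt _))// ler_nat ltnS leq_maxl.
  move=> [n _ /=]; rewrite in_itv/= => /andP[nx _]; rewrite (lt_le_trans _ nx)//.
have inv0 n : 0 < n.+1%:R^-1 :> R by rewrite invr_gt0.
have nd : nondecreasing_seq (fun n => `[n.+1%:R^-1, n.+1%:R[%classic : set R).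
  move=> i j ij; apply/subsetPset => x /=; rewrite !in_itv/= => /andP[ix xi].
  apply/andP; split; last by rewrite (lt_le_trans xi)// ler_nat.
  by rewrite (le_trans _ ix)// lef_pV2 ?posrE// ler_nat.
have := @ge0_nondecreasing_set_cvg_integral _ (measurableTypeR R) R
  (fun n => `[n.+1%:R^-1, n.+1%:R[%classic) (EFin \o psi) mu nd.
move=> /(_ (fun n => measurable_itv _) (fun n => mpsico (inv0 n)))/=.
move=> /(_ _)/cvg_lim H; rewrite U -H//; last by move=> n x _; rewrite lee_fin psi0.
apply: lime_le.
  apply: ereal_nondecreasing_is_cvgn => i j ij; apply: ge0_subset_integral => //.
  - exact: mpsico.
  - by move=> x _; rewrite lee_fin psi0.
  - by have := nd _ _ ij; move/subsetPset.
apply: nearW => n; apply/lee_mul01Pr.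
  by apply: integral_ge0 => x _; rewrite lee_fin psi0.
by move=> c c01; exact: psi_itv.
Qed.

End Fixed.

Lemma bliss_nincr (g : R -> \bar R) :
  (forall s, 0 < s -> (0 <= g s)%E) ->
  (forall s t, 0 < s -> s <= t -> (g t <= g s)%E) ->
  (\int[mu]_(x in `]0%R, +oo[) (primitive g x%:E `^ q * (x `^ (- m))%:E) <=
   B%:E * (\int[mu]_(x in `]0%R, +oo[) g x `^ p) `^ (1 + r))%E.
Proof.
move=> g0 gn.
have : (0 <= \int[mu]_(x in `]0%R, +oo[) g x `^ p)%E.
  by apply: integral_ge0 => x _; exact: poweR_ge0.
case E : (\int[mu]_(x in `]0%R, +oo[) g x `^ p)%E => [N| |]// _.
  by rewrite poweR_EFin -EFinM; exact: bliss_nincr_fin.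
rewrite poweRyr; last by rewrite gt_eqF// ltr_wpDr.
by rewrite gt0_muley ?lte_fin// leey.
Qed.

End NonincreasingBliss.

(** * Gamma and Beta integrals *)

Section PrimitiveOfDerive.
Context {R : realType}.
Notation mu := (@lebesgue_measure R).
Implicit Types (x y z e : R).

Section Antiderivative.
Variables (f F : R -> R).
Hypotheses (f0 : forall x, 0 < x -> 0 <= f x)
  (cf : forall x, 0 < x -> {for x, continuous f})
  (Fd : forall x, 0 < x -> is_derive x 1 F (f x))
  (Fs : forall e, 0 < e -> exists2 d, 0 < d & forall y, 0 < y < d -> `|F y| < e).

Let mf : measurable_fun (`]0%R, +oo[ : set R) (EFin \o f).
Proof. by apply/measurable_EFinP; exact: measurable_continuous_pos. Qed.

Let mfco y z : 0 < y -> measurable_fun `[y, z[ (EFin \o f).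
Proof.
move=> y0; apply: measurable_funS mf => // t /=.
by rewrite !in_itv/= andbT => /andP[yt _]; exact: lt_le_trans yt.
Qed.

Lemma integral_antiderivative y x : 0 < y -> y < x ->
  (\int[mu]_(t in `[y, x[) (f t)%:E = (F x - F y)%:E)%E.
Proof.
move=> y0 yx; rewrite integral_itv_bndo_bndc; last exact: mfco.
rewrite (@continuous_FTC2 _ f F)//.
- apply/continuous_within_itvP => //; split.
  + by move=> z; rewrite in_itv/= => /andP[yz _]; apply: cf; exact: lt_trans yz.
  + exact/cvg_at_right_filter/cf.
  + exact/cvg_at_left_filter/cf/(lt_trans y0 yx).
- split.
  + by move=> z; rewrite in_itv/= => /andP[yz _]; have [] := Fd (lt_trans y0 yz).
  + exact/cvg_at_right_filter/is_derive_continuous/Fd.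
  + exact/cvg_at_left_filter/(is_derive_continuous (Fd (lt_trans y0 yx))).
- move=> z; rewrite in_itv/= => /andP[yz _]; rewrite derive1E.
  by have [_] := Fd (lt_trans y0 yz).
Qed.

Let F_le y x : 0 < y -> y <= x -> F y <= F x.
Proof.
move=> y0 yx; apply: (is_derive_le yx) => z /andP[yz _]; [apply: Fd|apply: f0];
  exact: lt_le_trans yz.
Qed.

Let F_ge0 y : 0 < y -> 0 <= F y.
Proof.
move=> y0; rewrite leNgt; apply/negP => Fy.
have Fy' : 0 < - F y by rewrite oppr_gt0.
have [d d0 Hd] := Fs Fy'.
pose z := Num.min y (d / 2).
have z0 : 0 < z by rewrite lt_min y0 divr_gt0.
have zy : z <= y by rewrite ge_min lexx.
have zd : z < d by rewrite gt_min; apply/orP; right; lra.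
have := Hd z; rewrite z0 => /(_ zd); have := F_le z0 zy.
rewrite ltr_norml => + /andP[+ _]; lra.
Qed.

(** f may be unbounded near 0, so the fundamental theorem is applied on [y, x) with y tending to 0;
    smallness of F near 0 replaces continuity at the end point. *)
Lemma primitive_antiderivative x : 0 < x -> primitive (EFin \o f) x%:E = (F x)%:E.
Proof.
move=> x0; apply/eqP; rewrite eq_le; apply/andP; split.
  pose a n : R := Num.min (x / 2) n.+1%:R^-1.
  have a0 n : 0 < a n by rewrite lt_min divr_gt0//= invr_gt0.
  have ax n : a n < x by rewrite gt_min; apply/orP; left; lra.
  have nd : nondecreasing_seq (fun n => `[a n, x[%classic : set R).
    move=> i j ij; apply/subsetPset => t /=; rewrite !in_itv/= => /andP[it ->].
    rewrite andbT (le_trans _ it)// le_min ge_min lexx /= ge_min; apply/orP; right.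
    by rewrite lef_pV2 ?posrE// ler_nat.
  have U : below x%:E = \bigcup_n `[a n, x[%classic.
    rewrite below_itv; apply/seteqP; split => t /=; rewrite in_itv/=.
      move=> /andP[t0 tx]; exists (Num.truncn t^-1) => //=; rewrite in_itv/= tx andbT.
      rewrite ge_min; apply/orP; right.
      by rewrite invf_ple ?posrE// ltW// truncnS_gt.
    move=> [n _ /=]; rewrite in_itv/= => /andP[nt ->]; rewrite andbT.
    exact: lt_le_trans nt.
  have := @ge0_nondecreasing_set_cvg_integral _ (measurableTypeR R) R
    (fun n => `[a n, x[%classic) (EFin \o f) mu nd.
  move=> /(_ (fun n => measurable_itv _) (fun n => mfco (a0 n)))/=.
  have p0 n t : `[a n, x[%classic t -> (0 <= (f t)%:E)%E.
    by rewrite /= in_itv/= => /andP[nt _]; rewrite lee_fin f0// (lt_le_trans _ nt).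
  move=> /(_ p0)/cvg_lim H; rewrite /primitive U -H//.
  apply: lime_le.
    apply: ereal_nondecreasing_is_cvgn => i j ij; apply: ge0_subset_integral => //.
    - exact: mfco.
    - exact: p0.
    - by have := nd _ _ ij; move/subsetPset.
  apply: nearW => n; rewrite integral_antiderivative// lee_fin lerBlDr lerDl.
  exact: F_ge0.
apply/lee_addgt0Pr => e e0.
have [d d0 Hd] := Fs e0.
pose y := Num.min (x / 2) (d / 2).
have y0 : 0 < y by rewrite lt_min !divr_gt0.
have yx : y < x by rewrite gt_min; apply/orP; left; lra.
have yd : y < d by rewrite gt_min; apply/orP; right; lra.
have Fy : F y < e.
  by have := Hd y; rewrite y0 yd => /(_ isT); rewrite ltr_norml => /andP[].
apply: (@le_trans _ _ ((F x - F y)%:E + e%:E)%E).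
  by rewrite -EFinD lee_fin; lra.
rewrite leeD2r// -integral_antiderivative//; apply: ge0_subset_integral => //.
- exact: measurable_below.
- by apply: measurable_funS mf => // t [t0 _] /=; rewrite in_itv/= t0.
- by move=> t [t0 _]; rewrite lee_fin f0.
- by rewrite below_itv => t /=; rewrite !in_itv/= => /andP[yt ->]; rewrite (lt_le_trans y0).
Qed.

End Antiderivative.

Lemma powR_small (c e : R) : 0 < c -> 0 < e ->
  exists2 d, 0 < d & forall y, 0 < y < d -> y `^ c < e.
Proof.
move=> c0 e0; exists (e `^ c^-1); first exact: powR_gt0.
move=> y /andP[y0 ye].
rewrite [ltRHS](_ : _ = (e `^ c^-1) `^ c); last first.
  by rewrite -powRrM mulVf ?gt_eqF// powRr1// ltW.
by apply: gt0_ltr_powR; rewrite ?nnegrE ?powR_ge0// ltW.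
Qed.

Lemma is_derive_powR_div (c t : R) : c != 0 -> 0 < t ->
  is_derive t 1 (fun t => t `^ c / c) (t `^ (c - 1)).
Proof.
move=> c0 t0; have := is_deriveZ c^-1 (is_derive_powR c t0).
rewrite /GRing.scale/= mulrA mulVf// mul1r (_ : _ \*: _ = (fun t => t `^ c / c))//.
by apply/funext => z; rewrite /= mulrC.
Qed.

Lemma primitive_powR (c x : R) : 0 < c -> 0 < x ->
  primitive (fun t => (t `^ (c - 1))%:E) x%:E = (x `^ c / c)%:E.
Proof.
move=> c0 x0.
apply: (@primitive_antiderivative (fun t => t `^ (c - 1)) (fun t => t `^ c / c)) => //.
- by move=> t _; exact: powR_ge0.
- by move=> t t0; exact: is_derive_continuous (is_derive_powR _ t0).
- by move=> t t0; apply: is_derive_powR_div => //; rewrite gt_eqF.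
- move=> e e0; have [d d0 Hd] := powR_small c0 (mulr_gt0 e0 c0).
  exists d => // y /[dup] /andP[y0 _] /Hd h.
  by rewrite ger0_norm ?divr_ge0 ?powR_ge0 ?(ltW c0)// ltr_pdivrMr.
Qed.

Section PowerSubstitution.
Variables (phi : R -> \bar R).
Hypotheses (phi0 : forall x, 0 < x -> (0 <= phi x)%E)
  (nphi : forall x y, 0 < x -> x <= y -> (phi y <= phi x)%E).

(* The substitution u = lam t^k; both sides integrate the same initial
   segments, so monotonicity of phi suffices. *)
Lemma power_substitution (lam k c : R) : 0 < lam -> 0 < k -> 0 < c ->
  (\int[mu]_(t in `]0%R, +oo[) (phi (lam * t `^ k) * (t `^ (c - 1))%:E) =
   (lam `^ (- (c / k)) / k)%:E *
     \int[mu]_(t in `]0%R, +oo[) (phi t * (t `^ (c / k - 1))%:E))%E.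
Proof.
move=> lam0 k0 c0.
pose C := lam `^ (- (c / k)) / k.
have C0 : 0 < C by rewrite divr_gt0// powR_gt0.
have ck0 : 0 < c / k by rewrite divr_gt0.
have mp (s : R) : measurable_fun (`]0%R, +oo[ : set R) (fun t => (t `^ s)%:E).
  apply/measurable_EFinP; apply: measurable_continuous_pos => t t0.
  exact: is_derive_continuous (is_derive_powR _ t0).
have ma : measurable_fun (`]0%R, +oo[ : set R) (fun t => lam * t `^ k).
  by apply: measurable_funM => //; apply/measurable_EFinP; exact: mp.
have a0 x : (`]0%R, +oo[%classic : set R) x -> 0 < lam * x `^ k.
  by rewrite /= in_itv/= andbT => x0; rewrite mulr_gt0 ?powR_gt0.
have pos x : (`]0%R, +oo[%classic : set R) x -> 0 < x.
  by rewrite /= in_itv/= andbT.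
have cmp t : 0 < t ->
    (\int[mu]_(x in `]0%R, +oo[ `&` [set x | (lam * x `^ k <= t)%R]) (x `^ (c - 1))%:E =
     C%:E * \int[mu]_(x in `]0%R, +oo[ `&` [set x | (x <= t)%R]) (x `^ (c / k - 1))%:E)%E.
  move=> t0.
  have cl (s u : R) : 0 < s -> 0 < u ->
      (\int[mu]_(x in `]0%R, u]) (x `^ (s - 1))%:E = (u `^ s / s)%:E)%E.
    move=> s0 u0; rewrite -primitive_powR// /primitive below_itv.
    rewrite -integral_itv_bndo_bndc//.
    by apply: measurable_funS (mp (s - 1)) => // z; rewrite /= !in_itv/= => /andP[->].
  pose u := (t / lam) `^ k^-1.
  have u0 : 0 < u by rewrite powR_gt0// divr_gt0.
  have uk : u `^ k = t / lam.
    by rewrite /u -powRrM mulVf ?gt_eqF// powRr1// ltW// divr_gt0.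
  rewrite (_ : _ `&` _ = `]0, u]%classic); last first.
    apply/seteqP; split => x /=; rewrite !in_itv/= andbT.
      move=> [x0 xt]; rewrite x0 /= leNgt; apply/negP => ux.
      have : u `^ k < x `^ k by apply: gt0_ltr_powR; rewrite ?nnegrE ?ltW.
      by rewrite uk ltr_pdivrMr// mulrC ltNge xt.
    move=> /andP[x0 xu]; split => //; rewrite mulrC -ler_pdivlMr// -uk.
    by apply: powR_le => //; exact: ltW.
  rewrite (_ : _ `&` [set x | x <= t] = `]0, t]%classic); last first.
    apply/seteqP; split => x /=; rewrite !in_itv/= andbT; first by move=> [-> ->].
    by move=> /andP[-> ->].
  rewrite !cl// -EFinM; congr EFin.
  rewrite /C /u -powRrM (powR_expR _ (divr_gt0 t0 lam0)) ln_div ?posrE//.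
  rewrite (powR_expR _ lam0) (powR_expR _ t0).
  have -> : k^-1 * c * (ln t - ln lam) = c / k * ln t + - (c / k) * ln lam by ring.
  by rewrite expRD; field; rewrite !gt_eqF.
have h0 (s x : R) : (`]0%R, +oo[%classic : set R) x -> (0 <= (x `^ s)%:E)%E.
  by move=> _; rewrite lee_fin powR_ge0.
apply/eqP; rewrite eq_le; apply/andP; split.
  apply: (@comparison _ _ _ _ _ mu mu _ _ (fun t => lam * t `^ k) (fun t => t)) => //.
  - exact: mp.
  - exact: mp.
  - exact: h0.
  - exact: h0.
  - exact: ltW.
  - by move=> t t0; rewrite cmp.
rewrite -lee_pdivlMl//.
apply: (@comparison _ _ _ _ _ mu mu _ _ (fun t => t) (fun t => lam * t `^ k)) => //.
- exact: mp.
- exact: mp.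
- exact: h0.
- exact: h0.
- by rewrite invr_ge0 ltW.
- by move=> t t0; rewrite cmp// muleA -EFinM mulVf ?gt_eqF// mul1e.
Qed.

End PowerSubstitution.
End PrimitiveOfDerive.

Section GammaBeta.
Context {R : realType}.
Notation mu := (@lebesgue_measure R).
Implicit Types (a s t u x : R).

Let pos x : (`]0%R, +oo[%classic : set R) x -> 0 < x.
Proof. by rewrite /= in_itv/= andbT. Qed.

Lemma EFin_mul_div (g c : R) (X : \bar R) : 0 < g -> (g%:E * X)%E = c%:E -> X = (c / g)%:E.
Proof.
move=> g0; case: X => [x| |].
- by rewrite -EFinM => -[<-]; rewrite mulrC mulKf// gt_eqF.
- by rewrite gt0_muley ?lte_fin.
- by rewrite gt0_muleNy ?lte_fin.
Qed.

Lemma powR_mulB1 x s : 0 < x -> x * x `^ (s - 1) = x `^ s.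
Proof.
move=> x0; rewrite powRB; last by apply/implyP => _; rewrite gt_eqF.
by rewrite powRr1 ?(ltW x0)// mulrCA divff ?mulr1// gt_eqF.
Qed.

Lemma is_derive_expRN t : is_derive t 1 (fun x => expR (- x)) (- expR (- t)).
Proof.
have d1 := is_deriveN (is_derive_id t (1 : R)).
have d2 := @is_derive1_comp R expR (fun x => - x) t _ _ (is_derive_expR (- t)) d1.
by apply: (is_derive_eq d2); rewrite mulrN1.
Qed.

Lemma measurable_expRN D : measurable_fun D (fun t : R => (expR (- t))%:E).
Proof.
apply/measurable_EFinP; apply: measurable_funTS.
by apply: (measurableT_comp (@measurable_expR R)); exact: oppr_measurable.
Qed.

Lemma measurable_EFin_powR D a : measurable_fun D (fun t : R => (t `^ a)%:E).
Proof. by apply/measurable_EFinP; apply: measurable_funTS; exact: measurable_powR. Qed.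

Lemma integral_expRN a : (\int[mu]_(x in `]a, +oo[) (expR (- x))%:E = (expR (- a))%:E)%E.
Proof.
rewrite integral_itv_obnd_cbnd; last exact: measurable_expRN.
rewrite (@ge0_continuous_FTC2y _ _ (fun x => - expR (- x)) _ 0)//.
- by rewrite EFinN oppeK add0e.
- apply: derivable_within_continuous => x _; by have [] := is_derive_expRN x.
- by rewrite -oppr0; apply: cvgN; exact: cvgr_expR.
- apply: cvgN; apply: cvg_at_right_filter.
  exact: is_derive_continuous (is_derive_expRN a).
- by move=> x _; rewrite derive1E; have [_ ->] := is_deriveN (is_derive_expRN x); rewrite opprK.
Qed.

(** Extended-valued until finiteness is known, and written as a decreasing factor times a power, the
    shape that [power_substitution] transforms. *)
Definition gamma_integral s : \bar R :=
  (\int[mu]_(t in `]0%R, +oo[) ((expR (- t))%:E * (t `^ (s - 1))%:E))%E.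

Let expRN_nincr x y : 0 < x -> x <= y -> ((expR (- y))%:E <= (expR (- x))%:E :> \bar R)%E.
Proof. by move=> _ xy; rewrite lee_fin ler_expR lerN2. Qed.

Lemma gamma_integral_scale s u : 0 < s -> 0 < u ->
  (\int[mu]_(t in `]0%R, +oo[) ((expR (- (u * t)))%:E * (t `^ (s - 1))%:E) =
   (u `^ (- s))%:E * gamma_integral s)%E.
Proof.
move=> s0 u0.
have := @power_substitution R (fun t => (expR (- t))%:E) _ expRN_nincr u 1 s u0 ltr01 s0.
rewrite !divr1 => <-; last by move=> x _; rewrite lee_fin expR_ge0.
by apply: eq_integral => t /set_mem/pos t0; rewrite powRr1// ltW.
Qed.

(** In place of integration by parts: the layer cake of t^s against e^-t dt gives the integral of
    exp(-u^(1/s)) du, and the substitution by the power 1/s turns this into s times the integral of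
    e^-t t^(s - 1). *)
Lemma gamma_integralD1 s : 0 < s -> (gamma_integral (s + 1) = s%:E * gamma_integral s)%E.
Proof.
move=> s0; have k0 : 0 < s^-1 by rewrite invr_gt0.
have := @power_substitution R (fun t => (expR (- t))%:E) _ expRN_nincr 1 s^-1 1 ltr01 k0 ltr01.
rewrite powR1 !div1r invrK => <-; last by move=> x _; rewrite lee_fin expR_ge0.
rewrite /gamma_integral addrK.
under eq_integral do rewrite muleC.
rewrite (@layer_cake _ (measurableTypeR R) R mu)//.
- apply: eq_integral => t /set_mem/pos t0.
  rewrite subrr powRr0 mule1 mul1r -integral_expRN; congr (integral _ _ _).
  have c0 : 0 < t `^ s^-1 by rewrite powR_gt0.
  apply/seteqP; split => x /=; rewrite !in_itv/= !andbT lte_fin.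
    move=> [x0 tx]; rewrite ltNge; apply/negP => xt.
    have := powR_le (ltW s0) (ltW x0) xt.
    by rewrite -powRrM mulVf ?gt_eqF// powRr1 ?(ltW t0)// leNgt tx.
  move=> tx; have x0 := lt_trans c0 tx; split => //.
  rewrite ltNge; apply/negP => xt.
  have := powR_le (ltW k0) (powR_ge0 _ _) xt.
  by rewrite -powRrM divff ?gt_eqF// powRr1 ?(ltW x0)// leNgt tx.
- exact: measurable_EFin_powR.
- exact: measurable_expRN.
- by move=> x _; rewrite lee_fin powR_ge0.
Qed.

Let gpos s t : 0 < t -> 0 < expR (- t) * t `^ (s - 1).
Proof. by move=> t0; rewrite mulr_gt0 ?expR_gt0 ?powR_gt0. Qed.

Let gcont s t : 0 < t -> {for t, continuous (fun t => expR (- t) * t `^ (s - 1))}.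
Proof.
move=> t0; apply: continuousM; first exact: is_derive_continuous (is_derive_expRN t).
exact: is_derive_continuous (is_derive_powR _ t0).
Qed.

Let gamma_primitive s :
  gamma_integral s = primitive (EFin \o (fun t => expR (- t) * t `^ (s - 1))) +oo.
Proof. by rewrite /primitive belowy. Qed.

(* Comparison with t^(s-1) (1+t)^(-s-1), whose primitive (t/(1+t))^s / s is
   bounded. *)
Lemma gamma_integral_lty s : 0 < s -> (gamma_integral s < +oo)%E.
Proof.
move=> s0; pose k := s + 1; have k0 : 0 < k by rewrite addr_gt0.
pose M := expR 1 * k `^ k.
have M0 : 0 < M by rewrite mulr_gt0 ?expR_gt0 ?powR_gt0.
pose h t := t `^ (s - 1) * (1 + t) `^ (- k).
pose H t := (t / (1 + t)) `^ s / s.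
have t1 t : 0 < t -> 0 < 1 + t by move=> t0; rewrite addr_gt0.
have d1 t : is_derive t 1 (fun t => 1 + t) 1.
  have := is_deriveD (is_derive_cst (1 : R) t (1 : R)) (is_derive_id t (1 : R)).
  by rewrite add0r.
have dk t : 0 < t -> is_derive t 1 (fun t => (1 + t) `^ (- k)) (- k * (1 + t) `^ (- k - 1) * 1).
  by move=> t0; apply: (@is_derive_powR_comp R (fun t => 1 + t)) => //; exact: t1.
have ch t : 0 < t -> {for t, continuous h}.
  move=> t0; apply: continuousM.
    exact: is_derive_continuous (is_derive_powR _ t0).
  exact: is_derive_continuous (dk _ t0).
have H1 t : 0 < t -> H t = t `^ s * (1 + t) `^ (- s) / s.
  by move=> t0; rewrite /H powRM ?invr_ge0 ?(ltW t0) ?(ltW (t1 _ t0))// powRN -powR_inv1 ?(ltW (t1 _ t0))// -powRrM mulN1r powRN.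
have dH t : 0 < t -> is_derive t 1 H (h t).
  move=> t0.
  have a1 := is_derive_powR s t0.
  have a2 : is_derive t 1 (fun t => (1 + t) `^ (- s)) (- s * (1 + t) `^ (- s - 1) * 1).
    by apply: (@is_derive_powR_comp R (fun t => 1 + t)) => //; exact: t1.
  have a3 := is_deriveZ s^-1 (is_deriveM a1 a2).
  have a4 : is_derive t 1 (s^-1 \*: ((@powR R)^~ s * (fun t => (1 + t) `^ (- s)))) (h t).
    apply: (is_derive_eq a3); rewrite /GRing.scale/= mulr1 /h /k.
    have e1 := powR_mulB1 s t0.
    have e2 := powR_mulB1 (- s) (t1 _ t0).
    rewrite opprD -e1 -e2; field; by rewrite gt_eqF.
  apply: (near_eq_is_derive _ a4).
  near=> z; have z0 : 0 < z by near: z; exact: lt_nbhsr.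
  by rewrite H1// [RHS]mulrC.
have Hle t : 0 < t -> 0 <= H t <= s^-1.
  move=> t0; have q1 : 0 <= t / (1 + t) <= 1.
    by rewrite divr_ge0 ?(ltW t0) ?(ltW (t1 _ t0))//= ler_pdivrMr ?t1// mul1r lerDr.
  have /andP[q2 q3] := q1.
  rewrite /H divr_ge0 ?powR_ge0 ?(ltW s0)//= -[leRHS]mul1r ler_pM2r ?invr_gt0//.
  by have := powR_le (ltW s0) q2 q3; rewrite powR1.
have Hs e : 0 < e -> exists2 d, 0 < d & forall y, 0 < y < d -> `|H y| < e.
  move=> e0; have [d d0 Hd] := powR_small s0 (mulr_gt0 e0 s0).
  exists d => // y /[dup] /andP[y0 _] /Hd h1.
  have /andP[Hy _] := Hle _ y0; rewrite ger0_norm// /H ltr_pdivrMr//.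
  apply: le_lt_trans h1; apply: powR_le; first exact: ltW.
    by rewrite divr_ge0 ?ltW ?t1.
  by rewrite ler_pdivrMr ?t1// mulrDr mulr1 lerDl mulr_ge0 ?ltW.
have bnd t : 0 < t -> expR (- t) * t `^ (s - 1) <= M * h t.
  move=> t0; rewrite /h mulrCA mulrC ler_pM2l ?powR_gt0//.
  have u0 := t1 _ t0.
  rewrite (powR_expR _ u0) /M (powR_expR _ k0) -!expRD ler_expR.
  have uk : 0 < (1 + t) / k by rewrite divr_gt0.
  (* The bound 1 + ln u <= u at u = (1 + t)/k gives e^-t (1 + t)^k <= e^(1 - k) k^k, which is at
     most M. *)
  have := expR_ge1Dx (ln ((1 + t) / k)).
  rewrite lnK ?posrE// ler_pdivlMr// ln_div ?posrE// => e.
  have e' : (1 + (ln (1 + t) - ln k)) * k <= 1 + t by [].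
  have : 0 <= k by exact: ltW.
  lra.
have h0 t : 0 < t -> 0 <= h t by move=> t0; rewrite mulr_ge0 ?powR_ge0.
rewrite gamma_primitive; apply: (@le_lt_trans _ _ (M / s)%:E); last exact: ltry.
rewrite leNgt; apply/negP => /primitivey_gt[||x x0].
- by apply/measurable_EFinP; apply: measurable_continuous_pos => t; exact: gcont.
- by move=> t t0; rewrite lee_fin ltW// gpos.
apply/negP; rewrite -leNgt.
apply: (@le_trans _ _ (M%:E * primitive (EFin \o h) x%:E)%E); last first.
  rewrite (@primitive_antiderivative R h H)// -EFinM lee_fin ler_pM2l//.
  by have /andP[] := Hle _ x0.
have sub : below x%:E `<=` (`]0%R, +oo[ : set R).
  by move=> y [y0 _] /=; rewrite in_itv/= y0.
have mh : measurable_fun (below x%:E) (EFin \o h).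
  apply/measurable_EFinP; apply: measurable_funS (measurable_continuous_pos ch) => //.
rewrite /primitive -ge0_integralZl//; last 3 first.
- exact: measurable_below.
- by move=> t [t0 _]; rewrite lee_fin h0.
- by rewrite lee_fin ltW.
apply: ge0_le_integral => //.
- exact: measurable_below.
- by move=> t [t0 _]; rewrite lee_fin ltW// gpos.
- apply/measurable_EFinP; apply: (@measurable_funS _ _ _ _ (`]0%R, +oo[ : set R)) => //.
  by apply: measurable_continuous_pos => t; exact: gcont.
- exact: emeasurable_funM.
- by move=> t [t0 _]; rewrite /= -EFinM lee_fin bnd.
Unshelve. all: by end_near. Qed.

Lemma gamma_integral_gt0 s : 0 < s -> (0 < gamma_integral s)%E.
Proof.
move=> s0; rewrite gamma_primitive; set f := fun t => _.
have f0 t : 0 < t -> 0 <= f t by move=> t0; rewrite ltW// gpos.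
have mf : measurable_fun (`]0%R, +oo[ : set R) (EFin \o f).
  by apply/measurable_EFinP; apply: measurable_continuous_pos => t; exact: gcont.
have le x : (primitive (EFin \o f) x%:E <= primitive (EFin \o f) +oo)%E.
  apply: ge0_subset_integral.
  - exact: measurable_below.
  - exact: measurable_below.
  - by rewrite belowy.
  - by move=> y [y0 _]; rewrite lee_fin f0.
  - by move=> y [y0 _]; split => //; exact: ltry.
have lty x : 0 < x -> (primitive (EFin \o f) x%:E < +oo)%E.
  move=> _; apply: (le_lt_trans (le x)).
  by rewrite -gamma_primitive gamma_integral_lty.
apply: (lt_le_trans _ (le 1)); rewrite (real_primitiveE f0 lty ltr01).
rewrite lte_fin; apply: real_primitive_gt0 => //; first exact: gcont.
by move=> z z0; exact: gpos.
Qed.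

Lemma gamma_integralE s : 0 < s -> gamma_integral s = (Gamma s)%:E.
Proof.
move=> s0; rewrite /Gamma.
have E : lintegral halfline (fun t => (t `^ (s - 1) * expR (- t))%:E) = gamma_integral s.
  rewrite lintegralE.
  - by apply: eq_integral => t _; rewrite -EFinM mulrC.
  - exact: measurable_halfline.
  - have -> : (fun t : R => (t `^ (s - 1) * expR (- t))%:E) =
        (fun t => (t `^ (s - 1))%:E * (expR (- t))%:E)%E by [].
    by apply: emeasurable_funM; [exact: measurable_EFin_powR|exact: measurable_expRN].
  - by move=> x _; rewrite lee_fin mulr_ge0 ?powR_ge0 ?expR_ge0.
by rewrite E fineK// ge0_fin_numE ?gamma_integral_lty// ltW// gamma_integral_gt0.
Qed.

Lemma Gamma_gt0 s : 0 < s -> 0 < Gamma s.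
Proof. by move=> s0; rewrite -lte_fin -gamma_integralE// gamma_integral_gt0. Qed.

Lemma GammaD1 s : 0 < s -> Gamma (s + 1) = s * Gamma s.
Proof.
move=> s0; have := gamma_integralD1 s0.
rewrite (gamma_integralE s0) (gamma_integralE (addr_gt0 s0 ltr01)) -EFinM.
exact: EFin_inj.
Qed.

(** The Beta function B(a, s - a) in its half-line form, again a decreasing factor times a power. *)
Definition beta_integral a s : \bar R :=
  (\int[mu]_(t in `]0%R, +oo[) (((1 + t) `^ (- s))%:E * (t `^ (a - 1))%:E))%E.

Lemma tonelli_halfline (f : measurableTypeR R * measurableTypeR R -> R) :
  measurable_fun setT f ->
  (forall x y, 0 < x -> 0 < y -> 0 <= f (x, y)) ->
  (\int[mu]_(x in `]0%R, +oo[) \int[mu]_(y in `]0%R, +oo[) (f (x, y))%:E =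
   \int[mu]_(y in `]0%R, +oo[) \int[mu]_(x in `]0%R, +oo[) (f (x, y))%:E)%E.
Proof.
move=> mf f0; pose D : set R := `]0, +oo[%classic.
pose F (z : measurableTypeR R * measurableTypeR R) : \bar R :=
  (f z * (\1_D z.1 * \1_D z.2))%:E.
have D1 x : \1_D x = (0 < x)%R%:R :> R.
  by rewrite indicE; congr (_ : bool)%:R; apply/idP/idP => [/set_mem/pos//|x0];
    apply/mem_set; rewrite /D/= in_itv/= x0.
have F0 z : (0 <= F z)%E.
  rewrite /F lee_fin !D1; case: z => x y /=.
  case: ltP => x0; case: ltP => y0; rewrite ?mulr0 ?mul0r ?mulr0// !mulr1.
  exact: f0.
have mF : measurable_fun setT F.
  apply/measurable_EFinP; apply: measurable_funM => //; apply: measurable_funM.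
    by apply: (measurableT_comp _ measurable_fst); apply: measurable_indic; exact: measurable_itv.
  by apply: (measurableT_comp _ measurable_snd); apply: measurable_indic; exact: measurable_itv.
have := @fubini_tonelli _ _ _ _ R mu mu F mF F0; rewrite /fubini_F /fubini_G => E.
transitivity (\int[mu]_x \int[mu]_y F (x, y))%E.
  rewrite [LHS]integral_mkcond; apply: eq_integral => x _; rewrite patchE.
  case: ifPn => [/set_mem/pos x0|/negP x0].
    rewrite [LHS]integral_mkcond; apply: eq_integral => y _; rewrite patchE /F/= !D1 x0 mul1r.
    case: ifPn => [/set_mem/pos ->|/negP y0]; first by rewrite mulr1.
    case: ltP => [y1|_]; last by rewrite mulr0.
    by exfalso; apply: y0; apply/mem_set; rewrite /= in_itv/= y1.
  rewrite integral0_eq; first by [].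
  move=> y _.
  rewrite /F/= !D1.
  case: ltP => [x1|_]; last by rewrite mul0r mulr0.
  by exfalso; apply: x0; apply/mem_set; rewrite /= in_itv/= x1.
rewrite E [RHS]integral_mkcond; apply: eq_integral => y _; rewrite patchE.
case: ifPn => [/set_mem/pos y0|/negP y0].
  rewrite [RHS]integral_mkcond; apply: eq_integral => x _; rewrite patchE /F/= !D1 y0 mulr1.
  case: ifPn => [/set_mem/pos ->|/negP x0]; first by rewrite mulr1.
  case: ltP => [x1|_]; last by rewrite mulr0.
  by exfalso; apply: x0; apply/mem_set; rewrite /= in_itv/= x1.
rewrite integral0_eq; first by [].
move=> x _.
rewrite /F/= !D1.
case: (ltP 0 y) => [y1|_]; last by rewrite !mulr0.
by exfalso; apply: y0; apply/mem_set; rewrite /= in_itv/= y1.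
Qed.

(* Gamma(s) (1+t)^(-s) is the Laplace-type integral of u^(s-1) exp(-(1+t)u);
   exchange the two integrations. *)
Lemma beta_gamma_integral a s (ga gs gsa : R) : 0 < a -> a < s ->
  0 < ga -> 0 < gs -> 0 < gsa ->
  gamma_integral a = ga%:E -> gamma_integral s = gs%:E ->
  gamma_integral (s - a) = gsa%:E -> beta_integral a s = (ga * gsa / gs)%:E.
Proof.
move=> a0 as_ ga0 gs0 gsa0 gaE gsE gsaE.
have s0 := lt_trans a0 as_; have sa0 : 0 < s - a by rewrite subr_gt0.
pose f (z : measurableTypeR R * measurableTypeR R) : R :=
  expR (- ((1 + z.1) * z.2)) * z.2 `^ (s - 1) * z.1 `^ (a - 1).
have mf : measurable_fun setT f.
  apply: measurable_funM; [apply: measurable_funM|].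
  - apply: (measurableT_comp (@measurable_expR R)).
    apply: measurableT_comp => //; apply: measurable_funM; last exact: measurable_snd.
    by apply: measurable_funD => //; exact: measurable_fst.
  - exact: (measurableT_comp (measurable_powR _) measurable_snd).
  - exact: (measurableT_comp (measurable_powR _) measurable_fst).
have T := tonelli_halfline mf.
suff : (gs%:E * beta_integral a s = (ga * gsa)%:E)%E.
  by move=> E; exact: (EFin_mul_div gs0 E).
have mga (c : R) : measurable_fun (`]0%R, +oo[ : set R)
    (fun t => (expR (- t))%:E * (t `^ c)%:E)%E.
  by apply: emeasurable_funM; [exact: measurable_expRN|exact: measurable_EFin_powR].
rewrite /beta_integral -ge0_integralZl; last 4 first.
- exact: measurable_itv.
- apply: emeasurable_funM; last exact: measurable_EFin_powR.
  apply/measurable_EFinP; apply: measurable_funTS; apply: (measurableT_comp (measurable_powR _)).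
  exact: measurable_funD.
- by move=> x _; rewrite mule_ge0 ?lee_fin ?powR_ge0.
- by rewrite lee_fin ltW.
transitivity (\int[mu]_(x in `]0%R, +oo[) \int[mu]_(y in `]0%R, +oo[) (f (x, y))%:E)%E.
  apply: eq_integral => x /set_mem/pos x0.
  have x1 : 0 < 1 + x by rewrite addr_gt0.
  rewrite muleA (muleC _ ((1 + x) `^ (- s))%:E) -gsE -(gamma_integral_scale s0 x1).
  rewrite -ge0_integralZr; last 4 first.
  - exact: measurable_itv.
  - apply: emeasurable_funM; last exact: measurable_EFin_powR.
    apply/measurable_EFinP; apply: measurable_funTS; apply: (measurableT_comp (@measurable_expR R)).
    by apply: measurableT_comp => //; exact: measurable_funM.
  - by move=> t _; rewrite mule_ge0 ?lee_fin ?powR_ge0 ?expR_ge0.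
  - by rewrite lee_fin powR_ge0.
  by apply: eq_integral => t _; rewrite -!EFinM.
rewrite T; last by move=> x y x0 y0; rewrite !mulr_ge0 ?powR_ge0 ?expR_ge0.
rewrite EFinM -gsaE -ge0_integralZl; last 4 first.
- exact: measurable_itv.
- exact: mga.
- by move=> x _; rewrite mule_ge0 ?lee_fin ?powR_ge0 ?expR_ge0.
- by rewrite lee_fin ltW.
apply: eq_integral => y /set_mem/pos y0.
transitivity ((expR (- y) * y `^ (s - 1))%:E *
    \int[mu]_(x in `]0%R, +oo[) ((expR (- (y * x)))%:E * (x `^ (a - 1))%:E))%E.
  rewrite -ge0_integralZl; last 4 first.
  - exact: measurable_itv.
  - apply: emeasurable_funM; last exact: measurable_EFin_powR.
    apply/measurable_EFinP; apply: measurable_funTS; apply: (measurableT_comp (@measurable_expR R)).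
    by apply: measurableT_comp => //; exact: measurable_funM.
  - by move=> t _; rewrite mule_ge0 ?lee_fin ?powR_ge0 ?expR_ge0.
  - by rewrite lee_fin mulr_ge0 ?expR_ge0 ?powR_ge0.
  apply: eq_integral => x _; rewrite -!EFinM; congr EFin.
  by rewrite /f/= mulrDl mul1r opprD expRD (mulrC x y); ring.
rewrite (gamma_integral_scale a0 y0) gaE -!EFinM; congr EFin.
have -> : y `^ (s - a - 1) = y `^ (s - 1) * y `^ (- a).
  by rewrite !(powR_expR _ y0) -expRD; congr expR; ring.
by ring.
Qed.

Lemma beta_integralE a s : 0 < a -> a < s ->
  beta_integral a s = (Gamma a * Gamma (s - a) / Gamma s)%:E.
Proof.
move=> a0 as_; have s0 := lt_trans a0 as_; have sa0 : 0 < s - a by rewrite subr_gt0.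
exact: (beta_gamma_integral a0 as_ (Gamma_gt0 a0) (Gamma_gt0 s0) (Gamma_gt0 sa0)
  (gamma_integralE a0) (gamma_integralE s0) (gamma_integralE sa0)).
Qed.

End GammaBeta.

(** * The sharp constant and near-extremals *)

Section BlissConstant.
Context {R : realType}.
Notation mu := (@lebesgue_measure R).
Variables (p r : R).
Hypotheses (p1 : 1 < p) (r0 : 0 < r).
Implicit Types (t : R).

Let q := p * (1 + r).
Let m := p + r * (p - 1).
Let s := q / r.

Let p0 : 0 < p. Proof. exact: lt_trans ltr01 p1. Qed.
Let q0 : 0 < q. Proof. by rewrite /q mulr_gt0// addr_gt0. Qed.
Let rn0 : r != 0. Proof. by rewrite gt_eqF. Qed.
Let pos (x : R) : (`]0%R, +oo[%classic : set R) x -> 0 < x.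
Proof. by rewrite /= in_itv/= andbT. Qed.

Let ln_split t : 0 < t -> ln (1 + t `^ r) = r * ln t + ln (1 + t `^ (- r)).
Proof.
move=> t0; have u0 : 0 < 1 + t `^ (- r) by rewrite addr_gt0// powR_gt0.
rewrite -ln_powR -lnM ?posrE ?powR_gt0//; congr ln.
rewrite mulrDr mulr1 addrC; congr (_ + _).
by rewrite !powR_expR// -expRD mulNr subrr expR0.
Qed.

Let v0 t : 0 < 1 + t `^ r. Proof. by rewrite ltr_wpDr ?powR_ge0. Qed.

Lemma extremal_deriv_powR t : 0 < t -> extremal_deriv r t `^ p = (1 + t `^ r) `^ (- s).
Proof.
move=> t0; have F0 := extremal_gt0 r t0.
have u0 : 0 < 1 + t `^ (- r) by rewrite addr_gt0// powR_gt0.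
rewrite /extremal_deriv -powRrM (powR_expR _ (v0 t)) ln_split//.
rewrite powR_expR ?divr_gt0// ln_div ?posrE// /extremal ln_powR.
by congr expR; rewrite /s /q; field.
Qed.

Lemma extremal_powR t : 0 < t ->
  extremal r t `^ q * t `^ (- m) = (1 + t `^ r) `^ (- s) * t `^ r.
Proof.
move=> t0; have F0 := extremal_gt0 r t0.
rewrite (powR_expR _ (v0 t)) ln_split// (powR_expR _ F0) /extremal ln_powR.
set L := ln (1 + _); rewrite !(powR_expR _ t0) -!expRD.
by congr expR; rewrite /s /q /m; field.
Qed.

Let phi t : \bar R := ((1 + t) `^ (- s))%:E.

Let s0 : 0 < s. Proof. by rewrite divr_gt0. Qed.

Let phi0 t : 0 < t -> (0 <= phi t)%E.
Proof. by move=> _; rewrite lee_fin powR_ge0. Qed.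

Let phin x y : 0 < x -> x <= y -> (phi y <= phi x)%E.
Proof.
move=> x0 xy; have x1 : 0 < 1 + x by rewrite addr_gt0.
have y1 : 0 < 1 + y by rewrite (lt_le_trans x1)// lerD2l.
rewrite lee_fin !powRN lef_pV2 ?posrE ?powR_gt0//.
by apply: powR_le; [exact: ltW|exact: ltW|rewrite lerD2l].
Qed.

Let beta_subst (c : R) : 0 < c -> c / r < s ->
  (\int[mu]_(t in `]0%R, +oo[) ((1 + t `^ r) `^ (- s) * t `^ (c - 1))%:E =
   (r^-1 * (Gamma (c / r) * Gamma (s - c / r) / Gamma s))%:E)%E.
Proof.
move=> c0 cs; have cr0 : 0 < c / r by rewrite divr_gt0.
have := power_substitution phi0 phin ltr01 r0 c0.
rewrite powR1 div1r => E; rewrite EFinM -(beta_integralE cr0 cs) /beta_integral.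
rewrite -/(phi _) -E.
by apply: eq_integral => t _; rewrite /phi mul1r EFinM.
Qed.

(** The integral of the p-th power of Bliss's function. As s/p = 1/r + 1 and s/q' = s - 1/r, it is
    Gamma(s/p) Gamma(s/q') / Gamma(s), the reciprocal of the quotient inside [Kconst]. *)
Definition bliss_energy : R := Gamma (r^-1 + 1) * Gamma (s - r^-1) / Gamma s.

Let rs : r^-1 < s.
Proof.
rewrite /s ltr_pdivlMr// mulVf// /q.
have : 0 < p * r by rewrite mulr_gt0.
by have := p1; lra.
Qed.

Let rV0 : 0 < r^-1. Proof. by rewrite invr_gt0. Qed.

Let m1E : (m - 1) = r * (s - (1 + r) / r).
Proof. by rewrite /m /s /q; field. Qed.

Let m10 : 0 < m - 1.
Proof.
have : 0 < r * (p - 1) by rewrite mulr_gt0// subr_gt0.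
by have := p1; rewrite /m; lra.
Qed.

Lemma bliss_energy_gt0 : 0 < bliss_energy.
Proof.
rewrite /bliss_energy divr_gt0 ?Gamma_gt0//; apply: mulr_gt0; apply: Gamma_gt0.
  exact: addr_gt0.
by rewrite subr_gt0.
Qed.

Lemma integral_extremal_deriv :
  primitive (fun t => (extremal_deriv r t `^ p)%:E) +oo = bliss_energy%:E.
Proof.
have c1 : 1 / r < s by rewrite div1r.
have := beta_subst ltr01 c1; rewrite div1r => E.
rewrite /primitive belowy.
transitivity (r^-1 * (Gamma r^-1 * Gamma (s - r^-1) / Gamma s))%:E.
  rewrite -E; apply: eq_integral => t /set_mem/pos t0; congr EFin.
  by rewrite extremal_deriv_powR// subrr powRr0 mulr1.
congr EFin; rewrite /bliss_energy (GammaD1 rV0).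
by rewrite !mulrA.
Qed.

(** This Beta integral differs from the energy by one step of the Gamma recurrence in each numerator
    factor. The steps together contribute 1/(m - 1), since m - 1 = r (s - (1 + r)/r). *)
Lemma integral_extremal :
  primitive (fun t => (extremal r t `^ q * t `^ (- m))%:E) +oo =
  (bliss_energy / (m - 1))%:E.
Proof.
have c0 : 0 < 1 + r by rewrite addr_gt0.
have d0 : 0 < s - (1 + r) / r by have := m10; rewrite m1E pmulr_rgt0.
have c1 : (1 + r) / r < s by rewrite -subr_gt0.
have := beta_subst c0 c1 => E.
rewrite /primitive belowy.
transitivity (r^-1 * (Gamma ((1 + r) / r) * Gamma (s - (1 + r) / r) / Gamma s))%:E.
  rewrite -E; apply: eq_integral => t /set_mem/pos t0; congr EFin.
  by rewrite extremal_powR// addrAC subrr add0r.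
congr EFin; rewrite /bliss_energy m1E.
have -> : s - r^-1 = s - (1 + r) / r + 1 by field.
have -> : r^-1 + 1 = (1 + r) / r by field.
rewrite (GammaD1 d0).
move: (Gamma ((1 + r) / r)) (Gamma (s - (1 + r) / r)) (Gamma s)^-1 => g1 g2 g3.
set d := s - (1 + r) / r in d0 *.
by field; rewrite rn0 gt_eqF.
Qed.

Lemma Kconst_lt : Kconst p q = bliss_energy `^ (- s^-1).
Proof.
rewrite /Kconst ifF; last first.
  by apply/negbTE; rewrite lt_eqF// /q -[ltLHS]mulr1 ltr_pM2l// ltrDl.
have r1n0 : 1 + r != 0 by rewrite gt_eqF// addr_gt0.
have pn0 : p != 0 by rewrite gt_eqF.
have -> : (p^-1 - q^-1)^-1 = s.
  by rewrite /s /q; field; rewrite rn0 pn0 r1n0.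
have -> : s / p = r^-1 + 1 by rewrite /s /q; field; rewrite rn0 pn0.
have -> : s / conjexp q = s - r^-1.
  by rewrite /conjexp invrK /s; field; rewrite rn0 gt_eqF.
have e0 := bliss_energy_gt0.
rewrite -[Gamma s / _]invf_div -/bliss_energy.
move: bliss_energy e0 => e e0.
by rewrite !powR_expR ?invr_gt0// lnV ?posrE//; congr expR; ring.
Qed.

(** The quotient on the right is the total of J over the power 1 + r of the total energy, both for
    the extremal. The factor m - 1 = q/p' comes from the weight (m - 1) y^r with which parameters
    are compared. *)
Lemma Kconst_powR_lt : Kconst p q `^ q = (m - 1) * (bliss_energy / (m - 1) / bliss_energy `^ (1 + r)).
Proof.
have e0 := bliss_energy_gt0.
rewrite Kconst_lt -powRrM.
have -> : (m - 1) * (bliss_energy / (m - 1) / bliss_energy `^ (1 + r)) =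
    bliss_energy / bliss_energy `^ (1 + r) by field; rewrite !gt_eqF// powR_gt0.
rewrite -powRN !(powR_expR _ e0) -[X in _ = X * _](lnK e0) -expRD; congr expR.
by rewrite /s; field; rewrite rn0 gt_eqF.
Qed.

End BlissConstant.

Lemma powR_invl (R : realType) (s x : R) : 0 < x -> x^-1 `^ s = (x `^ s)^-1.
Proof. by move=> x0; rewrite !powR_expR ?invr_gt0// lnV ?posrE// mulrN expRN. Qed.

(** * Near-extremal test functions *)

Section BlissSharpness.
Context {R : realType}.
Notation mu := (@lebesgue_measure R).
Implicit Types (t x y v : R).

Lemma exhaust_halfline (h : R -> R) v :
  (forall x, 0 < x -> 0 <= h x) -> (forall x, 0 < x -> {for x, continuous h}) ->
  (forall x, 0 < x -> (primitive (EFin \o h) x%:E < +oo)%E) ->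
  (v%:E < primitive (EFin \o h) +oo)%E ->
  exists a b : R, 0 < a /\ (v%:E <= \int[mu]_(x in `[a, b[) (h x)%:E)%E.
Proof.
move=> h0 ch fh vh.
have mh : measurable_fun (`]0%R, +oo[ : set R) h by exact: measurable_continuous_pos.
have [b b0 Hb] : exists2 t : R, 0 < t & (v%:E < primitive (EFin \o h) t%:E)%E.
  apply: primitivey_gt => //; first exact/measurable_EFinP.
rewrite (real_primitiveE h0 fh b0) lte_fin in Hb.
have e0 : 0 < real_primitive h b - v by rewrite subr_gt0.
have small := real_primitive_small h0 ch fh.
have [d d0 Hd] := small _ e0.
pose a := Num.min (b / 2) (d / 2).
have a0 : 0 < a by rewrite lt_min !divr_gt0.
have ab : a < b by rewrite gt_min; apply/orP; left; lra.
have ad : a < d by rewrite gt_min; apply/orP; right; lra.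
exists a, b; split => //.
have hd x : 0 < x -> is_derive x 1 (real_primitive h) (h x).
  by move=> x0; exact: is_derive_real_primitive.
rewrite (integral_antiderivative ch hd a0 ab).
by rewrite lee_fin; have := Hd a; rewrite a0 => /(_ ad); lra.
Qed.

Variables (p r : R).
Hypotheses (p1 : 1 < p).
Let q := p * (1 + r).
Let m := p + r * (p - 1).
Let p0 : 0 < p. Proof. exact: lt_trans ltr01 p1. Qed.
Let pos (x : R) : (`]0%R, +oo[%classic : set R) x -> 0 < x.
Proof. by rewrite /= in_itv/= andbT. Qed.

Lemma Kconst_powR_eq : r = 0 -> Kconst p q `^ q = (m - 1) * conjexp p `^ p.
Proof.
move=> rE; have qE : q = p by rewrite /q rE addr0 mulr1.
have mE : m = p by rewrite /m rE mul0r addr0.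
rewrite qE mE /Kconst eqxx.
have p10 : 0 < p - 1 by rewrite subr_gt0.
have p'E : conjexp p = p / (p - 1).
  by rewrite /conjexp; field; rewrite !gt_eqF//.
have p'0 : 0 < conjexp p by rewrite p'E divr_gt0.
have pE : p = (p - 1) * conjexp p by rewrite p'E; field; rewrite gt_eqF.
have eE : (conjexp p)^-1 * p = p - 1 by rewrite p'E; field; rewrite !gt_eqF.
rewrite powRM ?powR_ge0// -!powRrM mulVf ?gt_eqF// powRr1 ?ltW// eE.
rewrite {1}pE -mulrA; congr (_ * _).
exact: powR_mulB1.
Qed.

Lemma bliss_constant : 0 <= r ->
  exists B, [/\ 0 < B, bliss_for_smooth p r B & (m - 1) * B = Kconst p q `^ q].
Proof.
rewrite le_eqVlt => /predU1P[r0|r0].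
  have p'0 : 0 < conjexp p by rewrite /conjexp invr_gt0 subr_gt0 invf_lt1.
  exists (conjexp p `^ p); split; first exact: powR_gt0.
  - move=> f C f0 fn fC cf x x0.
    have r00 : 0 <= r by rewrite r0.
    have := hardy_smooth p1 r00 f0 fn fC cf (esym r0) x0.
    rewrite powRN mulrC ler_pdivrMr ?powR_gt0// => h.
    have E0 : 0 <= real_primitive (fun y => f y `^ p) x.
      by apply: real_primitive_ge0 => y _; exact: powR_ge0.
    apply: (le_trans h); rewrite mulrC.
    by rewrite -r0 addr0 powRr1.
  - by rewrite Kconst_powR_eq.
have e0 := bliss_energy_gt0 p1 r0.
have m10 : 0 < m - 1.
  have : 0 < r * (p - 1) by rewrite mulr_gt0// subr_gt0.
  by have := p1; rewrite /m; lra.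
set e := bliss_energy p r in e0 *.
have j0 : 0 < e / (m - 1) by rewrite divr_gt0.
exists (e / (m - 1) / e `^ (1 + r)); split.
- by rewrite divr_gt0// powR_gt0.
- move=> f C f0 fn fC cf x x0.
  have := bliss_smooth p1 (ltW r0) f0 fn fC cf r0 j0 e0 (integral_extremal p1 r0)
    (integral_extremal_deriv p1 r0) x0.
  have E0 : 0 <= real_primitive (fun y => f y `^ p) x.
    by apply: real_primitive_ge0 => y _; exact: powR_ge0.
  rewrite ler_pdivrMr// => h; apply: (le_trans h).
  rewrite powRM ?invr_ge0 ?(ltW e0)//.
  rewrite (powR_invl _ e0).
  rewrite le_eqVlt; apply/orP; left; apply/eqP; ring.
- by rewrite Kconst_powR_lt.
Qed.

(** The quotient k is already reached on an interval [a, b) with a > 0. Such an interval can be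
    dilated into any neighbourhood of 0 or of infinity, which the whole half-line cannot. *)
Definition bliss_test (f : R -> \bar R) (k : R) : Prop :=
  [/\ forall s, 0 < s -> (0 <= f s)%E,
      forall s t, 0 < s -> s <= t -> (f t <= f s)%E &
      exists N a b : R, [/\ 0 < N, 0 < a,
        (\int[mu]_(x in `]0%R, +oo[) f x `^ p = N%:E)%E &
        ((k * N `^ (1 + r))%:E <=
          \int[mu]_(x in `[a, b[) (average_power f q x * ((m - 1) * x `^ r)%:E))%E]].

(** For r > 0 Bliss's function attains the constant on (0, oo); the gap between k and K^q pays for
    the restriction to [a, b). *)
Lemma bliss_test_lt k : 0 < r -> 0 < k < Kconst p q `^ q -> exists f, bliss_test f k.
Proof.
move=> r0 /andP[k0]; rewrite Kconst_powR_lt//.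
have m10 : 0 < m - 1.
  have : 0 < r * (p - 1) by rewrite mulr_gt0// subr_gt0.
  by have := p1; rewrite /m; lra.
have E1 := integral_extremal_deriv p1 r0; have E2 := integral_extremal p1 r0.
have e0 := bliss_energy_gt0 p1 r0; move: e0 E1 E2; set e := bliss_energy p r => e0 E1 E2.
rewrite mulrA ltr_pdivlMr ?powR_gt0// => ke.
have w0 t : 0 < 1 + t `^ r by rewrite ltr_wpDr ?powR_ge0.
have dE t : 0 < t -> extremal_deriv r t = (1 + t `^ r) `^ (- (p * (1 + r) / r / p)).
  move=> t0; rewrite -mulNr powRrM -(extremal_deriv_powR p r0 t0) -powRrM.
  by rewrite divff ?gt_eqF// powRr1// ltW// extremal_deriv_gt0.
have c0 : 0 <= p * (1 + r) / r / p by rewrite !divr_ge0 ?mulr_ge0 ?addr_ge0 ?ltW.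
have fn s t : 0 < s -> s <= t -> extremal_deriv r t <= extremal_deriv r s.
  move=> s0 st; have t0 := lt_le_trans s0 st; rewrite (dE _ s0) (dE _ t0).
  move: (_ / p) c0 => c c0; rewrite !powRN lef_pV2.
  - by apply: powR_le => //; [exact: ltW|rewrite lerD2l powR_le// ltW].
  - by rewrite posrE powR_gt0.
  - by rewrite posrE powR_gt0.
have cd t : 0 < t -> {for t, continuous (extremal_deriv r)}.
  move=> t0; apply: continuous_powR_comp => //; first by rewrite addr_gt0.
    by move=> y y0; apply: divr_ge0; apply: ltW => //; exact: extremal_gt0.
  apply: continuousM; first exact: is_derive_continuous (is_derive_extremal r0 t0).
  by apply: continuousV => //; rewrite gt_eqF.
have Fx x : 0 < x -> primitive (EFin \o extremal_deriv r) x%:E = (extremal r x)%:E.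
  apply: primitive_antiderivative => //.
  - by move=> t t0; rewrite ltW// extremal_deriv_gt0.
  - by move=> t t0; exact: is_derive_extremal.
  - move=> d d0; exists d => // y /andP[y0 yd]; rewrite ger0_norm ?ltW ?extremal_gt0//.
    exact: le_lt_trans (extremal_le r0 y0) yd.
pose h t := (m - 1) * (extremal r t `^ q * t `^ (- m)).
have h0 t : 0 < t -> 0 <= h t by move=> _; rewrite !mulr_ge0 ?powR_ge0// ltW.
have ch t : 0 < t -> {for t, continuous h}.
  move=> t0; apply: continuousM; first exact: cst_continuous.
  apply: continuousM; last exact: is_derive_continuous (is_derive_powR (- m) t0).
  exact: (is_derive_continuous (@is_derive_powR_comp R (extremal r) q t _ (extremal_gt0 r t0)
    (is_derive_extremal r0 t0))).
have mh : measurable_fun (`]0%R, +oo[ : set R) (EFin \o h).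
  by apply/measurable_EFinP; exact: measurable_continuous_pos.
have Eh : primitive (EFin \o h) +oo = e%:E.
  transitivity ((m - 1)%:E * primitive (fun t => (extremal r t `^ q * t `^ (- m))%:E) +oo)%E.
    rewrite /primitive -ge0_integralZl; last 4 first.
    - exact: measurable_below.
    - rewrite belowy; apply/measurable_EFinP; apply: measurable_continuous_pos => t t0.
      apply: continuousM; last exact: is_derive_continuous (is_derive_powR (- m) t0).
      exact: (is_derive_continuous (@is_derive_powR_comp R (extremal r) q t _
        (extremal_gt0 r t0) (is_derive_extremal r0 t0))).
    - by move=> x _; rewrite lee_fin mulr_ge0 ?powR_ge0.
    - by rewrite lee_fin ltW.
    by apply: eq_integral => x _; rewrite /h -EFinM.
  by rewrite E2 -EFinM mulrC divfK// gt_eqF.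
have fh x : 0 < x -> (primitive (EFin \o h) x%:E < +oo)%E.
  move=> x0; apply: (@le_lt_trans _ _ e%:E); last exact: ltry.
  rewrite -Eh; apply: ge0_subset_integral.
  - exact: measurable_below.
  - exact: measurable_below.
  - by rewrite belowy.
  - by move=> y [y0 _]; rewrite lee_fin h0.
  - by move=> y [y0 _]; split => //; exact: ltry.
exists (EFin \o extremal_deriv r); split.
- by move=> t t0; rewrite lee_fin ltW// extremal_deriv_gt0.
- by move=> s t s0 st; rewrite lee_fin fn.
have ke' : k * e `^ (1 + r) < e by move: ke; rewrite [ltRHS]mulrC divfK// gt_eqF.
have [|a [b [a0 H]]] := @exhaust_halfline h (k * e `^ (1 + r)) h0 ch fh.
  by rewrite Eh lte_fin.
exists e, a, b; split => //.
- rewrite -E1 /primitive belowy; apply: eq_integral => t _.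
  exact: poweR_EFin.
- apply: (le_trans H); rewrite le_eqVlt; apply/orP; left; apply/eqP.
  apply: eq_integral => x /set_mem/=; rewrite in_itv/= => /andP[ax _].
  have x0 := lt_le_trans a0 ax.
  rewrite /average_power Fx// -EFinM.
  congr EFin; rewrite /h [RHS]mulrCA; congr (_ * _).
  have F0 := extremal_gt0 r x0.
  rewrite powRM ?invr_ge0 ?(ltW x0) ?(ltW F0)// -mulrA; congr (_ * _).
  rewrite !powR_expR ?invr_gt0// lnV ?posrE// -expRD; congr expR.
  by rewrite /m /q; ring.
Qed.

(* The truncated powers t^(c-1) 1_(t<1) with c slightly above 1/p'. *)
Lemma bliss_test_eq k : r = 0 -> 0 < k < Kconst p q `^ q -> exists f, bliss_test f k.
Proof.
move=> r0 /andP[k0]; rewrite Kconst_powR_eq//.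
have qE : q = p by rewrite /q r0 addr0 mulr1.
have mE : m = p by rewrite /m r0 mul0r addr0.
have p10 : 0 < p - 1 by rewrite subr_gt0.
have p'E : conjexp p = p / (p - 1).
  by rewrite /conjexp; field; rewrite !gt_eqF//.
rewrite mE; set P := conjexp p.
have P1 : 1 < P by rewrite /P p'E ltr_pdivlMr// mul1r; lra.
have P0 : 0 < P := lt_trans ltr01 P1.
move=> kP.
(* Up to the cut at a, the function t^(c - 1) on (0, 1) has quotient (p - 1)/c^p; it equals k at c =
   [cs]. *)
pose cs := ((p - 1) / k) `^ p^-1.
have kp : 0 < (p - 1) / k by rewrite divr_gt0.
have cs0 : 0 < cs by rewrite powR_gt0.
have csp : cs `^ p = (p - 1) / k by rewrite /cs -powRrM mulVf ?gt_eqF// powRr1// ltW.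
have Pcs : P^-1 < cs.
  rewrite ltNge; apply/negP => csP.
  have := powR_le (ltW p0) (ltW cs0) csP; rewrite csp.
  rewrite (powR_invl _ P0).
  rewrite ler_pdivrMr// mulrC ler_pdivlMr ?powR_gt0// => h.
  by move: kP; rewrite ltNge h.
have PV1 : P^-1 < 1 by rewrite invf_lt1.
(* c > 1/p' makes f^p integrable with energy 1/d, c < 1 makes f non-increasing, and c < [cs] lifts
   the quotient above k. *)
pose c := (P^-1 + Num.min 1 cs) / 2.
have min1 : Num.min 1 cs <= 1 by rewrite ge_min lexx.
have min2 : Num.min 1 cs <= cs by rewrite ge_min lexx orbT.
have min3 : P^-1 < Num.min 1 cs by rewrite lt_min PV1.
have c1 : c < 1 by rewrite /c; lra.
have ccs : c < cs by rewrite /c; lra.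
have cP : P^-1 < c by rewrite /c; lra.
have c0 : 0 < c by apply: lt_trans cP; rewrite invr_gt0.
clearbody c; pose d := (c - 1) * p + 1.
have d0 : 0 < d.
  have -> : d = p * (c - P^-1) by rewrite /d /P p'E; field; rewrite !gt_eqF.
  by rewrite mulr_gt0// subr_gt0.
pose f t : \bar R := (if t < 1 then t `^ (c - 1) else 0)%:E.
have cp0 : 0 < c `^ p by rewrite powR_gt0.
(* The share of the quotient that may be lost: cutting off (0, a) loses the fraction a^d. *)
have e0 : 0 < 1 - k * c `^ p / (p - 1).
  rewrite subr_gt0 ltr_pdivrMr// mul1r mulrC -ltr_pdivlMr// -csp.
  by apply: gt0_ltr_powR; rewrite ?nnegrE ?(ltW c0) ?(ltW cs0).
have [a1 a10 Ha1] := powR_small d0 e0.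
pose a := Num.min (1 / 2) (a1 / 2).
have a0 : 0 < a by rewrite lt_min !divr_gt0.
have aa1 : a < a1 by rewrite gt_min; apply/orP; right; lra.
have a_1 : a < 1 by rewrite gt_min; apply/orP; left; lra.
have mpw (s : R) D : measurable_fun D (fun t : R => (t `^ s)%:E) by exact: measurable_EFin_powR.
exists f; split.
- by move=> s s0; rewrite lee_fin; case: ifP => // _; exact: powR_ge0.
- move=> s t s0 st; rewrite lee_fin; case: ifPn => [t1|_]; last by case: ifP => // _; exact: powR_ge0.
  rewrite (le_lt_trans st t1); have -> : c - 1 = - (1 - c) by ring.
  rewrite !powRN lef_pV2 ?posrE ?powR_gt0 ?(lt_le_trans s0 st)//.
  by apply: powR_le => //; [rewrite subr_ge0 ltW|exact: ltW].
exists d^-1, a, 1; split => //.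
- by rewrite invr_gt0.
- transitivity (primitive (fun t => (t `^ (d - 1))%:E) 1%:E).
    rewrite /primitive [LHS]integral_mkcond [RHS]integral_mkcond.
    apply: eq_integral => t _; rewrite !patchE.
    case: ifPn => [/set_mem/pos t0|/negP t0]; last first.
      rewrite ifF//; apply/negP => /set_mem[t1 _]; apply: t0; apply/mem_set.
      by rewrite /= in_itv/= t1.
    rewrite /f; case: ltP => t1.
      rewrite mem_set; last by split.
      by rewrite poweR_EFin -powRrM /d addrK.
    rewrite memNset; last by move=> [_]; rewrite lte_fin ltNge t1.
    by rewrite poweR0r// gt_eqF.
  by rewrite primitive_powR// powR1 div1r.
- have Fx x : 0 < x -> x < 1 -> primitive f x%:E = (x `^ c / c)%:E.
    move=> x0 x1; rewrite -primitive_powR//; apply: eq_integral => t /set_mem[t0].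
    by rewrite lte_fin => tx; rewrite /f (lt_trans tx x1).
  have E : (\int[mu]_(x in `[a, 1%R[) (average_power f q x * ((p - 1) * x `^ r)%:E) =
      ((p - 1) / c `^ p)%:E * \int[mu]_(x in `[a, 1%R[) (x `^ (d - 1))%:E)%E.
    rewrite -ge0_integralZl; last 4 first.
    - exact: measurable_itv.
    - exact: mpw.
    - by move=> x _; rewrite lee_fin powR_ge0.
    - by rewrite lee_fin divr_ge0 ?ltW.
    apply: eq_integral => x /set_mem/=; rewrite in_itv/= => /andP[ax x1].
    have x0 := lt_le_trans a0 ax.
    rewrite /average_power Fx// -!EFinM; congr EFin.
    rewrite qE r0 powRr0 mulr1 /d addrK !powRM ?divr_ge0 ?powR_ge0 ?invr_ge0 ?(ltW x0) ?(ltW c0)//.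
    rewrite (powR_invl _ c0).
    have -> : x `^ ((c - 1) * p) = x `^ c `^ p * x^-1 `^ p.
      by rewrite -powRrM !powR_expR ?invr_gt0// lnV ?posrE// -expRD; congr expR; ring.
    by ring.
  have cd t : 0 < t -> {for t, continuous (fun t => t `^ (d - 1))}.
    by move=> t0; exact: is_derive_continuous (is_derive_powR _ t0).
  have dd t : 0 < t -> is_derive t 1 (fun t => t `^ d / d) (t `^ (d - 1)).
    by move=> t0; apply: is_derive_powR_div => //; rewrite gt_eqF.
  rewrite mE E (integral_antiderivative cd dd a0 a_1).
  rewrite -EFinM lee_fin r0 addr0 powRr1 ?invr_ge0 ?(ltW d0)// powR1 div1r.
  rewrite -[X in _ <= _ * (X - _)]mul1r -mulrBl.
  have := Ha1 a; rewrite a0 => /(_ aa1) h.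
  rewrite mulrA ler_pM2r ?invr_gt0//.
  have -> : k = (p - 1) / c `^ p * (k * c `^ p / (p - 1)).
    by field; rewrite !gt_eqF.
  by rewrite ler_pM2l ?divr_gt0//; lra.
Qed.

Lemma exists_bliss_test k : 0 <= r -> 0 < k < Kconst p q `^ q -> exists f, bliss_test f k.
Proof.
rewrite le_eqVlt => /predU1P[r0|]; [apply: bliss_test_eq|exact: bliss_test_lt].
exact: esym.
Qed.

End BlissSharpness.

(** * Bounds for the operator norm *)

Section OperatorNorm.
Context {R : realType}.
Notation mu := (@lebesgue_measure R).
Implicit Types (b f g : R -> \bar R) (t x y : R).
Variables (p q : R).
Hypotheses (p1 : 1 < p) (pq : p <= q).

Let r := q / p - 1.
Let m := p + r * (p - 1).
Let p0 : 0 < p. Proof. exact: lt_trans ltr01 p1. Qed.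
Let q0 : 0 < q. Proof. exact: lt_le_trans pq. Qed.
Let pn0 : p != 0. Proof. by rewrite gt_eqF. Qed.
Let p1n0 : p - 1 != 0. Proof. by rewrite gt_eqF// subr_gt0. Qed.
Let r0 : 0 <= r. Proof. by rewrite subr_ge0 ler_pdivlMr// mul1r. Qed.
Let qE : p * (1 + r) = q. Proof. by rewrite /r; field. Qed.
Let r1E : 1 + r = q / p. Proof. by rewrite /r addrC subrK. Qed.
Let p'E : conjexp p = p / (p - 1). Proof. by rewrite /conjexp; field; rewrite pn0 p1n0. Qed.
Let p'0 : 0 < conjexp p. Proof. by rewrite p'E divr_gt0// subr_gt0. Qed.
Let kp0 : 0 < p / conjexp p. Proof. exact: divr_gt0. Qed.
Let m1E : m - 1 = q / p * (p / conjexp p).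
Proof. by rewrite /m /r p'E; field; rewrite pn0 p1n0. Qed.
Let m10 : 0 < m - 1. Proof. by rewrite m1E mulr_gt0// divr_gt0. Qed.
Let pos x : (`]0%R, +oo[%classic : set R) x -> 0 < x.
Proof. by rewrite /= in_itv/= andbT. Qed.

Lemma Kconst_ge0 : 0 <= Kconst p q.
Proof.
by rewrite /Kconst; case: ifP => _; [apply: mulr_ge0; exact: powR_ge0|exact: powR_ge0].
Qed.

Lemma Kconst_gt0 : 0 < Kconst p q.
Proof.
rewrite lt_neqAle Kconst_ge0 andbT eq_sym; apply/eqP => K0.
have [B [B0 _]] := bliss_constant p1 r0.
by rewrite qE K0 powR0 ?gt_eqF// => /eqP; rewrite gt_eqF// mulr_gt0.
Qed.

Lemma tail_integral_ge0 b t : (0 <= tail_integral q b t)%E.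
Proof. by apply: integral_ge0 => x _; exact: poweR_ge0. Qed.

Lemma c1_ge0 b t : (0 <= c1 p q b t)%E.
Proof. by rewrite mule_ge0 ?lee_fin ?powR_ge0 ?poweR_ge0. Qed.

Lemma c1_powR b t : 0 < t ->
  (c1 p q b t `^ q = (conjexp p / p * t `^ (- (q / p)))%:E * tail_integral q b t)%E.
Proof.
move=> t0; rewrite /c1; have := tail_integral_ge0 b t.
move: (tail_integral q b t) => X X0.
have k0 : 0 < conjexp p / p by rewrite divr_gt0.
have Y0 : (0 <= (conjexp p / p)%:E * X)%E by rewrite mule_ge0// lee_fin ltW.
rewrite poweRM ?lee_fin ?powR_ge0 ?poweR_ge0// poweRVK//.
transitivity ((t `^ (- p^-1) `^ q)%:E * ((conjexp p / p)%:E * X))%E; first by [].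
rewrite -powRrM muleA -EFinM mulrC; congr ((_ * _ `^ _)%:E * _)%E.
by rewrite mulNr mulrC.
Qed.

(** The factor (p/p') t^(q/p) is the mass of the weight (m - 1) y^r on (0, t]. Thus c1(t)^q is the
    ratio of the tail integral of b to this mass, and a bound on c1 is precisely a hypothesis for
    [comparison]. *)
Lemma tail_integral_c1 b t : 0 < t ->
  tail_integral q b t = ((p / conjexp p * t `^ (q / p))%:E * (c1 p q b t `^ q))%E.
Proof.
move=> t0; rewrite c1_powR// muleA -EFinM.
have tq : t `^ (- (q / p)) * t `^ (q / p) = 1.
  by rewrite !powR_expR// -expRD mulNr addNr expR0.
have -> : p / conjexp p * t `^ (q / p) * (conjexp p / p * t `^ (- (q / p))) = 1.
  rewrite -[RHS]tq; field; by rewrite pn0 gt_eqF.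
by rewrite mul1e.
Qed.

Let w0 t : 0 <= p / conjexp p * t `^ (q / p).
Proof. by apply: mulr_ge0; [exact: ltW|exact: powR_ge0]. Qed.

Lemma le_tail_integral b t (A : R) : 0 < t -> 0 <= A -> (A%:E <= c1 p q b t)%E ->
  ((A `^ q * (p / conjexp p * t `^ (q / p)))%:E <= tail_integral q b t)%E.
Proof.
move=> t0 A0 Ac; rewrite tail_integral_c1// [A `^ q * _]mulrC (EFinM _ (A `^ q)) -poweR_EFin.
rewrite lee_wpmul2l ?lee_fin ?w0//.
by apply: poweR_le; [exact: ltW| |].
Qed.

Lemma tail_integral_le b t (A : R) : 0 < t -> 0 <= A -> (c1 p q b t <= A%:E)%E ->
  (tail_integral q b t <= (A `^ q * (p / conjexp p * t `^ (q / p)))%:E)%E.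
Proof.
move=> t0 A0 Ac; rewrite tail_integral_c1// [A `^ q * _]mulrC (EFinM _ (A `^ q)) -poweR_EFin.
rewrite lee_wpmul2l ?lee_fin ?w0//.
by apply: poweR_le; [exact: ltW|exact: c1_ge0|].
Qed.

Let measurable_weight D : measurable_fun D (fun x : R => ((m - 1) * x `^ r)%:E).
Proof.
apply/measurable_EFinP; apply: measurable_funM; first exact: measurable_cst.
by apply: measurable_funTS; exact: measurable_powR.
Qed.

Let integral_weight t : 0 < t ->
  (\int[mu]_(x in `]0%R, t]) ((m - 1) * x `^ r)%:E =
   (p / conjexp p * t `^ (q / p))%:E)%E.
Proof.
move=> t0; have r10 : 0 < 1 + r by rewrite ltr_wpDr.
have rE : r = 1 + r - 1 by rewrite addrAC subrr add0r.
rewrite -integral_itv_bndo_bndc; last exact: measurable_weight.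
transitivity ((m - 1)%:E * primitive (fun x => (x `^ (1 + r - 1))%:E) t%:E)%E.
  rewrite /primitive -ge0_integralZl; last 4 first.
  - exact: measurable_below.
  - exact: measurable_EFin_powR.
  - by move=> x _; rewrite lee_fin powR_ge0.
  - by rewrite lee_fin ltW.
  by rewrite below_itv; apply: eq_integral => x _; rewrite -rE.
rewrite primitive_powR// -EFinM; congr EFin.
rewrite r1E m1E; field; rewrite pn0 !gt_eqF//.
Qed.

Let weight_ge0 x : (0 <= ((m - 1) * x `^ r)%:E)%E.
Proof. by rewrite lee_fin mulr_ge0 ?powR_ge0// ltW. Qed.

Let measurable_on_finite_positive_set b : normal_form_parameter b -> measurable_fun (finite_positive_set b) b.
Proof.
move=> nfb; apply: measurable_funS (measurable_normal_form nfb) => //.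
by move=> x [x0 _] /=; rewrite in_itv/= x0.
Qed.

Let average_powerE g y : (forall s, 0 < s -> (0 <= g s)%E) -> 0 < y ->
  (average_power g q y * (y `^ r)%:E = primitive g y%:E `^ q * (y `^ (- m))%:E)%E.
Proof.
move=> g0 y0; rewrite /average_power poweRM ?primitive_ge0 ?lee_fin ?invr_ge0 ?(ltW y0)//.
rewrite poweR_EFin -muleA; congr (_ * _)%E; rewrite -EFinM; congr EFin; rewrite (powR_invl _ y0) -powRN !powR_expR// -expRD.
by congr expR; rewrite /m /r; field.
Qed.

Let measurable_tail b t : normal_form_parameter b ->
  measurable (finite_positive_set b `&` [set x | (fine (b x) <= t)%R]).
Proof.
move=> nfb; rewrite (_ : _ `&` _ = finite_positive_set b `&` [set x | (b x <= t%:E)%E]).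
  by apply: measurable_lee => //; [exact: measurable_finite_positive_set|exact: measurable_on_finite_positive_set].
have bE x : finite_positive_set b x -> b x = (fine (b x))%:E.
  by move=> [_ /andP[bx0 bxy]]; rewrite fineK// ge0_fin_numE// ltW.
apply/seteqP; split => x [Dx /= bt]; split => //=.
  by rewrite (bE _ Dx) lee_fin.
by rewrite -lee_fin -(bE _ Dx).
Qed.

(** For finite A = A1, [tail_integral_le] supplies the hypothesis of [comparison] against the power
    weight, with the identity as second map. By [average_powerE] the outcome is (m - 1) times the
    integral in [bliss_nincr]. If A1 is infinite, so is the bound, because K > 0. *)
Lemma opnorm_le_A1 b : normal_form_parameter b -> finite_valued b ->
  (opnorm p q b <= (Kconst p q)%:E * A1 p q b)%E.
Proof.
move=> nfb fb; have K0 := Kconst_gt0.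
have c1A t : 0 < t -> (c1 p q b t <= A1 p q b)%E.
  by move=> t0; apply: ereal_sup_ubound; exists t => //; apply/halflineP.
have A0 : (0 <= A1 p q b)%E := le_trans (c1_ge0 b 1) (c1A 1 ltr01).
case: (A1 p q b) A0 c1A => [A| |]//; last first.
  by move=> _ _; rewrite gt0_muley ?lte_fin// leey.
rewrite lee_fin => A0 c1A; apply: ereal_inf_lbound; split.
  by rewrite -EFinM lee_fin mulr_ge0// ltW.
move=> f Lf; have [g [g0 gn gH gp]] := pnorm_Hardy_rearrangement nfb p0 q0 Lf.
have g0' s : 0 < s -> (0 <= g s)%E by [].
have gn' s t : 0 < s -> s <= t -> (g t <= g s)%E by move=> _; exact: gn.
rewrite (le_trans gH)// gp.
have [B [B0 HB BK]] := bliss_constant p1 r0.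
have := bliss_nincr p1 r0 B0 HB g0' gn'.
rewrite -/m qE => HB'.
rewrite (pnorm_Hardy g0' gn' nfb q0) (pnorm_nincr g0' gn' p0).
set N := (\int[mu]_(x in _) g x `^ p)%E in HB' *.
have N0 : (0 <= N)%E by apply: integral_ge0 => x _; exact: poweR_ge0.
have key : (\int[mu]_(x in `]0%R, +oo[) primitive g (b x) `^ q <=
    (A `^ q)%:E * ((Kconst p q `^ q)%:E * N `^ (1 + r)))%E.
  rewrite -(integral_finite_positive_setE g0' nfb q0 fb).
  apply: (@le_trans _ _ ((A `^ q)%:E *
      \int[mu]_(y in `]0%R, +oo[) (average_power g q y * ((m - 1) * y `^ r)%:E))%E).
    apply: comparison => //.
    - exact: measurable_finite_positive_set.
    - by apply: measurableT_comp => //; exact: measurable_on_finite_positive_set.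
    - by apply: (measurableT_comp (measurable_poweR q)); exact: measurable_on_finite_positive_set.
    - exact: measurable_weight.
    - by move=> x [_ ax]; exact: fine_gt0.
    - by move=> x _; exact: poweR_ge0.
    - exact: powR_ge0.
    - move=> t t0; rewrite -tail_integralE//.
      rewrite (_ : _ `&` _ = `]0, t]%classic); last first.
        apply/seteqP; split => x /=; rewrite !in_itv/= andbT; first by move=> [-> ->].
        by move=> /andP[-> ->].
      by rewrite integral_weight// -EFinM tail_integral_le// c1A.
    - by move=> x x0; exact: poweR_ge0.
    - by move=> x y x0 xy; exact: average_power_nincr.
  rewrite lee_wpmul2l ?lee_fin ?powR_ge0//.
  have -> : (\int[mu]_(y in `]0%R, +oo[) (average_power g q y * ((m - 1) * y `^ r)%:E) =
      (m - 1)%:E *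
      \int[mu]_(x in `]0%R, +oo[) (primitive g x%:E `^ q * (x `^ (- m))%:E))%E.
    transitivity ((m - 1)%:E * \int[mu]_(y in `]0%R, +oo[) (average_power g q y * (y `^ r)%:E))%E.
      rewrite -ge0_integralZl; last 4 first.
      - exact: measurable_itv.
      - apply: emeasurable_funM; last exact: measurable_EFin_powR.
        by apply: nonincreasing_emeasurable => x y x0 xy; exact: average_power_nincr.
      - by move=> x _; rewrite mule_ge0 ?poweR_ge0// lee_fin powR_ge0.
      - by rewrite lee_fin ltW.
      by apply: eq_integral => y _; rewrite EFinM muleCA.
    congr (_ * _)%E.
    by apply: eq_integral => y /set_mem/pos y0; rewrite average_powerE.
  rewrite -qE -BK EFinM -muleA lee_wpmul2l ?lee_fin ?(ltW m10)//.
  by rewrite qE.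
apply: (@le_trans _ _ (((A `^ q)%:E * ((Kconst p q `^ q)%:E * N `^ (1 + r))) `^ q^-1)%E).
  apply: poweR_le => //; first by rewrite invr_ge0 ltW.
  by apply: integral_ge0 => x _; exact: poweR_ge0.
rewrite -!poweR_EFin poweRM ?poweR_ge0 ?mule_ge0 ?poweR_ge0//.
rewrite poweRM ?poweR_ge0// !poweRKV ?lee_fin ?(ltW K0)//.
rewrite -poweRrM muleA [(A%:E * _)%E]muleC.
have -> : (1 + r) * q^-1 = p^-1 by rewrite r1E; field; rewrite pn0 gt_eqF.
by [].
Qed.

Definition admissible b (C : R) : Prop := 0 <= C /\
  forall f, Lplus f -> (pnorm q (Hardy b f) <= C%:E * pnorm p f)%E.

Lemma opnorm_ge b (L : \bar R) :
  (forall C, admissible b C -> (L <= C%:E)%E) -> (L <= opnorm p q b)%E.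
Proof.
move=> LC; apply: le_ereal_inf_tmp => -[C| |] [].
- by rewrite lee_fin => C0 HC; apply: LC.
- by move=> _ _; exact: leey.
- by rewrite leeNy_eq.
Qed.

Section Admissible.
Variables (b : R -> \bar R) (C : R).
Hypotheses (nfb : normal_form_parameter b) (admC : admissible b C).

Let C0 : 0 <= C. Proof. by case: admC. Qed.

Let integral_primitive_le g (N : R) :
  (forall s, 0 < s -> (0 <= g s)%E) ->
  (forall s t, 0 < s -> s <= t -> (g t <= g s)%E) ->
  (\int[mu]_(x in `]0%R, +oo[) g x `^ p = N%:E)%E -> 0 <= N ->
  (\int[mu]_(x in `]0%R, +oo[) primitive g (b x) `^ q <= (C `^ q * N `^ (q / p))%:E)%E.
Proof.
move=> g0 gn gN N0; case: admC => _ /(_ _ (Lplus_nincr g0 gn)).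
rewrite (pnorm_Hardy g0 gn nfb q0) (pnorm_nincr g0 gn p0) gN.
have : (0 <= \int[mu]_(x in `]0%R, +oo[) primitive g (b x) `^ q)%E.
  by apply: integral_ge0 => x _; exact: poweR_ge0.
move: (\int[mu]_(x in _) _)%E => X X0 XC.
have := @poweR_le R q _ _ (ltW q0) (poweR_ge0 _ _) XC.
rewrite poweRVK// => /le_trans; apply.
have -> : (C%:E * N%:E `^ p^-1)%E = (C * N `^ p^-1)%:E by [].
change (((C * N `^ p^-1) `^ q)%:E <= (C `^ q * N `^ (q / p))%:E)%E.
by rewrite lee_fin powRM ?powR_ge0// -powRrM (mulrC p^-1).
Qed.

(** Tested on the indicator of (0, t): where b <= t its primitive at b is b itself, so the tail
    integral is at most C^q t^(q/p). *)
Lemma admissible_c1 t : 0 < t ->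
  (((p / conjexp p) `^ q^-1)%:E * c1 p q b t <= C%:E)%E.
Proof.
move=> t0; pose f x : \bar R := (if x < t then 1 else 0)%:E.
have f0 s : 0 < s -> (0 <= f s)%E by move=> _; rewrite /f; case: ifP; rewrite lee_fin.
have fn s u : 0 < s -> s <= u -> (f u <= f s)%E.
  move=> _ su; rewrite /f; case: (ltP u t) => ut; first by rewrite (le_lt_trans su ut).
  by case: ifP; rewrite lee_fin.
have fN : (\int[mu]_(x in `]0%R, +oo[) f x `^ p = t%:E)%E.
  have <- : mu (below t%:E) = t%:E by apply: lebesgue_measure_below; rewrite lee_fin ltW.
  rewrite -[RHS]mul1e -integral_cst; last exact: measurable_below.
  rewrite [LHS]integral_mkcond [RHS]integral_mkcond; apply: eq_integral => x _.
  rewrite !patchE; case: ifPn => [/set_mem/pos x0|/negP x0]; last first.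
    rewrite ifF//; apply/negP => /set_mem[x1 _]; apply: x0; apply/mem_set.
    by rewrite /= in_itv/= x1.
  rewrite /f; case: ltP => xt.
    by rewrite mem_set ?poweR1r//; split.
  rewrite memNset; last by move=> [_]; rewrite lte_fin ltNge xt.
  by rewrite poweR0r// gt_eqF.
have H := integral_primitive_le f0 fn fN (ltW t0).
have tailH : (tail_integral q b t <= (C `^ q * t `^ (q / p))%:E)%E.
  apply: le_trans H; rewrite tail_integralE//.
  apply: (@le_trans _ _ (\int[mu]_(x in finite_positive_set b `&` [set x | (fine (b x) <= t)%R])
      primitive f (b x) `^ q)%E).
    rewrite le_eqVlt; apply/orP; left; apply/eqP; apply: eq_integral => x /set_mem[[x0 /andP[bx0 bxy]] /= bt].
    congr (_ `^ _)%E.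
    have bE : b x = (fine (b x))%:E by rewrite fineK// ge0_fin_numE// ltW.
    rewrite -[LHS]lebesgue_measure_below; last exact: ltW.
    rewrite -[LHS]mul1e -integral_cst; last exact: measurable_below.
    apply: eq_integral => y /set_mem[y0 yb]; rewrite /f ifT//.
    by rewrite (lt_le_trans _ bt)// -lte_fin -bE.
  apply: ge0_subset_integral => //.
  - exact: measurable_tail.
  - exact: measurable_primitive_comp.
  - by move=> x _; exact: poweR_ge0.
  - by move=> x [[x0 _] _] /=; rewrite in_itv/= x0.
have k0 : 0 < (p / conjexp p) `^ q^-1 by rewrite powR_gt0.
have cE : ((((p / conjexp p) `^ q^-1)%:E * c1 p q b t) `^ q <= C%:E `^ q)%E.
  rewrite poweRM ?lee_fin ?powR_ge0 ?c1_ge0// c1_powR//.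
  have -> : (((p / conjexp p) `^ q^-1)%:E `^ q)%E = (p / conjexp p)%:E.
    by rewrite -poweR_EFin poweRVK// lee_fin ltW.
  rewrite muleA -EFinM.
  have -> : p / conjexp p * (conjexp p / p * t `^ (- (q / p))) = t `^ (- (q / p)).
    by field; rewrite pn0 gt_eqF.
  apply: (@le_trans _ _ ((t `^ (- (q / p)))%:E * (C `^ q * t `^ (q / p))%:E)%E).
    by rewrite lee_wpmul2l ?lee_fin ?powR_ge0.
  rewrite -EFinM mulrCA -[X in _ * X](_ : 1 = _) ?mulr1//.
  by rewrite !powR_expR// -expRD mulNr addNr expR0.
have := @poweR_le R q^-1 _ _ _ _ cE; rewrite !poweRKV ?lee_fin//; first last.
  by rewrite mule_ge0 ?c1_ge0// lee_fin powR_ge0.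
by apply; [rewrite invr_ge0 ltW|exact: poweR_ge0].
Qed.

Let primitive_dilation f (lam y : R) :
  (forall s, 0 < s -> (0 <= f s)%E) ->
  (forall s t, 0 < s -> s <= t -> (f t <= f s)%E) -> 0 < lam ->
  (primitive (fun t => f (lam * t)%R) (y / lam)%:E = (lam^-1)%:E * primitive f y%:E)%E.
Proof.
(* Cutting f at y leaves it non-increasing, so [power_substitution] with exponent 1 applies to the
   cut function. *)
move=> f0 fn lam0; pose phi x : \bar R := if x < y then f x else 0%E.
have phi0 s : 0 < s -> (0 <= phi s)%E by rewrite /phi; case: ifP => // _; exact: f0.
have phin s t : 0 < s -> s <= t -> (phi t <= phi s)%E.
  move=> s0 st; rewrite /phi; case: (ltP t y) => ty; last by case: ifP => // _; exact: f0.
  by rewrite (le_lt_trans st ty) fn.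
have := power_substitution phi0 phin lam0 ltr01 ltr01.
rewrite !divr1 (powR_expR _ lam0) mulN1r -lnV ?posrE// lnK ?posrE ?invr_gt0// => E.
have phiE (z : R) (g h : R -> \bar R) : (forall x, 0 < x -> g x = if x < z then h x else 0%E) ->
    (\int[mu]_(x in `]0%R, +oo[) (g x * (x `^ (1 - 1))%:E) = primitive h z%:E)%E.
  move=> gh; rewrite /primitive [LHS]integral_mkcond [RHS]integral_mkcond.
  apply: eq_integral => x _; rewrite !patchE.
  case: ifPn => [/set_mem/pos x0|/negP x0]; last first.
    rewrite ifF//; apply/negP => /set_mem[x1 _]; apply: x0; apply/mem_set.
    by rewrite /= in_itv/= x1.
  rewrite subrr powRr0 mule1 gh//; case: ltP => xz; first by rewrite mem_set.
  by rewrite memNset// => -[_]; rewrite lte_fin ltNge xz.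
rewrite -(phiE y phi f)// -E; symmetry; apply: phiE => x x0.
by rewrite powRr1 ?(ltW x0)// /phi ltr_pdivlMr// mulrC.
Qed.

(* The test function f is dilated so that the part of (0, oo) carrying almost
   all of its energy falls where the tails of b are large. *)
Lemma admissible_bliss_test f (k N al be A lam : R) :
  (forall s, 0 < s -> (0 <= f s)%E) ->
  (forall s t, 0 < s -> s <= t -> (f t <= f s)%E) ->
  0 < N -> 0 < al -> 0 < A -> 0 < lam ->
  (\int[mu]_(x in `]0%R, +oo[) f x `^ p = N%:E)%E ->
  ((k * N `^ (q / p))%:E <=
    \int[mu]_(x in `[al, be[) (average_power f q x * ((m - 1) * x `^ r)%:E))%E ->
  (forall t, al / lam <= t <= be / lam ->
    ((A `^ q * (p / conjexp p * t `^ (q / p)))%:E <= tail_integral q b t)%E) ->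
  A `^ q * k <= C `^ q.
Proof.
move=> f0 fn N0 al0 A0 lam0 fN fk tailA.
pose g x := f (lam * x).
have lx s : 0 < s -> 0 < lam * s by move=> s0; rewrite mulr_gt0.
have g0 s : 0 < s -> (0 <= g s)%E by move=> s0; exact/f0/lx.
have gn s t : 0 < s -> s <= t -> (g t <= g s)%E.
  by move=> s0 st; apply: fn; [exact: lx|rewrite ler_pM2l].
have gN : (\int[mu]_(x in `]0%R, +oo[) g x `^ p = (N / lam)%:E)%E.
  have fp0 s : 0 < s -> (0 <= f s `^ p)%E by move=> _; exact: poweR_ge0.
  have fpn s t : 0 < s -> s <= t -> (f t `^ p <= f s `^ p)%E.
    move=> s0 st; apply: poweR_le; [exact: ltW|exact/f0/(lt_le_trans s0)|exact: fn].
  have := power_substitution fp0 fpn lam0 ltr01 ltr01.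
  rewrite !divr1 (powR_expR _ lam0) mulN1r -lnV ?posrE// lnK ?posrE ?invr_gt0// => E.
  transitivity ((lam^-1)%:E * N%:E)%E; last by rewrite -EFinM mulrC.
  have E1 (h : R -> \bar R) (h' : R -> \bar R) : (forall x, 0 < x -> h x = h' x) ->
      (\int[mu]_(x in `]0%R, +oo[) h x =
       \int[mu]_(x in `]0%R, +oo[) (h' x * (x `^ (1 - 1))%:E))%E.
    by move=> hh; apply: eq_integral => x /set_mem/pos x0; rewrite subrr powRr0 mule1 hh.
  rewrite -fN (E1 (fun x => (f x `^ p)%E) (fun x => (f x `^ p)%E))// -E; apply: E1 => x x0.
  by rewrite powRr1// ltW.
have NL : 0 <= N / lam by rewrite divr_ge0 ?ltW.
have H := integral_primitive_le g0 gn gN NL.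
(* D undoes the factor A^q in the bound on the tails and the scaling of the weight: D A^q t^(q/p) =
   (lam t)^(q/p). *)
pose D := (A `^ q)^-1 * lam `^ (q / p).
have D0 : 0 < D by rewrite mulr_gt0 ?invr_gt0 ?powR_gt0.
have avg x : 0 < x -> average_power g q (x / lam) = average_power f q x.
  move=> x0; rewrite /average_power primitive_dilation// invf_div; congr (_ `^ _)%E.
  rewrite (muleC (lam^-1)%:E) -muleA -EFinM; congr (_ * _%:E)%E.
  by field; rewrite !gt_eqF.
have cmp : (\int[mu]_(x in `[al, be[) (average_power g q (x / lam) * ((m - 1) * x `^ r)%:E) <=
    D%:E * \int[mu]_(x in finite_positive_set b) (average_power g q (fine (b x)) * b x `^ q))%E.
  apply: comparison => //.
  - exact: measurable_finite_positive_set.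
  - by apply: measurable_funM.
  - by apply: measurableT_comp => //; exact: measurable_on_finite_positive_set.
  - exact: measurable_weight.
  - by apply: (measurableT_comp (measurable_poweR q)); exact: measurable_on_finite_positive_set.
  - by move=> x /=; rewrite in_itv/= => /andP[ax _]; rewrite divr_gt0// (lt_le_trans al0).
  - by move=> x [_ ax]; exact: fine_gt0.
  - by move=> x _; exact: poweR_ge0.
  - exact: ltW.
  - move=> t t0; rewrite -tail_integralE//.
    set S := _ `&` _.
    have [S0|/set0P[y0 [/= y0D y0t]]] := eqVneq S set0.
      by rewrite S0 integral_set0 mule_ge0 ?tail_integral_ge0// lee_fin ltW.
    have /andP[aly ybe] : al <= y0 < be by move: y0D; rewrite in_itv.
    (* The tails are controlled only up to be / lam. Beyond it the weight on [al, be) gains nothing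
       and the tail integral of b does not decrease, so t may be replaced by t'. *)
    pose t' := Num.min t (be / lam).
    have t't : t' <= t by rewrite ge_min lexx.
    have y0t' : y0 / lam <= t' by rewrite le_min y0t ler_pM2r ?invr_gt0// ltW.
    have t'0 : 0 < t' by apply: lt_le_trans y0t'; rewrite divr_gt0// (lt_le_trans al0).
    have lt'0 : 0 < lam * t' by rewrite mulr_gt0.
    have tl : (tail_integral q b t' <= tail_integral q b t)%E.
      rewrite !tail_integralE//; apply: ge0_subset_integral => //.
      + exact: measurable_tail.
      + exact: measurable_tail.
      + apply: measurable_funS (measurable_finite_positive_set nfb) _ _; first by move=> x [].
        by apply: (measurableT_comp (measurable_poweR q)); exact: measurable_on_finite_positive_set.
      + by move=> x _; exact: poweR_ge0.
      + by move=> x [Dx /= xt]; split => //=; exact: le_trans t't.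
    apply: (@le_trans _ _ (D%:E * (A `^ q * (p / conjexp p * t' `^ (q / p)))%:E)%E); last first.
      rewrite lee_wpmul2l ?lee_fin ?(ltW D0)//; apply: le_trans tl; apply: tailA.
      rewrite ge_min lexx orbT andbT; apply: le_trans y0t'.
      by rewrite ler_pM2r ?invr_gt0.
    rewrite -EFinM.
    have -> : D * (A `^ q * (p / conjexp p * t' `^ (q / p))) =
        p / conjexp p * (lam * t') `^ (q / p).
      rewrite powRM ?ltW// /D; have Aq := powR_gt0 q A0.
      by field; rewrite !gt_eqF.
    rewrite -integral_weight//; apply: ge0_subset_integral => //.
    + apply: measurableI => //; rewrite -[X in measurable X]setTI.
      by apply: measurable_fun_le => //; apply: measurable_funM.
    + exact: measurable_weight.
    + move=> x [/=]; rewrite !in_itv/= => /andP[ax xb] xt.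
      rewrite (lt_le_trans al0 ax)/= mulrC -ler_pdivrMr// le_min xt.
      by rewrite ler_pM2r ?invr_gt0// ltW.
  - by move=> x x0; exact: poweR_ge0.
  - by move=> x y x0 xy; exact: average_power_nincr.
have K1 : ((k * N `^ (q / p))%:E <= (D * (C `^ q * (N / lam) `^ (q / p)))%:E)%E.
  apply: (le_trans fk); apply: (@le_trans _ _ (D%:E *
      \int[mu]_(x in finite_positive_set b) (average_power g q (fine (b x)) * b x `^ q))%E).
    apply: le_trans cmp; rewrite le_eqVlt; apply/orP; left; apply/eqP.
    apply: eq_integral => x /set_mem/=; rewrite in_itv/= => /andP[ax _].
    by rewrite avg// (lt_le_trans al0).
  rewrite (EFinM D (_ * _)) lee_wpmul2l ?lee_fin ?(ltW D0)//.
  by apply: le_trans H; exact: integral_finite_positive_set_le.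
move: K1; rewrite lee_fin.
have Nq : 0 < N `^ (q / p) by rewrite powR_gt0.
have Aq := powR_gt0 q A0; have lq := powR_gt0 (q / p) lam0.
rewrite powRM ?invr_ge0 ?(ltW N0) ?(ltW lam0)// (powR_invl _ lam0) /D.
have -> : (A `^ q)^-1 * lam `^ (q / p) * (C `^ q * (N `^ (q / p) / lam `^ (q / p))) =
    C `^ q / A `^ q * N `^ (q / p) by field; rewrite !gt_eqF.
by rewrite ler_pM2r// ler_pdivlMr// mulrC.
Qed.

End Admissible.

Lemma opnorm_ge_A1 b : normal_form_parameter b ->
  (((p / conjexp p) `^ q^-1)%:E * A1 p q b <= opnorm p q b)%E.
Proof.
move=> nfb; apply: opnorm_ge => C admC.
have k0 : 0 < (p / conjexp p) `^ q^-1 by rewrite powR_gt0.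
rewrite -lee_pdivlMl//; apply: ge_ereal_sup => _ [t /halflineP t0 <-].
by rewrite lee_pdivlMl//; exact: admissible_c1.
Qed.

Let lt_limf_einf (h : R -> \bar R) (F : set (set R)) (A : R) :
  (A%:E < limf_einf h F)%E -> exists2 V, F V & forall t, V t -> (A%:E <= h t)%E.
Proof.
rewrite limf_einfE => /ereal_sup_gt[_ [V FV <-]] AV; exists V => // t Vt.
by apply: (le_trans (ltW AV)); apply: ereal_inf_lbound; exists t.
Qed.

(** Covers both ends of the half-line: all that is used of L is that, for A < L, some dilation
    carries a given [al, be] into the region where c1 >= A. If C < K A, a test function for some k
    strictly between (C/A)^q and K^q is contradictory. *)
Lemma opnorm_ge_Kconst b (L : \bar R) : normal_form_parameter b ->
  (forall A al be : R, 0 < A -> (A%:E < L)%E -> 0 < al ->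
    exists2 lam, 0 < lam & forall t, al / lam <= t <= be / lam -> (A%:E <= c1 p q b t)%E) ->
  ((Kconst p q)%:E * L <= opnorm p q b)%E.
Proof.
move=> nfb HL; apply: opnorm_ge => C [C0 HC].
have K0 := Kconst_gt0.
have key A : 0 < A -> (A%:E < L)%E -> Kconst p q * A <= C.
  move=> A0 AL; rewrite leNgt; apply/negP => CK.
  have : C `^ q < (Kconst p q * A) `^ q.
    by apply: gt0_ltr_powR; rewrite ?nnegrE// mulr_ge0// ltW.
  rewrite powRM ?(ltW K0) ?(ltW A0)// -ltr_pdivrMr ?powR_gt0// => CAK.
  have CA0 : 0 <= C `^ q / A `^ q by rewrite divr_ge0 ?powR_ge0.
  pose k := (C `^ q / A `^ q + Kconst p q `^ q) / 2.
  have k1 : C `^ q / A `^ q < k by rewrite /k; lra.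
  have k2 : k < Kconst p q `^ q by rewrite /k; lra.
  have kK : 0 < k < Kconst p (p * (1 + r)) `^ (p * (1 + r)).
    by rewrite qE k2 (le_lt_trans CA0 k1).
  have [f [f0 fn [N [al [be [N0 al0 fN]]]]]] := exists_bliss_test p1 r0 kK.
  rewrite qE r1E => fk.
  have [lam lam0 Hlam] := HL A al be A0 AL al0.
  have := @admissible_bliss_test b C nfb (conj C0 HC) f k N al be A lam
    f0 fn N0 al0 A0 lam0 fN fk.
  have tailA t : al / lam <= t <= be / lam ->
      ((A `^ q * (p / conjexp p * t `^ (q / p)))%:E <= tail_integral q b t)%E.
    move=> /[dup] /andP[alt _] /Hlam; apply: le_tail_integral; last exact: ltW.
    by rewrite (lt_le_trans _ alt)// divr_gt0.
  move=> /(_ tailA); rewrite leNgt => /negP; apply.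
  by rewrite mulrC -ltr_pdivrMr// powR_gt0.
rewrite -lee_pdivlMl// -EFinM leNgt; apply/negP => CL.
have KC0 : 0 <= (Kconst p q)^-1 * C by rewrite mulr_ge0// invr_ge0 ltW.
have [A CA AL] : exists2 A, (Kconst p q)^-1 * C < A & (A%:E < L)%E.
  case: L CL {HL key} => [l| |]//.
    rewrite lte_fin => Cl; exists (((Kconst p q)^-1 * C + l) / 2); rewrite ?lte_fin; lra.
  by move=> _; exists ((Kconst p q)^-1 * C + 1); rewrite ?ltry// ltrDl.
have := key A (le_lt_trans KC0 CA) AL; rewrite leNgt => /negP; apply.
by rewrite -ltr_pdivrMl.
Qed.

Lemma opnorm_ge_A1_zero b : normal_form_parameter b ->
  ((Kconst p q)%:E * A1_zero p q b <= opnorm p q b)%E.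
Proof.
move=> nfb; apply: opnorm_ge_Kconst => // A al be A0 /lt_limf_einf[V [d /= d0 Hd] HV] al0.
(* No sign of be is known, hence the maximum with 1. Division by 2 M / d brings be to at most d / 2,
   inside the given neighbourhood of 0. *)
pose M := Num.max be 1; have M0 : 0 < M by rewrite lt_max ltr01 orbT.
exists (2 * M / d); first by rewrite divr_gt0// mulr_gt0.
have l0 : 0 < 2 * M / d by rewrite divr_gt0// mulr_gt0.
move=> t /andP[alt tbe]; apply: HV; apply: Hd; last first.
  by rewrite (lt_le_trans _ alt)// divr_gt0.
have t0 : 0 < t by rewrite (lt_le_trans _ alt)// divr_gt0.
rewrite /ball_/= sub0r normrN gtr0_norm// (le_lt_trans tbe)//.
rewrite ltr_pdivrMr//.
have -> : d * (2 * M / d) = 2 * M by field; rewrite gt_eqF.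
have : be <= M by rewrite /M le_max lexx.
lra.
Qed.

Lemma opnorm_ge_A1_infty b : normal_form_parameter b ->
  ((Kconst p q)%:E * A1_infty p q b <= opnorm p q b)%E.
Proof.
move=> nfb; apply: opnorm_ge_Kconst => // A al be A0 /lt_limf_einf[V [M [_ HM]] HV] al0.
(* M may be negative; M' is positive and exceeds M. Division by al / M' moves the left end al to
   M'. *)
pose M' := Num.max M 0 + 1.
have M'0 : 0 < M' by rewrite ltr_wpDl// le_max lexx orbT.
exists (al / M'); first by rewrite divr_gt0.
move=> t /andP[alt _]; apply: HV; apply: HM; apply: lt_le_trans alt.
have -> : al / (al / M') = M' by field; rewrite !gt_eqF.
by rewrite (@le_lt_trans _ _ (Num.max M 0)) ?le_max ?lexx// ltrDl.
Qed.

End OperatorNorm.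

Unset Implicit Arguments.
Set Strict Implicit.
Set Printing Implicit Defensive.

Theorem theorem3p15 (R : realType) (p q : R) (hp : 1 < p) (hq : 0 < q) :
  (forall (a b : R -> \bar R) (C : R),
     normal_form_parameter a -> normal_form_parameter b -> 0 < C ->
     finite_valued a ->
     (forall t : R, 0 < t ->
        (tail_integral q a t <= C%:E * tail_integral q b t)%E) ->
     (opnorm p q a <= (C `^ q^-1)%:E * opnorm p q b)%E) /\
  (p <= q -> forall b : R -> \bar R, normal_form_parameter b ->
     (Order.max (((p / conjexp p) `^ q^-1)%:E * A1 p q b)
        (Order.max ((Kconst p q)%:E * A1_zero p q b)
                   ((Kconst p q)%:E * A1_infty p q b))
      <= opnorm p q b)%E /\
     (finite_valued b -> (opnorm p q b <= (Kconst p q)%:E * A1 p q b)%E)) /\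
  (p <= q -> forall b : R -> \bar R, normal_form_parameter b ->
     finite_valued b ->
     A1_zero p q b = A1 p q b \/ A1_infty p q b = A1 p q b ->
     opnorm p q b = ((Kconst p q)%:E * A1 p q b)%E).
Proof.
have p0 : 0 < p := lt_trans ltr01 hp.
split; first by move=> a b C nfa nfb C0 fa; exact: opnorm_le_of_tails.
split=> pq b nfb.
  split; last exact: opnorm_le_A1.
  rewrite !ge_max; apply/and3P; split.
  - exact: opnorm_ge_A1.
  - exact: opnorm_ge_A1_zero.
  - exact: opnorm_ge_A1_infty.
move=> fb AE; apply/le_anti/andP; split; first exact: opnorm_le_A1.
by case: AE => <-; [exact: opnorm_ge_A1_zero|exact: opnorm_ge_A1_infty].
Qed.
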